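(* Suppose that $\varphi$ is a hyperbolic automorphism of $\mathbb{D}$ with attractive fixed point $a\in\mathbb{T}$ and repelling fixed point $b\in\mathbb{T}$. Let $W_{h,\varphi}$ be a weighted composition operator on $\mathcal{D}$, determined by an $h\in\mathcal{M}(\mathcal{D})$ that is continuous at $a$ and $b$. Let $0<\mu<1$ be such that $\varphi$ is conjugate to the automorphism $$\psi(z)=\frac{(1+\mu)z+(1-\mu)}{(1-\mu)z+(1+\mu)}.$$ If $W_{h,\varphi}$ is invertible, then $$\rho(W_{h,\varphi})\le\max\{|h(a)|,|h(b)|\}/\mu.$$ Hence $\sigma(W_{h,\varphi})$ is contained in the annulus $$\{\lambda\in\mathbb{C}:\ \min\{|h(a)|,|h(b)|\}\,\mu\le|\lambda|\le\max\{|h(a)|,|h(b)|\}/\mu\}.$$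
   Context: $\mathbb{D}$ is the open unit disc in $\mathbb{C}$, $\mathbb{T}=\partial\mathbb{D}$ is the unit circle, and $A$ is normalized Lebesgue area measure on $\mathbb{D}$. The Dirichlet space $\mathcal{D}$ is the space of holomorphic $f$ on $\mathbb{D}$ with $\|f\|_{\mathcal{D}}^2=|f(0)|^2+\int_{\mathbb{D}}|f'(z)|^2\,dA(z)<\infty$. $\mathcal{M}(\mathcal{D})$ is the algebra of multipliers of $\mathcal{D}$, i.e. the functions $u$ on $\mathbb{D}$ such that $uf\in\mathcal{D}$ for every $f\in\mathcal{D}$. For $h\in\mathcal{M}(\mathcal{D})$ and $\varphi$ an automorphism of $\mathbb{D}$, $(W_{h,\varphi}f)(z)=h(z)f(\varphi(z))$ defines a bounded operator on $\mathcal{D}$; $\sigma(W_{h,\varphi})$ and $\rho(W_{h,\varphi})$ are its spectrum and spectral radius, and invertibility is meant as a bounded operator on $\mathcal{D}$. An automorphism $\varphi(z)=e^{i\theta}\frac{p-z}{1-\overline{p}z}$, with $p\in\mathbb{D}$ and $-\pi<\theta\le\pi$, is hyperbolic if $|p|>\cos(\theta/2)$; it then fixes exactly two points, both on $\mathbb{T}$, one attractive (the iterates of $\varphi$ converge to it on $\mathbb{D}$) and the other repelling. ''Conjugate'' means conjugate by an automorphism of $\mathbb{D}$: $\varphi=\alpha^{-1}\circ\psi\circ\alpha$ for some automorphism $\alpha$ of $\mathbb{D}$. ''$h$ is continuous at $c\in\mathbb{T}$'' means that $h$ extends continuously to $\mathbb{D}\cup\{c\}$, with $h(c)=\lim_{z\to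 c,\,z\in\mathbb{D}}h(z)$. *)

(* Defs.v *)
From mathcomp Require Import all_boot all_order all_algebra.
From mathcomp Require Import complex.
From mathcomp Require Import all_classical all_reals all_analysis.
Set Implicit Arguments.
Unset Strict Implicit.
Unset Printing Implicit Defensive.
Import Order.TTheory GRing.Theory Num.Theory.
Import numFieldNormedType.Exports.
Local Open Scope classical_set_scope.
Local Open Scope ring_scope.
Local Open Scope complex_scope.

Section Disc.
Context {R : realType}.
Local Notation C := R[i].

(* The modulus as an element of R: the norm `|z| of R[i] has values in R[i]. *)
Definition modulus (z : C) : R := ComplexField.Normc.normc z.

Definition disc : set C := [set z | modulus z < 1].
Definition circle : set C := [set z | modulus z = 1].

(* Complex differentiability at every point of the disc; the disc being open,
   the values of f elsewhere are irrelevant. *)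
Definition holomorphic_on_disc (f : C -> C) : Prop :=
  forall z, disc z -> derivable (f : C^o -> C^o) z 1.

Definition mutually_inverse_on_disc (alpha beta : C -> C) : Prop :=
  [/\ forall z, disc z -> disc (alpha z),
      forall z, disc z -> disc (beta z),
      forall z, disc z -> beta (alpha z) = z
    & forall z, disc z -> alpha (beta z) = z].

Definition conjugate_on_disc (phi psi : C -> C) : Prop :=
  exists alpha beta : C -> C,
    [/\ holomorphic_on_disc alpha, holomorphic_on_disc beta,
        mutually_inverse_on_disc alpha beta
      & forall z, disc z -> phi z = beta (psi (alpha z))].

Definition disc_automorphism (p : C) (theta : R) (z : C) : C :=
  (cos theta +i* sin theta) * ((p - z) / (1 - p^* * z)).

(* An automorphism extends to the closed disc by the same formula; the
   extension is what gives a meaning to fixed points on the circle. *)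
Definition hyperbolic_automorphism (phi : C -> C) : Prop :=
  exists (p : C) (theta : R),
    [/\ disc p, - pi < theta <= pi, cos (theta / 2) < modulus p
      & forall z, modulus z <= 1 -> phi z = disc_automorphism p theta z].

Definition attractive_fixed_point (phi : C -> C) (a : C) : Prop :=
  [/\ circle a, phi a = a
    & forall z, disc z -> (iter n phi z : C^o) @[n --> \oo] --> (a : C^o)].

(* A hyperbolic automorphism has exactly two fixed points, both on the circle:
   the repelling one is the one which is not attractive. *)
Definition repelling_fixed_point (phi : C -> C) (b : C) : Prop :=
  [/\ circle b, phi b = b & ~ attractive_fixed_point phi b].

Definition psi_automorphism (mu : R) (z : C) : C :=
  ((1 + mu)%:C * z + (1 - mu)%:C) / ((1 - mu)%:C * z + (1 + mu)%:C).

Definition disc_limit (h : C -> C) (c l : C) : Prop :=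
  (h : C^o -> C^o) z @[z --> within disc (nbhs (c : C^o))] --> (l : C^o).

(* A function on the disc is represented by its extension by 0 to the whole
   plane, so that equality of functions on the disc is Leibniz equality. *)
Definition on_disc (f : C -> C) : Prop := forall z, ~ disc z -> f z = 0.

Definition dirichlet_integral (f : C -> C) : \bar R :=
  ((pi^-1)%:E *
   \int[(lebesgue_measure \x lebesgue_measure)%E]_(w in
          [set w : R * R | disc (w.1 +i* w.2)])
     ((modulus ('D_1 (f : C^o -> C^o) (w.1 +i* w.2))) ^+ 2)%:E)%E.

Definition dirichlet (f : C -> C) : Prop :=
  [/\ on_disc f, holomorphic_on_disc f & (dirichlet_integral f < +oo)%E].

Definition dirichlet_norm (f : C -> C) : R :=
  Num.sqrt (modulus (f 0) ^+ 2 + fine (dirichlet_integral f)).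

Definition multiplier (u : C -> C) : Prop :=
  on_disc u /\ forall f, dirichlet f -> dirichlet (fun z => u z * f z).

(* Operators on the Dirichlet space are maps on C -> C of which only the
   restriction to the Dirichlet space matters. *)
Definition bounded_operator (T : (C -> C) -> (C -> C)) : Prop :=
  [/\ forall f, dirichlet f -> dirichlet (T f),
      forall (k : C) f g, dirichlet f -> dirichlet g ->
        T (fun z => k * f z + g z) = (fun z => k * T f z + T g z)
    & exists M : R, forall f, dirichlet f ->
        dirichlet_norm (T f) <= M * dirichlet_norm f].

Definition invertible_operator (T : (C -> C) -> (C -> C)) : Prop :=
  bounded_operator T /\
  exists S : (C -> C) -> (C -> C),
    [/\ bounded_operator S,
        forall f, dirichlet f -> S (T f) = f
      & forall f, dirichlet f -> T (S f) = f].

Definition spectrum (T : (C -> C) -> (C -> C)) : set C :=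
  [set l | ~ invertible_operator (fun f z => T f z - l * f z)].

Definition spectral_radius (T : (C -> C) -> (C -> C)) : \bar R :=
  ereal_sup [set (modulus l)%:E | l in spectrum T].

(* Extended by 0 off the disc as soon as h is. *)
Definition weighted_composition (h phi : C -> C) (f : C -> C) : C -> C :=
  fun z => h z * f (phi z).

End Disc.

(* Main.v *)
Require Import Defs.
From mathcomp Require Import all_boot all_order all_algebra.
From mathcomp Require Import complex ring lra.
From mathcomp Require Import all_classical all_reals all_analysis.
From mathcomp Require Import measurable_realfun.

(** Why the theorem is true.

    In the coordinate [(z - a) / (z - b)] the automorphism [phi] is multiplication
    by a constant of modulus less than [1].  Hence every orbit spends all but a
    bounded number of its steps close to [a] or to [b], with a bound that does not
    depend on the starting point, and there [|h|] is close to [|ha|] or to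
    [|hb|].  So for every [L] greater than both the modulus of the product of [h]
    along [n] steps of an orbit is at most [c * L ^+ n] ([orbit_product]).

    The [n]th power of [W] maps [f] to this product times [f o phi_n], where
    [phi_n] is the [n]th iterate.  Composition with an automorphism preserves the
    Dirichlet integral; here it is shown to multiply it by at most a constant that
    is the same for all automorphisms ([dirichlet_comp]), so that composition
    with [phi_n] has a norm that is polynomial in [n] ([iterate_Nsq]).  The
    derivative of the product involves [n] terms with the derivative of one
    factor [h o phi_k]; they are controlled because multiplication by [h o phi_k]
    is conjugate, through the composition with [phi_k], to multiplication by [h]
    ([wprod_Nsq]).  Thus the norm of the [n]th power of [W] is at most a
    polynomial in [n] times [L ^+ n], and for [|l| > L] the Neumann series of
    [1 - W / l] converges ([invertible_of_orbit_products]).  The inverse of [W] is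
    a weighted composition operator too, with the weight [1 / h] moved by the
    inverse of [phi] ([inverse_weighted_composition]), and the same reasoning
    applied to it deals with [|l|] less than both [|ha|] and [|hb|].  The spectrum
    lies therefore between the minimum and the maximum of [|ha|] and [|hb|]
    ([spectrum_annulus]), and [mu < 1] gives the bounds of the theorem.

    All of this rests on some complex analysis of functions that are merely known
    to be complex differentiable.  Goursat's theorem expresses the derivative at
    a point as an integral of [f (z + w) / w ^+ 2] over squares ([goursat],
    [sqint_derivative]); it follows that the derivative is continuous, and that
    it is bounded at the origin by the Dirichlet integral ([holo_cderive_cont],
    [cderive0_bound]).  The change of variables is replaced by a comparison of the
    areas of small squares and of their preimages, which costs a constant factor
    ([area_comparison]).  Bisection of squares ([bisection_ind]) is the form of
    compactness that is used throughout.  The squared norm is [Nsq], its part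
    without the value at the origin is [Dsq]. *)


Import Order.TTheory GRing.Theory Num.Theory.
Import numFieldNormedType.Exports.
Set Implicit Arguments.
Unset Strict Implicit.
Unset Printing Implicit Defensive.
Local Open Scope classical_set_scope.
Local Open Scope ring_scope.
Local Open Scope complex_scope.
Local Notation Re := complex.Re.
Local Notation Im := complex.Im.
Local Notation minr := Num.min.
Local Notation maxr := Num.max.
Local Notation mu := (@lebesgue_measure _).
Local Notation mu2 := (mu \x mu)%E.

(** * Modulus and complex differentiability *)

Arguments modulus : simpl never.

Ltac abs_lra := rewrite ler_norml; apply/andP; split; lra.

Lemma le_of_eq (d : Order.disp_t) (T : porderType d) (x y : T) : x = y -> (x <= y)%O.
Proof. by move=> ->. Qed.

Section Modulus.
Context {R : realType}.
Local Notation C := R[i].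
Implicit Types (z w : C) (x y : R).

Lemma norm_modulus z : `|z| = (modulus z)%:C.
Proof. by []. Qed.

Lemma modulus_ge0 z : 0 <= modulus z.
Proof. by rewrite -lecR -norm_modulus normr_ge0. Qed.

Lemma modulus0 : modulus (0 : C) = 0.
Proof. by apply: complexI; rewrite -norm_modulus normr0. Qed.

Lemma modulus1 : modulus (1 : C) = 1.
Proof. by apply: complexI; rewrite -norm_modulus normr1. Qed.

Lemma modulus_eq0 z : (modulus z == 0) = (z == 0).
Proof.
apply/eqP/eqP => [|->]; last exact: modulus0.
exact: ComplexField.Normc.eq0_normc.
Qed.

Lemma modulus_gt0 z : (0 < modulus z) = (z != 0).
Proof. by rewrite lt_neqAle modulus_ge0 andbT eq_sym modulus_eq0. Qed.

Lemma modulusM z w : modulus (z * w) = modulus z * modulus w.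
Proof. exact: ComplexField.Normc.normcM. Qed.

Lemma modulusV z : modulus z^-1 = (modulus z)^-1.
Proof. exact: ComplexField.Normc.normcV. Qed.

Lemma modulus_mul_eq1 z w : z * w = 1 -> z != 0 /\ (modulus z)^-1 = modulus w.
Proof.
move=> zw; have z0 : z != 0.
  by apply/eqP => z0; move: zw; rewrite z0 mul0r => /eqP; rewrite eq_sym oner_eq0.
by split; [exact: z0|rewrite -modulusV -[z^-1]mulr1 -zw mulKf].
Qed.

Lemma modulusX z n : modulus (z ^+ n) = modulus z ^+ n.
Proof.
elim: n => [|n IH]; first by rewrite !expr0 modulus1.
by rewrite !exprS modulusM IH.
Qed.

Lemma modulusN z : modulus (- z) = modulus z.
Proof. exact: normcN. Qed.

Lemma modulusBC z w : modulus (z - w) = modulus (w - z).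
Proof. by rewrite -modulusN opprB. Qed.

Lemma le_modulusD z w : modulus (z + w) <= modulus z + modulus w.
Proof. exact: le_normcD. Qed.

Lemma le_modulusB z w : modulus (z - w) <= modulus z + modulus w.
Proof. by rewrite -(modulusN w) le_modulusD. Qed.

Lemma modulusD_le z w x y : modulus z <= x -> modulus w <= y -> modulus (z + w) <= x + y.
Proof. by move=> zx wy; apply: le_trans (le_modulusD _ _) _; exact: lerD. Qed.

Lemma modulusB_le z w x y : modulus z <= x -> modulus w <= y -> modulus (z - w) <= x + y.
Proof. by move=> zx wy; apply: modulusD_le; rewrite ?modulusN. Qed.

Lemma modulus_sub_ge z w : modulus z - modulus w <= modulus (z - w).
Proof. by rewrite lerBlDr; have := le_modulusD (z - w) w; rewrite subrK. Qed.

Lemma modulus_real x : modulus (x%:C) = `|x|.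
Proof. by rewrite /modulus /= expr0n /= addr0 sqrtr_sqr. Qed.

Lemma modulus_sqr z : modulus z ^+ 2 = Re z ^+ 2 + Im z ^+ 2.
Proof. by case: z => x y; rewrite sqr_sqrtr ?addr_ge0 ?sqr_ge0. Qed.

Lemma modulus_i : modulus ('i : C) = 1.
Proof. by rewrite /modulus /= expr0n /= expr1n add0r sqrtr1. Qed.

Lemma Re_le_modulus z : `|Re z| <= modulus z.
Proof.
rewrite -(ler_pXn2r (n := 2)) ?nnegrE ?normr_ge0 ?modulus_ge0 //.
by rewrite modulus_sqr real_normK ?num_real // lerDl sqr_ge0.
Qed.

Lemma Im_le_modulus z : `|Im z| <= modulus z.
Proof.
rewrite -(ler_pXn2r (n := 2)) ?nnegrE ?normr_ge0 ?modulus_ge0 //.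
by rewrite modulus_sqr real_normK ?num_real // lerDr sqr_ge0.
Qed.

Lemma modulus_le_ReIm z : modulus z <= `|Re z| + `|Im z|.
Proof.
rewrite -(ler_pXn2r (n := 2)) ?nnegrE ?addr_ge0 ?normr_ge0 ?modulus_ge0 //.
rewrite modulus_sqr sqrrD !real_normK ?num_real //.
by rewrite addrAC lerDl mulrn_wge0 // mulr_ge0.
Qed.

Lemma Re_add z w : Re (z + w) = Re z + Re w. Proof. by case: z w => a b [c d]. Qed.
Lemma Im_add z w : Im (z + w) = Im z + Im w. Proof. by case: z w => a b [c d]. Qed.
Lemma Re_opp z : Re (- z) = - Re z. Proof. by case: z. Qed.
Lemma Im_opp z : Im (- z) = - Im z. Proof. by case: z. Qed.
Lemma Re_mul z w : Re (z * w) = Re z * Re w - Im z * Im w.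
Proof. by case: z w => a b [c d]. Qed.
Lemma Im_mul z w : Im (z * w) = Re z * Im w + Im z * Re w.
Proof. by case: z w => a b [c d]. Qed.

Lemma complex_eqP z w : Re z = Re w -> Im z = Im w -> z = w.
Proof. by case: z w => a b [c d] /= -> ->. Qed.

(** The triangle inequality for squares, with the constant that makes it
    polynomial; it replaces the exact triangle inequality for the norm. *)
Lemma sqr_modulusD z w :
  modulus (z + w) ^+ 2 <= 2 * modulus z ^+ 2 + 2 * modulus w ^+ 2.
Proof.
rewrite !modulus_sqr Re_add Im_add.
have := sqr_ge0 (Re z - Re w); have := sqr_ge0 (Im z - Im w).
rewrite !sqrrD !sqrrN; lra.
Qed.

End Modulus.

Section ComplexDerivative.
Context {R : realType}.
Local Notation C := R[i].
Implicit Types (f g : C -> C) (z w d : C).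

(** Complex differentiability at a point, with the modulus as an element of
    [R]: the form in which all estimates are made. *)
Definition cdiff f z d := forall e : R, 0 < e -> exists2 r : R, 0 < r &
  forall w, modulus (w - z) < r ->
    modulus (f w - f z - d * (w - z)) <= e * modulus (w - z).

Definition ccont f z := forall e : R, 0 < e -> exists2 r : R, 0 < r &
  forall w, modulus (w - z) < r -> modulus (f w - f z) <= e.

Lemma cdiff_cont f z d : cdiff f z d -> ccont f z.
Proof.
move=> fz e e0; have [r r0 H] := fz 1 ltr01.
pose K := 1 + modulus d.
have K0 : 0 < K by rewrite ltr_pwDl ?modulus_ge0.
exists (minr r (e / K)); first by rewrite lt_min r0 divr_gt0.
move=> w; rewrite lt_min => /andP[wr we].
have -> : f w - f z = (f w - f z - d * (w - z)) + d * (w - z) by rewrite subrK.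
apply: (le_trans (le_modulusD _ _)); rewrite modulusM.
have := H _ wr; rewrite mul1r => h.
apply: (@le_trans _ _ (K * modulus (w - z))).
  by rewrite mulrDl mul1r lerD2r.
by rewrite mulrC -ler_pdivlMr // ltW.
Qed.

Lemma ccont_bounded f z : ccont f z ->
  exists2 r : R, 0 < r & forall w, modulus (w - z) < r ->
    modulus (f w) <= modulus (f z) + 1.
Proof.
move=> /(_ 1 ltr01)[r r0 H]; exists r => // w /H h.
by rewrite -lerBlDl (le_trans (modulus_sub_ge _ _)).
Qed.

Lemma cdiff_eq f z d d' : d = d' -> cdiff f z d -> cdiff f z d'.
Proof. by move=> ->. Qed.

Lemma cdiff_near f g z d (s : R) : 0 < s ->
  (forall w, modulus (w - z) < s -> f w = g w) -> cdiff f z d -> cdiff g z d.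
Proof.
move=> s0 fg fz e e0; have [r r0 H] := fz e e0.
exists (minr r s); first by rewrite lt_min r0.
move=> w; rewrite lt_min => /andP[wr ws].
rewrite -fg // -(fg z) ?subrr ?modulus0 //; exact: H.
Qed.

Lemma cdiff_cst c z : cdiff (fun=> c) z 0.
Proof.
move=> e e0; exists 1 => // w _.
by rewrite subrr mul0r subrr modulus0 mulr_ge0 ?modulus_ge0 ?ltW.
Qed.

Lemma cdiff_id z : cdiff id z 1.
Proof.
move=> e e0; exists 1 => // w _.
by rewrite mul1r subrr modulus0 mulr_ge0 ?modulus_ge0 ?ltW.
Qed.

Lemma ccontM f g z : ccont f z -> ccont g z -> ccont (fun w => f w * g w) z.
Proof.
move=> fz gz e e0.
pose A := modulus (g z) + 1; pose B := modulus (f z) + 1.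
have A0 : 0 < A by rewrite ltr_wpDl ?modulus_ge0.
have B0 : 0 < B by rewrite ltr_wpDl ?modulus_ge0.
have e2 : 0 < e / 2 by rewrite divr_gt0.
have [r1 r10 H1] := fz _ (divr_gt0 e2 A0).
have [r2 r20 H2] := gz _ (divr_gt0 e2 B0).
have [r3 r30 H3] := ccont_bounded gz.
exists (minr (minr r1 r2) r3); first by rewrite !lt_min r10 r20.
move=> w; rewrite !lt_min => /andP[/andP[/H1 h1 /H2 h2] /H3 h3].
have -> : f w * g w - f z * g z = (f w - f z) * g w + f z * (g w - g z) by ring.
rewrite [e]splitr; apply: modulusD_le; rewrite modulusM.
  apply: (@le_trans _ _ (e / 2 / A * A)); last by rewrite divfK // gt_eqF.
  by apply: ler_pM => //; exact: modulus_ge0.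
apply: (@le_trans _ _ (B * (e / 2 / B))); last by rewrite mulrC divfK // gt_eqF.
by apply: ler_pM; rewrite ?modulus_ge0 // lerDl.
Qed.

Lemma ccontD f g z : ccont f z -> ccont g z -> ccont (fun w => f w + g w) z.
Proof.
move=> fz gz e e0; have e20 : 0 < e / 2 by rewrite divr_gt0.
have [r1 r10 H1] := fz _ e20; have [r2 r20 H2] := gz _ e20.
exists (minr r1 r2); first by rewrite lt_min r10.
move=> w; rewrite lt_min => /andP[/H1 h1 /H2 h2].
rewrite opprD addrACA; apply: (le_trans (le_modulusD _ _)).
by rewrite [e]splitr lerD.
Qed.

Lemma ccont_comp f g z : ccont g z -> ccont f (g z) -> ccont (fun w => f (g w)) z.
Proof.
move=> gz fz e e0; have [r r0 H] := fz _ e0.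
have r20 : 0 < r / 2 by rewrite divr_gt0.
have [s s0 K] := gz _ r20; exists s => // w /K h.
by apply: H; apply: le_lt_trans h _; rewrite ltr_pdivrMr // ltr_pMr ?ltr1n.
Qed.

Lemma ccont_cst c z : ccont (fun=> c) z.
Proof. exact: (cdiff_cont (cdiff_cst c z)). Qed.

(** Caratheodory's form of the derivative, from which the rules of calculus
    follow algebraically. *)
Lemma cdiffP f z d : cdiff f z d <->
  exists2 q : C -> C, q z = d /\ ccont q z & forall w, f w - f z = q w * (w - z).
Proof.
split=> [fz|[q [<- qz] fq] e /qz[r r0 H]]; last first.
  exists r => // w wr; rewrite fq -mulrBl modulusM.
  by apply: ler_wpM2r; [exact: modulus_ge0|exact: H].
exists (fun w => if w == z then d else (f w - f z) / (w - z)).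
  rewrite eqxx; split=> // e e0; have [r r0 H] := fz e e0; exists r => // w wr.
  rewrite eqxx; case: eqVneq => [_|wz]; first by rewrite subrr modulus0 ltW.
  rewrite -subr_eq0 in wz; rewrite -(ler_pM2r (_ : 0 < modulus (w - z))) ?modulus_gt0 //.
  by rewrite -modulusM mulrBl divfK //; exact: H.
move=> w; case: eqVneq => [->|wz]; first by rewrite !subrr mulr0.
by rewrite divfK // subr_eq0.
Qed.

Lemma cdiffD f g z d1 d2 : cdiff f z d1 -> cdiff g z d2 ->
  cdiff (fun w => f w + g w) z (d1 + d2).
Proof.
move=> /cdiffP[p [<- pz] fp] /cdiffP[q [<- qz] gq]; apply/cdiffP.
exists (fun w => p w + q w); first by split=> //; exact: ccontD.
by move=> w; rewrite mulrDl -fp -gq; ring.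
Qed.

Lemma cdiffM f g z d1 d2 : cdiff f z d1 -> cdiff g z d2 ->
  cdiff (fun w => f w * g w) z (d1 * g z + f z * d2).
Proof.
move=> /cdiffP[p [<- pz] fp] /[dup] /cdiff_cont gz /cdiffP[q [<- qz] gq]; apply/cdiffP.
exists (fun w => p w * g w + f z * q w).
  by split=> //; apply: ccontD; apply: ccontM => //; exact: ccont_cst.
by move=> w; rewrite mulrDl mulrAC -fp -mulrA -gq; ring.
Qed.

Lemma cdiffZ f z d c : cdiff f z d -> cdiff (fun w => c * f w) z (c * d).
Proof.
by move=> fz; have := cdiffM (cdiff_cst c z) fz; rewrite mul0r add0r.
Qed.

Lemma cdiffN f z d : cdiff f z d -> cdiff (fun w => - f w) z (- d).
Proof.
move=> /(cdiffZ (-1)); rewrite mulN1r; apply: (@cdiff_near _ _ _ _ 1) => // w _.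
by rewrite mulN1r.
Qed.

Lemma cdiffB f g z d1 d2 : cdiff f z d1 -> cdiff g z d2 ->
  cdiff (fun w => f w - g w) z (d1 - d2).
Proof. by move=> fz gz; apply: cdiffD => //; exact: cdiffN. Qed.

Lemma cdiff_comp f g z d1 d2 : cdiff g z d2 -> cdiff f (g z) d1 ->
  cdiff (fun w => f (g w)) z (d1 * d2).
Proof.
move=> /[dup] /cdiff_cont gz /cdiffP[q [<- qz] gq] /cdiffP[p [<- pz] fp]; apply/cdiffP.
exists (fun w => p (g w) * q w).
  by split=> //; apply: ccontM => //; exact: ccont_comp.
by move=> w; rewrite fp gq mulrA.
Qed.

Lemma cdiff_inv z : z != 0 -> cdiff (fun w => w^-1) z (- (z ^+ 2)^-1).
Proof.
move=> z0 e e0.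
pose m := modulus z; have m0 : 0 < m by rewrite modulus_gt0.
exists (minr (m / 2) (e * m ^+ 3 / 2)).
  by rewrite lt_min !divr_gt0 // mulr_gt0 // exprn_gt0.
move=> w; rewrite lt_min => /andP[wm we].
have w2 : m / 2 <= modulus w.
  have := modulus_sub_ge z (z - w).
  by rewrite opprB addrCA subrr addr0 -/m modulusBC; lra.
have w0 : w != 0 by rewrite -modulus_gt0; apply: lt_le_trans w2; rewrite divr_gt0.
have -> : w^-1 - z^-1 - - (z ^+ 2)^-1 * (w - z) =
   (w - z) * ((w - z) * (w^-1 * (z ^+ 2)^-1)).
  by field; rewrite z0 w0.
rewrite modulusM mulrC; apply: ler_wpM2r; first exact: modulus_ge0.
rewrite !modulusM !modulusV modulusX -/m.
have wi : (modulus w)^-1 <= (m / 2)^-1.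
  by rewrite lef_pV2 // posrE ?divr_gt0 // modulus_gt0.
apply: (@le_trans _ _ (e * m ^+ 3 / 2 * ((m / 2)^-1 * (m ^+ 2)^-1))).
  apply: ler_pM; rewrite ?modulus_ge0 ?mulr_ge0 ?invr_ge0 ?exprn_ge0 ?modulus_ge0 //.
    exact: ltW.
  by apply: ler_wpM2r => //; rewrite invr_ge0 exprn_ge0 // ltW.
suff -> : e * m ^+ 3 / 2 * ((m / 2)^-1 * (m ^+ 2)^-1) = e by [].
by field; rewrite gt_eqF.
Qed.

Lemma cdiffV f z d : f z != 0 -> cdiff f z d ->
  cdiff (fun w => (f w)^-1) z (- (f z ^+ 2)^-1 * d).
Proof. by move=> fz0 fz; apply: (cdiff_comp fz (cdiff_inv fz0)). Qed.

Lemma cdiff_unique f z d d' : cdiff f z d -> cdiff f z d' -> d = d'.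
Proof.
move=> fd fd'; apply/eqP; rewrite -subr_eq0 -modulus_eq0; apply/eqP/le_anti.
rewrite modulus_ge0 andbT; apply/ler_addgt0Pl => e e0; rewrite addr0.
have e20 : 0 < e / 2 by rewrite divr_gt0.
have [r1 r10 H1] := fd _ e20; have [r2 r20 H2] := fd' _ e20.
pose s := minr r1 r2 / 2.
have s0 : 0 < s by rewrite divr_gt0 // lt_min r10.
have sm : modulus (z + s%:C - z) = s.
  by rewrite addrAC subrr add0r modulus_real gtr0_norm.
have sr : s < minr r1 r2 by rewrite /s ltr_pdivrMr // ltr_pMr ?ltr1n // lt_min r10.
have [sr1 sr2] : s < r1 /\ s < r2 by apply/andP; rewrite -lt_min.
have := H1 (z + s%:C); have := H2 (z + s%:C); rewrite sm.
move=> /(_ sr2) h2 /(_ sr1) h1.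
rewrite -(ler_pM2r s0) -{1}sm -modulusM.
have -> : (d - d') * (z + s%:C - z) =
  (f (z + s%:C) - f z - d' * (z + s%:C - z)) - (f (z + s%:C) - f z - d * (z + s%:C - z))
  by ring.
apply: (le_trans (le_modulusB _ _)); rewrite [e]splitr mulrDl; exact: lerD.
Qed.

Lemma ccont_near f g z (s : R) : 0 < s ->
  (forall w, modulus (w - z) < s -> f w = g w) -> ccont f z -> ccont g z.
Proof.
move=> s0 fg fz e e0; have [r r0 H] := fz e e0.
exists (minr r s); first by rewrite lt_min r0.
move=> w; rewrite lt_min => /andP[wr ws].
rewrite -fg // -(fg z) ?subrr ?modulus0 //; exact: H.
Qed.

(** Convergence in the topology of the scalar field, in terms of the modulus. *)
Lemma nbhs_modulusP (z : C) (A : set C) : nbhs (z : C^o) A <->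
  exists2 r : R, 0 < r & forall w, modulus (w - z) < r -> A w.
Proof.
split.
  move=> /nbhs_ballP[e /= e0 H].
  move: (e0); rewrite ltcE /= => /andP[/eqP Ime Ree].
  exists (Re e) => // w wz; apply: H; rewrite -ball_normE /ball_ /=.
  by rewrite norm_modulus modulusBC ltcE /= Ime eqxx.
move=> [r r0 H]; apply/nbhs_ballP; exists (r%:C) => /=.
  by rewrite ltcR.
move=> w; rewrite -ball_normE /ball_ /= => wz; apply: H.
by move: wz; rewrite norm_modulus ltcR modulusBC.
Qed.

Lemma derivable_cdiff f z d :
  (derivable (f : C^o -> C^o) z 1 /\ 'D_1 (f : C^o -> C^o) z = d) <-> cdiff f z d.
Proof.
pose q (h : C^o) : C^o := h^-1 *: ((f \o shift z) (h *: (1 : C^o)) - f z : C^o).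
have qE h : h != 0 -> modulus (q h - d) * modulus h =
    modulus (f (h + z) - f z - d * (h + z - z)).
  move=> h0; rewrite -modulusM addrK; congr modulus.
  have -> : q h = h^-1 * (f (h + z) - f z).
    by rewrite /q /= /shift /= (_ : h *: (1 : C^o) = h) //; exact: mulr1.
  by rewrite mulrBl mulrAC mulVf ?mul1r.
have cvgP : (q @ 0^' --> (d : C^o)) <-> cdiff f z d.
  split.
  - move=> H e e0; have := H [set w | modulus (w - d) < e].
    have : nbhs (d : C^o) [set w | modulus (w - d) < e].
      by apply/nbhs_modulusP; exists e.
    move=> /[swap] /[apply]; rewrite /= /fmap /= => /nbhs_modulusP[r r0 K].
    exists r => // w wz.
    have [->|wz0] := eqVneq w z.
      by rewrite !subrr mulr0 subr0 modulus0 mulr0.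
    have wz1 : w - z != 0 by rewrite subr_eq0.
    have := K (w - z); rewrite subr0 => /(_ wz wz1) /= K1.
    have := qE _ wz1; rewrite subrK => <-.
    by rewrite ler_wpM2r ?modulus_ge0 // ltW.
  - move=> H A /nbhs_modulusP[e e0 K].
    have e20 : 0 < e / 2 by rewrite divr_gt0.
    have [r r0 L] := H _ e20.
    apply/nbhs_modulusP; exists r => // h; rewrite subr0 => hr h0 /=.
    apply: K; apply: (@le_lt_trans _ _ (e / 2)); last first.
      by rewrite ltr_pdivrMr // ltr_pMr ?ltr1n.
    have := L (h + z); rewrite addrK => /(_ hr).
    have := qE _ h0; rewrite addrK => <-.
    by rewrite ler_pM2r // modulus_gt0.
split.
  by move=> [fz fd]; apply/cvgP; rewrite -fd; exact: fz.
move=> /cvgP qd; split.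
  by apply/cvg_ex; exists d.
exact: (cvg_lim (@norm_hausdorff _ _) qd).
Qed.

Lemma disc_limitP (h : C -> C) c l : disc_limit h c l <->
  forall e : R, 0 < e -> exists2 r : R, 0 < r &
    forall z, disc z -> modulus (z - c) < r -> modulus (h z - l) < e.
Proof.
split.
  move=> H e e0; have := H [set w | modulus (w - l) < e].
  have : nbhs (l : C^o) [set w | modulus (w - l) < e].
    by apply/nbhs_modulusP; exists e.
  move=> /[swap] /[apply]; rewrite /= /fmap /= => /nbhs_modulusP[r r0 K].
  by exists r => // z dz zc; exact: K.
move=> H A /nbhs_modulusP[e e0 K].
have [r r0 L] := H _ e0.
by apply/nbhs_modulusP; exists r => // w wc dw /=; apply: K; exact: L.
Qed.

End ComplexDerivative.

(** * Bisection of rectangles *)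

Section Bisection.
Context {R : realType}.

Lemma geometric_small (D q e : R) : 0 < q -> q < 1 -> 0 < e ->
  exists N, forall n, (N <= n)%N -> D * q ^+ n <= e.
Proof.
move=> q0 q1 e0; have qn : `|q| < 1 by rewrite gtr0_norm.
have /cvgrPdist_le/(_ e e0)[N _ HN] := cvg_geometric D qn.
by exists N => n /HN; rewrite sub0r normrN; apply: le_trans; exact: ler_norm.
Qed.

(** The compactness of a rectangle as an induction principle: a property of
    rectangles (lower left corner [x + iy], sides [t * l] and [t * m]) that
    holds for the small ones around every point and passes from the four
    quarters to the whole holds for the rectangle itself.  Otherwise successive
    quartering gives a nested sequence of counterexamples, which shrinks to a
    point.  It is used to prove Goursat's theorem, uniform continuity and the
    comparison of areas. *)
Lemma bisection_ind (l m : R) (P : R -> R -> R -> Prop) (x0 y0 t0 : R) :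
  0 <= l -> 0 <= m -> 0 < t0 ->
  (forall x y t, 0 < t -> P x y (t / 2) -> P (x + t / 2 * l) y (t / 2) ->
     P x (y + t / 2 * m) (t / 2) -> P (x + t / 2 * l) (y + t / 2 * m) (t / 2) ->
     P x y t) ->
  (forall a b, x0 <= a <= x0 + t0 * l -> y0 <= b <= y0 + t0 * m ->
     exists2 d : R, 0 < d & forall x y t, 0 < t < d ->
       x <= a <= x + t * l -> y <= b <= y + t * m -> P x y t) ->
  P x0 y0 t0.
Proof.
move=> l0 m0 t00 quarter local; apply: contrapT => nP.
pose bad (s : R * R * R) := 0 < s.2 /\ ~ P s.1.1 s.1.2 s.2.
have step (s : R * R * R) : exists s' : R * R * R, bad s ->
  [/\ bad s', s'.2 = s.2 / 2, s.1.1 <= s'.1.1, s.1.2 <= s'.1.2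
    & s'.1.1 + s'.2 * l <= s.1.1 + s.2 * l /\ s'.1.2 + s'.2 * m <= s.1.2 + s.2 * m].
  case: s => [[x y] t]; rewrite /bad /=.
  have [t0'|] := boolP (0 < t); last first.
    by exists (x, y, t) => -[].
  have [?|nPt] := pselect (P x y t); first by exists (x, y, t) => -[].
  have t2 : 0 < t / 2 by rewrite divr_gt0.
  have tl : 0 <= t / 2 * l by rewrite mulr_ge0 // ltW.
  have tm : 0 <= t / 2 * m by rewrite mulr_ge0 // ltW.
  have tl2 : t * l = t / 2 * l + t / 2 * l by field.
  have tm2 : t * m = t / 2 * m + t / 2 * m by field.
  rewrite tl2 tm2.
  have [p1|p1] := pselect (P x y (t / 2)); last first.
    by exists (x, y, t / 2) => _; split => //=; split; lra.
  have [p2|p2] := pselect (P (x + t / 2 * l) y (t / 2)); last first.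
    by exists (x + t / 2 * l, y, t / 2) => _; split => //=; [lra|split; lra].
  have [p3|p3] := pselect (P x (y + t / 2 * m) (t / 2)); last first.
    by exists (x, y + t / 2 * m, t / 2) => _; split => //=; [lra|split; lra].
  have [p4|p4] := pselect (P (x + t / 2 * l) (y + t / 2 * m) (t / 2)); last first.
    by exists (x + t / 2 * l, y + t / 2 * m, t / 2) => _;
      split => //=; [lra|lra|split; lra].
  by case: nPt; exact: quarter.
have [next nextP] := choice step.
pose s n := iter n next (x0, y0, t0).
have bads n : bad (s n) by elim: n => [|n /nextP[]].
have sS n : s n.+1 = next (s n) by [].
have st n : (s n).2 = t0 / 2 ^+ n.
  elim: n => [|n IH]; first by rewrite divr1.
  have [_ -> _ _ _] := nextP _ (bads n).
  by rewrite -/(s n) IH exprS; field; rewrite expf_neq0.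
have mono n k : [/\ (s n).1.1 <= (s (n + k)%N).1.1, (s n).1.2 <= (s (n + k)%N).1.2,
    (s (n + k)%N).1.1 + (s (n + k)%N).2 * l <= (s n).1.1 + (s n).2 * l
  & (s (n + k)%N).1.2 + (s (n + k)%N).2 * m <= (s n).1.2 + (s n).2 * m].
  elim: k => [|k [h1 h2 h3 h4]]; first by rewrite addn0.
  have [_ _ g1 g2 [g3 g4]] := nextP _ (bads (n + k)%N).
  by rewrite addnS sS; split; apply: le_trans; eassumption.
have pos n : 0 <= (s n).2 by have [/ltW] := bads n.
have upx n k : (s k).1.1 <= (s n).1.1 + (s n).2 * l.
  have [h _ _ _] := mono k n; have [_ _ g _] := mono n k.
  apply: (le_trans h); rewrite addnC; apply: le_trans g.
  by rewrite lerDl mulr_ge0.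
have upy n k : (s k).1.2 <= (s n).1.2 + (s n).2 * m.
  have [_ h _ _] := mono k n; have [_ _ _ g] := mono n k.
  apply: (le_trans h); rewrite addnC; apply: le_trans g.
  by rewrite lerDl mulr_ge0.
pose a := sup [set (s k).1.1 | k in [set: nat]].
pose b := sup [set (s k).1.2 | k in [set: nat]].
have ax n : (s n).1.1 <= a <= (s n).1.1 + (s n).2 * l.
  apply/andP; split.
    apply: ub_le_sup; last by exists n.
    by exists (x0 + t0 * l) => _ [k _ <-]; exact: (upx 0%N).
  apply: ge_sup; first by exists (s 0%N).1.1; exists 0%N.
  by move=> _ [k _ <-]; exact: upx.
have bx n : (s n).1.2 <= b <= (s n).1.2 + (s n).2 * m.
  apply/andP; split.
    apply: ub_le_sup; last by exists n.
    by exists (y0 + t0 * m) => _ [k _ <-]; exact: (upy 0%N).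
  apply: ge_sup; first by exists (s 0%N).1.2; exists 0%N.
  by move=> _ [k _ <-]; exact: upy.
have [d d0 H] := local a b (ax 0%N) (bx 0%N).
have h0 : 0 < 2^-1 :> R by rewrite invr_gt0.
have h1 : 2^-1 < 1 :> R by rewrite invf_lt1 // ltr1n.
have [n tn] := geometric_small t0 h0 h1 (divr_gt0 d0 (ltr0n _ 2)).
have {}tn : t0 / 2 ^+ n < d by have := tn n (leqnn n); rewrite exprVn; lra.
have [t'0 nPn] := bads n; apply: nPn.
by apply: H => //; rewrite t'0 st.
Qed.

End Bisection.

(** * Complex integrals along segments *)

Section SegmentIntegral.
Context {R : realType}.
Local Notation C := R[i].
Implicit Types (F G : R -> C) (a b c t : R).

Definition rcont F t := forall e : R, 0 < e -> exists2 r : R, 0 < r &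
  forall s, `|s - t| < r -> modulus (F s - F t) <= e.

Definition rdiff G t (d : C) := forall e : R, 0 < e -> exists2 r : R, 0 < r &
  forall s, `|s - t| < r ->
    modulus (G s - G t - (s - t)%:C * d) <= e * `|s - t|.

Definition rcont_on F a b := forall t, a <= t <= b -> rcont F t.

Lemma rcont_Re F t : rcont F t -> continuous_at (t : R) (fun s : R => Re (F s) : R).
Proof.
move=> Ft; apply/cvgrPdist_le => /= e e0.
have [r r0 H] := Ft _ e0.
apply/nbhs_normP; exists r => //= s; rewrite /ball_ /= => st.
rewrite distrC -Re_opp -Re_add; apply: (le_trans (Re_le_modulus _)).
by apply: H; rewrite distrC.
Qed.

Lemma rcont_Im F t : rcont F t -> continuous_at (t : R) (fun s : R => Im (F s) : R).
Proof.
move=> Ft; apply/cvgrPdist_le => /= e e0.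
have [r r0 H] := Ft _ e0.
apply/nbhs_normP; exists r => //= s; rewrite /ball_ /= => st.
rewrite distrC -Im_opp -Im_add; apply: (le_trans (Im_le_modulus _)).
by apply: H; rewrite distrC.
Qed.

Lemma rcont_on_integrable F a b : rcont_on F a b ->
  mu.-integrable `[a, b] (EFin \o (fun s => Re (F s))) /\
  mu.-integrable `[a, b] (EFin \o (fun s => Im (F s))).
Proof.
move=> Fab; split; apply: continuous_compact_integrable;
  try exact: segment_compact; apply: continuous_in_subspaceT => t;
  rewrite inE /= in_itv /= => tab.
- exact/rcont_Re/Fab.
- exact/rcont_Im/Fab.
Qed.

Lemma rcont_onZ F a b (k : C) : rcont_on F a b -> rcont_on (fun t => k * F t) a b.
Proof.
move=> Fc t ht e e0; pose K := modulus k + 1.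
have K0 : 0 < K by rewrite ltr_wpDl ?modulus_ge0.
have [r r0 H] := Fc t ht _ (divr_gt0 e0 K0).
exists r => // u /H h; rewrite -mulrBr modulusM.
apply: (@le_trans _ _ (K * (e / K))); last by rewrite mulrC divfK // gt_eqF.
by apply: ler_pM; rewrite ?modulus_ge0 // lerDl.
Qed.

Lemma rcont_on_modulus_sqr F a b : rcont_on F a b ->
  mu.-integrable `[a, b] (EFin \o (fun t => modulus (F t) ^+ 2)).
Proof.
move=> Fc; apply: continuous_compact_integrable; first exact: segment_compact.
apply: continuous_in_subspaceT => t; rewrite inE /= in_itv /= => /Fc ct.
have -> : (fun s => modulus (F s) ^+ 2) = (fun s => Re (F s) * Re (F s) + Im (F s) * Im (F s)).
  by apply/funext => s; rewrite modulus_sqr !expr2.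
by apply: cvgD; apply: cvgM; [exact: rcont_Re|exact: rcont_Re|exact: rcont_Im|exact: rcont_Im].
Qed.

Lemma integrable_itv_cst a b (c : R) : mu.-integrable `[a, b] (EFin \o (fun=> c)).
Proof.
apply: continuous_compact_integrable; first exact: segment_compact.
by apply: continuous_subspaceT => x; exact: cst_continuous.
Qed.

Lemma mu_itv (b1 b2 : bool) (x1 x2 : R) : x1 <= x2 ->
  mu [set` Interval (BSide b1 x1) (BSide b2 x2)] = (x2 - x1)%:E.
Proof.
move=> h; rewrite lebesgue_measure_itv /= lte_fin.
by case: ltgtP h => // -> _; rewrite subrr.
Qed.

Definition cint F a b : C :=
  (\int[mu]_(t in `[a, b]) Re (F t)) +i* (\int[mu]_(t in `[a, b]) Im (F t)).

Arguments cint : simpl never.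

Lemma Re_cint F a b : Re (cint F a b) = \int[mu]_(t in `[a, b]) Re (F t).
Proof. by []. Qed.

Lemma Im_cint F a b : Im (cint F a b) = \int[mu]_(t in `[a, b]) Im (F t).
Proof. by []. Qed.

Lemma eq_cint F G a b : (forall t, a <= t <= b -> F t = G t) ->
  cint F a b = cint G a b.
Proof.
move=> FG; rewrite /cint; congr Complex; apply: eq_Rintegral => t;
  by rewrite inE /= in_itv /= => /FG ->.
Qed.

Lemma rcont_onW F a b a' b' : a <= a' -> b' <= b -> rcont_on F a b -> rcont_on F a' b'.
Proof.
move=> aa bb Fab t /andP[ta tb]; apply: Fab.
by rewrite (le_trans aa ta) (le_trans tb bb).
Qed.

Lemma cint_split F a c b : a <= c -> c <= b -> rcont_on F a b ->
  cint F a b = cint F a c + cint F c b.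
Proof.
move=> ac cb Fab; have [iR iI] := rcont_on_integrable Fab.
have [jR jI] := rcont_on_integrable (rcont_onW ac (lexx b) Fab).
have sub : `]c, b] `<=` `[c, b] by move=> x /=; rewrite !in_itv /= => /andP[/ltW -> ->].
have S (f : R -> R) : mu.-integrable `[a, b] (EFin \o f) ->
    mu.-integrable `[c, b] (EFin \o f) ->
    \int[mu]_(t in `[a, b]) f t =
    \int[mu]_(t in `[a, c]) f t + \int[mu]_(t in `[c, b]) f t.
  move=> i j; have := Rintegral_itvB i (x := c).
  rewrite !bnd_simp => /(_ ac cb)/eqP; rewrite subr_eq => /eqP ->.
  rewrite addrC Rintegral_itv_obnd_cbnd //.
  exact: (integrableS _ _ _ j).
by rewrite /cint S // S //.
Qed.

Lemma cintD F G a b : rcont_on F a b -> rcont_on G a b ->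
  cint (fun t => F t + G t) a b = cint F a b + cint G a b.
Proof.
move=> /rcont_on_integrable[i1 i2] /rcont_on_integrable[j1 j2].
apply: complex_eqP; rewrite ?Re_add ?Im_add ?Re_cint ?Im_cint.
  by under eq_Rintegral => t _ do rewrite Re_add; rewrite RintegralD.
by under eq_Rintegral => t _ do rewrite Im_add; rewrite RintegralD.
Qed.

Lemma cintZ F a b (k : C) : rcont_on F a b ->
  cint (fun t => k * F t) a b = k * cint F a b.
Proof.
move=> /rcont_on_integrable[i1 i2].
have Z (x : R) (f : R -> R) : mu.-integrable `[a, b] (EFin \o f) ->
    mu.-integrable `[a, b] (EFin \o (fun t => x * f t)).
  by move=> /(integrableZl _ x); exact.
apply: complex_eqP; rewrite [RHS](Re_mul, Im_mul) ?Re_cint ?Im_cint.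
  under eq_Rintegral => t _ do rewrite Re_mul.
  by rewrite RintegralB ?RintegralZl //; exact: Z.
under eq_Rintegral => t _ do rewrite Im_mul.
by rewrite RintegralD ?RintegralZl //; exact: Z.
Qed.

Lemma modulus_cint_le F a b (M : R) : a <= b -> rcont_on F a b ->
  (forall t, a <= t <= b -> modulus (F t) <= M) ->
  modulus (cint F a b) <= 2 * M * (b - a).
Proof.
move=> ab /rcont_on_integrable[i1 i2] FM.
have S (f : R -> R) : mu.-integrable `[a, b] (EFin \o f) ->
    (forall t, a <= t <= b -> `|f t| <= M) ->
    `|\int[mu]_(t in `[a, b]) f t| <= M * (b - a).
  move=> i fM; apply: (le_trans (le_normr_Rintegral _ i)) => //.
  apply: (@le_trans _ _ (\int[mu]_(t in `[a, b]) M)).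
    apply: le_Rintegral; first by [].
    - exact: (integrable_norm i).
    - exact: integrable_itv_cst.
    by move=> t /=; rewrite in_itv /= => /fM.
  by rewrite Rintegral_cst //= mu_itv.
apply: (le_trans (modulus_le_ReIm _)).
rewrite -mulrA mulr_natl mulr2n; apply: lerD; apply: S => // t /FM; apply: le_trans.
- exact: Re_le_modulus.
- exact: Im_le_modulus.
Qed.

Lemma rdiff_real (g : R -> R) (t d : R) :
  (forall e : R, 0 < e -> exists2 r : R, 0 < r &
     forall s, `|s - t| < r -> `|g s - g t - (s - t) * d| <= e * `|s - t|) ->
  is_derive t 1 g d.
Proof.
move=> H.
have : (fun h : R => h^-1 *: ((g \o shift t) (h *: (1 : R)) - g t)) @ 0^' --> d.
  apply/cvgrPdist_le => /= e e0; have [r r0 K] := H _ e0.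
  apply/nbhs_normP; exists r => //= h; rewrite /ball_ /= sub0r normrN.
  move=> hr h0; have := K (h + t); rewrite addrK => /(_ hr).
  rewrite distrC -[e in e * _]mulr1 /shift /= scaler1 => k.
  rewrite -(ler_pM2r (_ : 0 < `|h|)) ?normr_gt0 // -normrM.
  rewrite mulrBl /GRing.scale /= mulrAC mulVf // mul1r (mulrC d).
  by rewrite mulr1 in k.
move=> c; split; first by apply/cvg_ex; exists d.
exact: (cvg_lim (@norm_hausdorff _ _) c).
Qed.

Lemma rdiff_Re G t d : rdiff G t d -> is_derive t 1 (fun s => Re (G s)) (Re d).
Proof.
move=> Gt; apply: rdiff_real => e e0; have [r r0 H] := Gt _ e0.
exists r => // s /H; apply: le_trans; apply: le_trans (Re_le_modulus _).
by rewrite !Re_add !Re_opp Re_mul /= mul0r subr0.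
Qed.

Lemma rdiff_Im G t d : rdiff G t d -> is_derive t 1 (fun s => Im (G s)) (Im d).
Proof.
move=> Gt; apply: rdiff_real => e e0; have [r r0 H] := Gt _ e0.
exists r => // s /H; apply: le_trans; apply: le_trans (Im_le_modulus _).
by rewrite !Im_add !Im_opp Im_mul /= mul0r addr0.
Qed.

Lemma cint_FTC F G a b : a <= b -> rcont_on F a b ->
  (forall t, a <= t <= b -> rdiff G t (F t)) -> cint F a b = G b - G a.
Proof.
rewrite le_eqVlt => /predU1P[-> _ _|ab Fab dG].
  by rewrite /cint set_itv1 !Rintegral_set1 subrr.
have S (f g : R -> R) : {within `[a, b], continuous f} ->
    (forall t, a <= t <= b -> is_derive t 1 g (f t)) ->
    \int[mu]_(t in `[a, b]) f t = g b - g a.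
  move=> cf dg; rewrite /Rintegral (@continuous_FTC2 _ f g) //.
    split.
    - move=> t; rewrite in_itv /= => /andP[at_ tb].
      by have [] := dg t; rewrite ?(ltW at_) ?(ltW tb).
    - apply: cvg_at_right_filter; apply: differentiable_continuous.
      by apply/derivable1_diffP; have [] := dg a; rewrite ?lexx ?ltW.
    - apply: cvg_at_left_filter; apply: differentiable_continuous.
      by apply/derivable1_diffP; have [] := dg b; rewrite ?lexx ?ltW.
  move=> t; rewrite in_itv /= => /andP[at_ tb]; rewrite derive1E.
  by have [] := dg t; rewrite ?(ltW at_) ?(ltW tb).
apply: complex_eqP; rewrite ?Re_add ?Im_add ?Re_opp ?Im_opp /=.
  apply: (S (fun t => Re (F t)) (fun t => Re (G t))) => [|t /dG /rdiff_Re //].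
  by apply: continuous_in_subspaceT => t; rewrite inE /= in_itv /= => /Fab /rcont_Re.
apply: (S (fun t => Im (F t)) (fun t => Im (G t))) => [|t /dG /rdiff_Im //].
by apply: continuous_in_subspaceT => t; rewrite inE /= in_itv /= => /Fab /rcont_Im.
Qed.

End SegmentIntegral.

Opaque modulus.

(** * Integrals along rectangles and squares, and Goursat's theorem *)

Section RectangleIntegral.
Context {R : realType}.
Local Notation C := R[i].
Implicit Types (f g : C -> C) (x y : R) (z w d : C).

Definition hint f y (x1 x2 : R) : C := cint (fun x => f (x +i* y)) x1 x2.
Definition vint f x (y1 y2 : R) : C := cint (fun y => f (x +i* y)) y1 y2.

Definition rint f (x1 x2 y1 y2 : R) : C :=
  hint f y1 x1 x2 + 'i * vint f x2 y1 y2 - hint f y2 x1 x2 - 'i * vint f x1 y1 y2.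

Lemma modulus_hor x x' y : modulus ((x +i* y) - (x' +i* y)) = `|x - x'|.
Proof. by rewrite -modulus_real; congr modulus; apply: complex_eqP => //=; rewrite subrr. Qed.

Lemma modulus_ver x y y' : modulus ((x +i* y) - (x +i* y')) = `|y - y'|.
Proof.
have -> : (x +i* y) - (x +i* y') = 'i * (y - y')%:C.
  by apply: complex_eqP; rewrite /= ?Re_add ?Im_add /=; ring.
by rewrite modulusM modulus_i mul1r modulus_real.
Qed.

Lemma rcont_hor f x y : ccont f (x +i* y) -> rcont (fun s => f (s +i* y)) x.
Proof.
move=> fc e /fc[r r0 H]; exists r => // s sx.
by apply: H; rewrite modulus_hor.
Qed.

Lemma rcont_ver f x y : ccont f (x +i* y) -> rcont (fun s => f (x +i* s)) y.
Proof.
move=> fc e /fc[r r0 H]; exists r => // s sx.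
by apply: H; rewrite modulus_ver.
Qed.

Lemma rdiff_hor f x y d : cdiff f (x +i* y) d -> rdiff (fun s => f (s +i* y)) x d.
Proof.
move=> fc e /fc[r r0 H]; exists r => // s sx.
have := H (s +i* y); rewrite modulus_hor => /(_ sx).
rewrite mulrC (_ : s +i* y - (x +i* y) = (s - x)%:C) //.
by apply: complex_eqP => //=; rewrite subrr.
Qed.

Lemma rdiff_ver f x y d : cdiff f (x +i* y) d -> rdiff (fun s => f (x +i* s)) y ('i * d).
Proof.
move=> fc e /fc[r r0 H]; exists r => // s sx.
have := H (x +i* s); rewrite modulus_ver => /(_ sx).
rewrite (_ : x +i* s - (x +i* y) = 'i * (s - y)%:C); last first.
  by apply: complex_eqP; rewrite /= ?Re_add ?Im_add /=; ring.
by rewrite mulrA mulrC (mulrC d).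
Qed.

(** The points that an integral around a rectangle sees. *)
Definition rbd (x1 x2 y1 y2 : R) z :=
  [/\ x1 <= Re z <= x2, y1 <= Im z <= y2 &
      [\/ Re z = x1, Re z = x2, Im z = y1 | Im z = y2]].

Section Sides.
Variables (x1 x2 y1 y2 : R).
Hypotheses (x12 : x1 <= x2) (y12 : y1 <= y2).
Let bd := rbd x1 x2 y1 y2.

Let bd1 x : x1 <= x <= x2 -> bd (x +i* y1).
Proof. by move=> h; split => //=; [rewrite lexx|apply: Or43]. Qed.
Let bd2 x : x1 <= x <= x2 -> bd (x +i* y2).
Proof. by move=> h; split => //=; [rewrite lexx andbT|apply: Or44]. Qed.
Let bd3 y : y1 <= y <= y2 -> bd (x1 +i* y).
Proof. by move=> h; split => //=; [rewrite lexx|apply: Or41]. Qed.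
Let bd4 y : y1 <= y <= y2 -> bd (x2 +i* y).
Proof. by move=> h; split => //=; [rewrite lexx andbT|apply: Or42]. Qed.

Lemma sides_cont f : (forall z, bd z -> ccont f z) ->
  [/\ rcont_on (fun x => f (x +i* y1)) x1 x2, rcont_on (fun x => f (x +i* y2)) x1 x2,
      rcont_on (fun y => f (x1 +i* y)) y1 y2 & rcont_on (fun y => f (x2 +i* y)) y1 y2].
Proof.
move=> H; split=> t h; [apply: rcont_hor|apply: rcont_hor|apply: rcont_ver|apply: rcont_ver];
  apply: H; [exact: bd1|exact: bd2|exact: bd3|exact: bd4].
Qed.

Lemma eq_rint f g : (forall z, bd z -> f z = g z) ->
  rint f x1 x2 y1 y2 = rint g x1 x2 y1 y2.
Proof.
move=> fg; rewrite /rint /hint /vint; congr (_ + 'i * _ - _ - 'i * _);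
  apply: eq_cint => t h; apply: fg; [exact: bd1|exact: bd4|exact: bd2|exact: bd3].
Qed.

Lemma rintD f g : (forall z, bd z -> ccont f z) -> (forall z, bd z -> ccont g z) ->
  rint (fun z => f z + g z) x1 x2 y1 y2 = rint f x1 x2 y1 y2 + rint g x1 x2 y1 y2.
Proof.
move=> /sides_cont[f1 f2 f3 f4] /sides_cont[g1 g2 g3 g4].
rewrite /rint /hint /vint !cintD //; ring.
Qed.

Lemma rintZ f k : (forall z, bd z -> ccont f z) ->
  rint (fun z => k * f z) x1 x2 y1 y2 = k * rint f x1 x2 y1 y2.
Proof. move=> /sides_cont[f1 f2 f3 f4]; rewrite /rint /hint /vint !cintZ //; ring. Qed.

Lemma modulus_rint_le f (M : R) : (forall z, bd z -> ccont f z) ->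
  (forall z, bd z -> modulus (f z) <= M) ->
  modulus (rint f x1 x2 y1 y2) <= 4 * M * ((x2 - x1) + (y2 - y1)).
Proof.
move=> /sides_cont[f1 f2 f3 f4] fM.
have h1 : modulus (hint f y1 x1 x2) <= 2 * M * (x2 - x1).
  by apply: modulus_cint_le => // t h; apply/fM/bd1.
have h2 : modulus (hint f y2 x1 x2) <= 2 * M * (x2 - x1).
  by apply: modulus_cint_le => // t h; apply/fM/bd2.
have v1 : modulus ('i * vint f x1 y1 y2) <= 2 * M * (y2 - y1).
  by rewrite modulusM modulus_i mul1r; apply: modulus_cint_le => // t h; apply/fM/bd3.
have v2 : modulus ('i * vint f x2 y1 y2) <= 2 * M * (y2 - y1).
  by rewrite modulusM modulus_i mul1r; apply: modulus_cint_le => // t h; apply/fM/bd4.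
have -> : 4 * M * ((x2 - x1) + (y2 - y1)) = 2 * M * (x2 - x1) + 2 * M * (y2 - y1)
  + 2 * M * (x2 - x1) + 2 * M * (y2 - y1) by ring.
by do 2 apply: modulusB_le => //; exact: modulusD_le.
Qed.

(** A derivative integrates to zero around a rectangle: the contributions of
    the corners cancel. *)
Lemma rint_derivative f g : (forall z, bd z -> ccont g z) ->
  (forall z, bd z -> cdiff f z (g z)) -> rint g x1 x2 y1 y2 = 0.
Proof.
move=> /[dup] gc /sides_cont[g1 g2 g3 g4] fg.
have h1 : hint g y1 x1 x2 = f (x2 +i* y1) - f (x1 +i* y1).
  apply: (cint_FTC (G := fun x => f (x +i* y1))) => // t h.
  exact/rdiff_hor/fg/bd1.
have h2 : hint g y2 x1 x2 = f (x2 +i* y2) - f (x1 +i* y2).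
  apply: (cint_FTC (G := fun x => f (x +i* y2))) => // t h.
  exact/rdiff_hor/fg/bd2.
have v1 : 'i * vint g x1 y1 y2 = f (x1 +i* y2) - f (x1 +i* y1).
  rewrite /vint -cintZ //.
  apply: (cint_FTC (G := fun y => f (x1 +i* y))) => // [|t h]; first exact: rcont_onZ.
  exact/rdiff_ver/fg/bd3.
have v2 : 'i * vint g x2 y1 y2 = f (x2 +i* y2) - f (x2 +i* y1).
  rewrite /vint -cintZ //.
  apply: (cint_FTC (G := fun y => f (x2 +i* y))) => // [|t h]; first exact: rcont_onZ.
  exact/rdiff_ver/fg/bd4.
rewrite /rint h1 h2 v1 v2; ring.
Qed.

End Sides.

Definition ccont_rect f (x1 x2 y1 y2 : R) := forall z,
  x1 <= Re z <= x2 -> y1 <= Im z <= y2 -> ccont f z.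

Lemma rint_split_hor f x1 x2 x3 y1 y2 : x1 <= x2 -> x2 <= x3 ->
  rcont_on (fun x => f (x +i* y1)) x1 x3 -> rcont_on (fun x => f (x +i* y2)) x1 x3 ->
  rint f x1 x3 y1 y2 = rint f x1 x2 y1 y2 + rint f x2 x3 y1 y2.
Proof.
move=> x12 x23 c1 c2; rewrite /rint /hint (cint_split x12 x23 c1) (cint_split x12 x23 c2).
ring.
Qed.

Lemma rint_split_ver f x1 x2 y1 y2 y3 : y1 <= y2 -> y2 <= y3 ->
  rcont_on (fun y => f (x1 +i* y)) y1 y3 -> rcont_on (fun y => f (x2 +i* y)) y1 y3 ->
  rint f x1 x2 y1 y3 = rint f x1 x2 y1 y2 + rint f x1 x2 y2 y3.
Proof.
move=> y12 y23 c1 c2; rewrite /rint /vint (cint_split y12 y23 c1) (cint_split y12 y23 c2).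
ring.
Qed.

Lemma rcont_on_rect f (x1 x2 y1 y2 : R) : ccont_rect f x1 x2 y1 y2 ->
  (forall y a b, y1 <= y -> y <= y2 -> x1 <= a -> b <= x2 ->
     rcont_on (fun x => f (x +i* y)) a b) /\
  (forall x a b, x1 <= x -> x <= x2 -> y1 <= a -> b <= y2 ->
     rcont_on (fun y => f (x +i* y)) a b).
Proof.
move=> H; split=> [y a b hy hy' ha hb t /andP[ta tb]|x a b hx hx' ha hb t /andP[ta tb]].
  by apply/rcont_hor/H => //=; rewrite ?hy ?hx ?(le_trans ha ta) ?(le_trans tb hb).
by apply/rcont_ver/H => //=; rewrite ?hy ?hx ?(le_trans ha ta) ?(le_trans tb hb).
Qed.

(** On a small rectangle the function is its linear part, which integrates to
    zero, up to an error that is small compared with the area. *)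
Lemma goursat f (x1 x2 y1 y2 : R) : x1 <= x2 -> y1 <= y2 ->
  (forall z, x1 <= Re z <= x2 -> y1 <= Im z <= y2 -> exists d, cdiff f z d) ->
  rint f x1 x2 y1 y2 = 0.
Proof.
move=> x12 y12 H.
have fc : ccont_rect f x1 x2 y1 y2.
  by move=> z hx hy; have [d /cdiff_cont] := H z hx hy.
pose l := x2 - x1; pose m := y2 - y1.
have l0 : 0 <= l by rewrite subr_ge0.
have m0 : 0 <= m by rewrite subr_ge0.
apply/eqP; rewrite -modulus_eq0; apply/eqP/le_anti; rewrite modulus_ge0 andbT.
apply/ler_addgt0Pl => e e0; rewrite addr0.
pose P (x y t : R) := x1 <= x -> x + t * l <= x2 -> y1 <= y -> y + t * m <= y2 ->
  modulus (rint f x (x + t * l) y (y + t * m)) <= e * t ^+ 2.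
suff : P x1 y1 1.
  rewrite /P !mul1r /l /m !subrKC expr1n mulr1; exact.
apply: (@bisection_ind _ l m) => //.
- move=> x y t t0 p1 p2 p3 p4 hx1 hx2 hy1 hy2.
  have t2 : 0 < t / 2 by rewrite divr_gt0.
  have tl : 0 <= t / 2 * l by rewrite mulr_ge0 // ltW.
  have tm : 0 <= t / 2 * m by rewrite mulr_ge0 // ltW.
  have tl2 : t * l = t / 2 * l + t / 2 * l by field.
  have tm2 : t * m = t / 2 * m + t / 2 * m by field.
  rewrite tl2 in hx2 *; rewrite tm2 in hy2 *.
  have [ch cv] := rcont_on_rect fc.
  rewrite (@rint_split_hor _ _ (x + (t / 2 * l))); try lra; [|apply: ch; lra..].
  rewrite (@rint_split_ver _ x _ _ (y + (t / 2 * m))); try lra; [|apply: cv; lra..].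
  rewrite (@rint_split_ver _ (x + (t / 2 * l)) _ _ (y + (t / 2 * m))); try lra; [|apply: cv; lra..].
  have -> : e * t ^+ 2 = (e * (t / 2) ^+ 2 + e * (t / 2) ^+ 2)
     + (e * (t / 2) ^+ 2 + e * (t / 2) ^+ 2) by field.
  rewrite !(addrA x) !(addrA y).
  apply: modulusD_le; apply: modulusD_le; [apply: p1|apply: p3|apply: p2|apply: p4]; lra.
- move=> a b; rewrite !mul1r /l /m !subrKC => ha hb.
  have [d fd] := H (a +i* b) ha hb.
  pose K := 4 * (l + m) ^+ 2 + 1.
  have K0 : 0 < K by rewrite ltr_wpDl // mulr_ge0 // sqr_ge0.
  have [r r0 Hr] := fd _ (divr_gt0 e0 K0).
  exists (r / (l + m + 1)); first by rewrite divr_gt0 // ltr_wpDl // addr_ge0.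
  move=> x y t /andP[t0 tr] hax hby hx1 hx2 hy1 hy2.
  rewrite -/l -/m in hax hby hx2 hy2 *.
  have lm0 : 0 <= l + m by rewrite addr_ge0.
  have tlm : 0 <= t * (l + m) by rewrite mulr_ge0 // ltW.
  have tlm' : t * (l + m) < r.
    move: tr; rewrite ltr_pdivlMr ?ltr_wpDl //; apply: le_lt_trans.
    by apply: ler_wpM2l; [exact: ltW|rewrite lerDl].
  have tl0 : 0 <= t * l by rewrite mulr_ge0 // ltW.
  have tm0 : 0 <= t * m by rewrite mulr_ge0 // ltW.
  pose z0 := a +i* b.
  pose E w := f w - f z0 - d * (w - z0).
  pose L w := f z0 + d * (w - z0).
  pose Q w := (f z0 - d * z0) * w + d / 2 * (w * w).
  have dQ w : cdiff Q w (L w).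
    apply: cdiff_eq (cdiffD (cdiffZ _ (@cdiff_id _ w)) (cdiffZ _ (cdiffM (@cdiff_id _ w) (@cdiff_id _ w)))).
    by rewrite /L; field.
  have dL w : cdiff L w d.
    apply: cdiff_eq (cdiffD (cdiff_cst (f z0) w) (cdiffZ d (cdiffB (@cdiff_id _ w) (cdiff_cst z0 w)))).
    by rewrite subr0 mulr1 add0r.
  have x1t : x <= x + t * l by rewrite lerDl.
  have y1t : y <= y + t * m by rewrite lerDl.
  have inside w : rbd x (x + t * l) y (y + t * m) w ->
      x1 <= Re w <= x2 /\ y1 <= Im w <= y2.
    by move=> [/andP[h1 h2] /andP[h3 h4] _]; split; lra.
  have cE w : rbd x (x + t * l) y (y + t * m) w -> ccont E w.
    move=> /inside[h1 h2]; have fw := fc w h1 h2.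
    have := ccontD fw (cdiff_cont (cdiffN (dL w))).
    by apply: (@ccont_near _ _ _ _ 1) => // v _; rewrite /E /L opprD addrA.
  have close w : rbd x (x + t * l) y (y + t * m) w -> modulus (w - z0) <= t * (l + m).
    move=> [/andP[h1 h2] /andP[h3 h4] _].
    apply: (le_trans (modulus_le_ReIm _)).
    rewrite !Re_add !Im_add !Re_opp !Im_opp /= mulrDr.
    move: hax hby => /andP[h5 h6] /andP[h7 h8].
    by apply: lerD; abs_lra.
  have -> : rint f x (x + t * l) y (y + t * m) =
      rint (fun w => E w + L w) x (x + t * l) y (y + t * m).
    apply: eq_rint => // w _; rewrite /E /L; ring.
  rewrite rintD //; last by move=> w _; exact: cdiff_cont (dL w).
  rewrite (rint_derivative _ _ (f := Q) (g := L)) //; last first.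
    by move=> w _; exact: cdiff_cont (dL w).
  rewrite addr0.
  apply: (@le_trans _ _ (4 * (e / K * (t * (l + m))) * ((x + t * l - x) + (y + t * m - y)))).
    apply: modulus_rint_le => // w bw; have h := close _ bw.
    apply: (le_trans (Hr _ (le_lt_trans h tlm'))).
    by apply: ler_wpM2l => //; rewrite ltW // divr_gt0.
  have -> : 4 * (e / K * (t * (l + m))) * ((x + t * l - x) + (y + t * m - y)) =
     e * t ^+ 2 * (4 * (l + m) ^+ 2 / K) by field; rewrite gt_eqF.
  apply: ler_piMr; first by rewrite mulr_ge0 ?sqr_ge0 // ltW.
  by rewrite ler_pdivrMr // mul1r /K lerDl.
Qed.

End RectangleIntegral.

(** * Derivatives as integrals over squares *)

Section Squares.
Context {R : realType}.
Local Notation C := R[i].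
Implicit Types (f g F : C -> C) (z w d : C) (s S : R).

Definition sqbd s := @rbd R (- s) s (- s) s.
Definition sqint F s : C := rint F (- s) s (- s) s.

Lemma sqbd_modulus s z : 0 <= s -> sqbd s z -> s <= modulus z <= 2 * s.
Proof.
move=> s0 [/andP[h1 h2] /andP[h3 h4] h]; apply/andP; split.
  have [hr|hi] : `|Re z| = s \/ `|Im z| = s.
    by case: h => ->; rewrite ?normrN (ger0_norm s0); [left|left|right|right].
  - by rewrite -hr Re_le_modulus.
  - by rewrite -hi Im_le_modulus.
apply: (le_trans (modulus_le_ReIm _)).
by rewrite mulr_natl mulr2n; apply: lerD; rewrite ler_norml ?h1 ?h3.
Qed.

Lemma sqbd_neq0 s z : 0 < s -> sqbd s z -> z != 0.
Proof.
move=> s0 /(sqbd_modulus (ltW s0))/andP[h _].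
by rewrite -modulus_gt0; exact: lt_le_trans h.
Qed.

Lemma sqbdN s : 0 <= s -> - s <= s. Proof. by move=> s0; lra. Qed.

Lemma modulus_sqint_le F s (M : R) : 0 <= s -> (forall z, sqbd s z -> ccont F z) ->
  (forall z, sqbd s z -> modulus (F z) <= M) -> modulus (sqint F s) <= 16 * M * s.
Proof.
move=> s0 Fc FM.
have := modulus_rint_le (sqbdN s0) (sqbdN s0) Fc FM; rewrite -/(sqint F s).
move=> /le_trans; apply; lra.
Qed.

(** The rectangle is the square together with four rectangles that avoid the
    origin, and the integrals around these vanish. *)
Lemma rint_annulus F s (x1 x2 y1 y2 : R) : 0 < s ->
  x1 <= - s -> s <= x2 -> y1 <= - s -> s <= y2 ->
  (forall z, x1 <= Re z <= x2 -> y1 <= Im z <= y2 -> z != 0 -> exists d, cdiff F z d) ->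
  rint F x1 x2 y1 y2 = sqint F s.
Proof.
move=> s0 hx1 hx2 hy1 hy2 H.
have H' z : x1 <= Re z <= x2 -> y1 <= Im z <= y2 -> s <= `|Re z| \/ s <= `|Im z| ->
    exists d, cdiff F z d.
  move=> h1 h2 h3; apply: H => //.
  rewrite -modulus_gt0; apply: (lt_le_trans s0).
  by case: h3 => h; apply: (le_trans h); rewrite ?Re_le_modulus ?Im_le_modulus.
have pos (x : R) : s <= x -> s <= `|x| by move=> h; apply: (le_trans h); exact: ler_norm.
have neg (x : R) : x <= - s -> s <= `|x|.
  by move=> h; rewrite -normrN; apply: pos; rewrite lerNr.
have top : rint F x1 x2 s y2 = 0.
  apply: goursat => //; first by lra.
  move=> z h1 /andP[h2 h3]; apply: H' => //; first by lra.
  by right; exact: pos.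
have bottom : rint F x1 x2 y1 (- s) = 0.
  apply: goursat => //; first by lra.
  move=> z h1 /andP[h2 h3]; apply: H' => //; first by lra.
  by right; exact: neg.
have left_ : rint F x1 (- s) (- s) s = 0.
  apply: goursat => //; first by lra.
  move=> z /andP[h1 h2] /andP[h3 h4]; apply: H' => //; [by lra|by lra|].
  by left; exact: neg.
have right_ : rint F s x2 (- s) s = 0.
  apply: goursat => //; first by lra.
  move=> z /andP[h1 h2] /andP[h3 h4]; apply: H' => //; [by lra|by lra|].
  by left; exact: pos.
have cv x u v : x1 <= x <= x2 -> s <= `|x| -> y1 <= u -> v <= y2 ->
    rcont_on (fun y => F (x +i* y)) u v.
  move=> hx xs hu hv t /andP[ut tv]; apply: rcont_ver.
  by have [|d /cdiff_cont] := H' (x +i* t) hx _ (or_introl xs); first (rewrite /=; lra).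
have ch y : y1 <= y <= y2 -> s <= `|y| -> rcont_on (fun x => F (x +i* y)) x1 x2.
  by move=> hy ys t ht; apply: rcont_hor; have [d /cdiff_cont] := H' (t +i* y) ht hy (or_intror ys).
have [l1 l2] : s <= `|x1| /\ s <= `|x2| by split; [exact: neg|exact: pos].
have [l3 l4] : s <= `|- s| /\ s <= `|s| by split; [exact: neg|exact: pos].
rewrite (@rint_split_ver _ _ _ _ _ (- s)); [ |lra|lra|apply: cv => //; lra|apply: cv => //; lra].
rewrite bottom add0r (@rint_split_ver _ _ _ _ _ s); [ |lra|lra|apply: cv => //; lra|apply: cv => //; lra].
rewrite top addr0 (@rint_split_hor _ _ _ (- s)); [ |lra|lra|apply: ch => //; lra|apply: ch => //; lra].
have ch' y : y1 <= y <= y2 -> s <= `|y| -> rcont_on (fun x => F (x +i* y)) (- s) x2.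
  by move=> hy ys; apply: rcont_onW (ch y hy ys).
rewrite left_ add0r (@rint_split_hor _ _ _ s); [ |lra|lra|apply: ch' => //; lra|apply: ch' => //; lra].
by rewrite right_ addr0.
Qed.

Lemma sqint_annulus F s S : 0 < s -> s <= S ->
  (forall z, `|Re z| <= S -> `|Im z| <= S -> z != 0 -> exists d, cdiff F z d) ->
  sqint F S = sqint F s.
Proof.
move=> s0 sS H; apply: rint_annulus; rewrite ?lerN2 //.
by move=> z; rewrite -!ler_norml; exact: H.
Qed.

Lemma cdiff_shift f z w d : cdiff f (z + w) d -> cdiff (fun v => f (z + v)) w d.
Proof.
move=> fd; apply: cdiff_eq (cdiff_comp (cdiffD (cdiff_cst z w) (@cdiff_id _ w)) fd).
by rewrite add0r mulr1.
Qed.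

Lemma cdiff_inv_sq z : z != 0 -> cdiff (fun w => (w ^+ 2)^-1) z (- (z ^+ 4)^-1 * (z + z)).
Proof.
move=> z0; have := cdiffV (f := fun w => w * w) (z := z).
rewrite mulf_neq0 // => /(_ _ isT (cdiffM (@cdiff_id _ z) (@cdiff_id _ z))).
move=> h; apply: cdiff_eq (cdiff_near ltr01 _ h); last by move=> w _; rewrite expr2.
by rewrite mul1r mulr1 -expr2 -exprM.
Qed.

Lemma sqint_inv_sq s : 0 < s -> sqint (fun w => (w ^+ 2)^-1) s = 0.
Proof.
move=> s0; apply: (rint_derivative (sqbdN (ltW s0)) (sqbdN (ltW s0))
  (f := fun w => - w^-1)) => w /(sqbd_neq0 s0) w0.
- exact: cdiff_cont (cdiff_inv_sq w0).
- by apply: cdiff_eq (cdiffN (cdiff_inv w0)); rewrite opprK.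
Qed.

(** The kernel [(f (z + w) - f z - d * w) / w ^+ 2] is holomorphic off [0] and
    of order [o(1 / |w|)], so that its integral over a small square tends to
    zero; that integral does not depend on the square. *)
Lemma sqint_derivative f z d S : 0 < S ->
  (forall w, `|Re w| <= S -> `|Im w| <= S -> exists d', cdiff f (z + w) d') ->
  cdiff f z d ->
  sqint (fun w => f (z + w) * (w ^+ 2)^-1) S = d * sqint (fun w => w^-1) S.
Proof.
move=> S0 H fd.
pose k w := (f (z + w) - f z - d * w) * (w ^+ 2)^-1.
have kd w : `|Re w| <= S -> `|Im w| <= S -> w != 0 -> exists d, cdiff k w d.
  move=> h1 h2 w0; have [d' /cdiff_shift fw] := H w h1 h2.
  eexists; exact: (cdiffM (cdiffB (cdiffB fw (cdiff_cst (f z) w))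
    (cdiffZ d (@cdiff_id _ w))) (cdiff_inv_sq w0)).
have in_sq s w : s <= S -> sqbd s w -> `|Re w| <= S /\ `|Im w| <= S.
  move=> sS [/andP[h1 h2] /andP[h3 h4] _].
  by split; abs_lra.
have kc s w : 0 < s -> s <= S -> sqbd s w -> ccont k w.
  move=> s0 sS bw; have [h1 h2] := in_sq _ _ sS bw.
  by have [d' /cdiff_cont] := kd w h1 h2 (sqbd_neq0 s0 bw).
have k0 : sqint k S = 0.
  apply/eqP; rewrite -modulus_eq0; apply/eqP/le_anti; rewrite modulus_ge0 andbT.
  apply/ler_addgt0Pl => /= e e0; rewrite addr0.
  have e0' : 0 < e / 16 by rewrite divr_gt0.
  have [r r0 Hr] := fd _ e0'.
  pose s := minr S (r / 4).
  have s0 : 0 < s by rewrite lt_min S0 divr_gt0.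
  have sS : s <= S by rewrite ge_min lexx.
  have sr4 : s <= r / 4 by rewrite ge_min lexx orbT.
  have sr : 2 * s < r by lra.
  rewrite (sqint_annulus s0 sS kd).
  apply: (@le_trans _ _ (16 * (e / 16 / s) * s)); last first.
    by apply: le_of_eq; field; rewrite gt_eqF.
  apply: modulus_sqint_le (ltW s0) _ _ => w bw; first exact: kc bw.
  have /andP[m1 m2] := sqbd_modulus (ltW s0) bw.
  have w0 := sqbd_neq0 s0 bw.
  have := Hr (z + w); rewrite addrAC subrr add0r => /(_ (le_lt_trans m2 sr)) h.
  rewrite modulusM modulusV modulusX.
  apply: (@le_trans _ _ (e / 16 * modulus w * (modulus w ^+ 2)^-1)).
    by apply: ler_wpM2r => //; rewrite invr_ge0 exprn_ge0 ?modulus_ge0.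
  have -> : e / 16 * modulus w * (modulus w ^+ 2)^-1 = e / 16 / modulus w.
    by field; rewrite modulus_eq0.
  apply: ler_wpM2l; first exact: ltW.
  by rewrite lef_pV2 // posrE modulus_gt0.
have SN := sqbdN (ltW S0).
have c1 w : sqbd S w -> ccont (fun w => f (z + w) * (w ^+ 2)^-1) w.
  move=> bw; have [h1 h2] := in_sq _ _ (lexx S) bw.
  have [d' /cdiff_shift/cdiff_cont fw] := H w h1 h2.
  by apply: ccontM fw _; exact: cdiff_cont (cdiff_inv_sq (sqbd_neq0 S0 bw)).
have c2 w : sqbd S w -> ccont (fun w => (w ^+ 2)^-1) w.
  by move=> bw; exact: cdiff_cont (cdiff_inv_sq (sqbd_neq0 S0 bw)).
have c3 w : sqbd S w -> ccont (fun w => w^-1) w.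
  by move=> bw; exact: cdiff_cont (cdiff_inv (sqbd_neq0 S0 bw)).
have : sqint (fun w => f (z + w) * (w ^+ 2)^-1) S =
    sqint (fun w => (k w + f z * (w ^+ 2)^-1) + d * w^-1) S.
  apply: eq_rint => // w /(sqbd_neq0 S0) w0; rewrite /k; by field.
rewrite /sqint => ->.
have Zc (c : C) F w : ccont F w -> ccont (fun w => c * F w) w.
  by move=> Fw; apply: ccontM => //; exact: ccont_cst.
rewrite rintD //; last 2 first.
- by move=> w bw; apply: ccontD; [exact: kc bw|exact/Zc/c2].
- by move=> w bw; exact/Zc/c3.
rewrite rintD //; last 2 first.
- by move=> w bw; exact: kc bw.
- by move=> w bw; exact/Zc/c2.
rewrite !rintZ // -!/(sqint _ S) k0 sqint_inv_sq // mulr0 !add0r //.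
Qed.

Lemma Re_cint_ge (F : R -> C) (a b m : R) : a <= b -> rcont_on F a b ->
  (forall t, a <= t <= b -> m <= Re (F t)) -> m * (b - a) <= Re (cint F a b).
Proof.
move=> ab /rcont_on_integrable[iR _] Fm; rewrite Re_cint.
have -> : m * (b - a) = \int[@lebesgue_measure R]_(t in `[a, b]) m.
  by rewrite Rintegral_cst //= mu_itv.
apply: le_Rintegral; first by [].
- exact: integrable_itv_cst.
- exact: iR.
by move=> t /=; rewrite in_itv /=; exact: Fm.
Qed.

(** The value is [2 * pi * 'i]: on a side at distance [s] from the origin the
    relevant component of the integrand is [s / (t ^+ 2 + s ^+ 2)], hence at
    least [1 / (2 * s)], and the side has length [2 * s]; each of the four sides
    thus contributes at least [1]. *)
Lemma sqint_inv_ge s : 0 < s -> 4 <= modulus (sqint (fun w => w^-1) s).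
Proof.
move=> s0; have sN := sqbdN (ltW s0).
have c w : sqbd s w -> ccont (fun w => w^-1) w.
  by move=> bw; exact: cdiff_cont (cdiff_inv (sqbd_neq0 s0 bw)).
have [c1 c2 c3 c4] := sides_cont sN sN c.
pose m := (2 * s)^-1.
have m0 : 0 < m by rewrite invr_gt0 mulr_gt0.
have key (t : R) : - s <= t <= s -> m <= s / (t ^+ 2 + s ^+ 2).
  move=> ht; have h : t ^+ 2 <= s ^+ 2.
    by rewrite -[leLHS]real_normK ?num_real // ler_pXn2r ?nnegrE ?normr_ge0 ?(ltW s0) // ler_norml.
  have h0 : 0 < t ^+ 2 + s ^+ 2 by rewrite ltr_wpDl ?sqr_ge0 // exprn_gt0.
  rewrite ler_pdivlMr // /m mulrC ler_pdivrMr ?mulr_gt0 //; lra.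
have one : m * (s - - s) = 1 by rewrite /m opprK; field; rewrite gt_eqF.
have side (k : C) (F : R -> C) : rcont_on F (- s) s ->
    (forall t, - s <= t <= s -> m <= Re (k * F t)) -> 1 <= Re (k * cint F (- s) s).
  by move=> Fc h; rewrite -cintZ // -one; apply: Re_cint_ge => //; exact: rcont_onZ.
pose w := sqint (fun w => w^-1) s.
suff : 4 <= Re (- 'i * w).
  move=> h; apply: (le_trans h); apply: (le_trans (ler_norm _)).
  by apply: (le_trans (Re_le_modulus _)); rewrite modulusM modulusN modulus_i mul1r.
have -> : - 'i * w = - 'i * cint (fun x => (x +i* - s)^-1) (- s) s
   + cint (fun y => (s +i* y)^-1) (- s) s
   + 'i * cint (fun x => (x +i* s)^-1) (- s) s
   + (-1) * cint (fun y => (- s +i* y)^-1) (- s) s.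
  have ii : 'i * 'i = -1 :> C by rewrite -expr2 sqr_i.
  rewrite /w /sqint /rint /hint /vint.
  set A := cint _ _ _; set B := cint _ _ _; set D := cint _ _ _; set E := cint _ _ _.
  have -> : - 'i * (A + 'i * B - D - 'i * E) = - 'i * A - ('i * 'i) * B + 'i * D + ('i * 'i) * E by ring.
  rewrite ii; ring.
have t1 := side _ _ c1; have t2 := side _ _ c2; have t3 := side _ _ c3; have t4 := side _ _ c4.
rewrite !Re_add.
have := t1 (- 'i); have := t2 'i; have := t3 (-1); have := t4 1.
rewrite mul1r => h4 h3 h2 h1.
have {}h4 : 1 <= Re (cint (fun y => (s +i* y)^-1) (- s) s).
  apply: h4 => t /key; rewrite mul1r /= => /le_trans; apply.
  by rewrite addrC.
have {}h3 : 1 <= Re (-1 * cint (fun y => (- s +i* y)^-1) (- s) s).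
  apply: h3 => t /key; rewrite mulN1r /= => /le_trans; apply.
  by rewrite sqrrN mulNr opprK addrC.
have {}h2 : 1 <= Re ('i * cint (fun x => (x +i* s)^-1) (- s) s).
  apply: h2 => t /key; rewrite /= mul0r mul1r sub0r opprK; exact.
have {}h1 : 1 <= Re (- 'i * cint (fun x => (x +i* - s)^-1) (- s) s).
  apply: h1 => t /key; rewrite /= oppr0 mul0r mulN1r sub0r opprK sqrrN mulNr opprK; exact.
lra.
Qed.

End Squares.

(** * Holomorphic functions on the disc have continuous derivatives *)

Section Holomorphic.
Context {R : realType}.
Local Notation C := R[i].
Implicit Types (f g : C -> C) (z w d : C).

(** Sealed, so that conversion never unfolds the limit behind a derivative. *)
Fact cderive_sealed : {D : (C -> C) -> C -> C |
  forall f z, D f z = 'D_1 (f : C^o -> C^o) z}.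
Proof. by exists (fun f z => 'D_1 (f : C^o -> C^o) z). Qed.

Definition cderive : (C -> C) -> C -> C := sval cderive_sealed.

Lemma cderiveE f z : cderive f z = 'D_1 (f : C^o -> C^o) z.
Proof. exact: (svalP cderive_sealed). Qed.

Lemma holo_cdiff f z : holomorphic_on_disc f -> disc z -> cdiff f z (cderive f z).
Proof.
move=> hf dz; apply/derivable_cdiff; split; first exact: hf.
by rewrite cderiveE.
Qed.

Lemma cdiff_cderive f z d : cdiff f z d -> cderive f z = d.
Proof. by rewrite cderiveE => /derivable_cdiff[]. Qed.

Lemma cdiff_holo f : (forall z, disc z -> exists d, cdiff f z d) -> holomorphic_on_disc f.
Proof. by move=> H z /H[d /derivable_cdiff[]]. Qed.

Lemma disc_near z : disc z -> exists2 r : R, 0 < r & forall w, modulus (w - z) < r -> disc w.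
Proof.
rewrite /disc /= => dz; exists (1 - modulus z); first by rewrite subr_gt0.
move=> w h; rewrite -[w](subrK z); apply: (le_lt_trans (le_modulusD _ _)).
by rewrite -ltrBrDr.
Qed.

Lemma disc0 : disc (0 : C).
Proof. by rewrite /disc /= modulus0. Qed.

(** The property passes from the four quarters to a square, and holds for the
    small squares around a point because the function is continuous there.  The
    increment [v] may leave the square. *)
Lemma uniform_continuity f (x0 y0 t0 e : R) : 0 < t0 -> 0 < e ->
  (forall w, x0 <= Re w <= x0 + t0 -> y0 <= Im w <= y0 + t0 -> ccont f w) ->
  exists2 r : R, 0 < r & forall w v, x0 <= Re w <= x0 + t0 -> y0 <= Im w <= y0 + t0 ->
    modulus v < r -> modulus (f (w + v) - f w) <= e.
Proof.
move=> t00 e0 fc.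
pose P x y t := x0 <= x -> x + t <= x0 + t0 -> y0 <= y -> y + t <= y0 + t0 ->
  exists2 r : R, 0 < r & forall w v, x <= Re w <= x + t ->
  y <= Im w <= y + t -> modulus v < r -> modulus (f (w + v) - f w) <= e.
suff : P x0 y0 t0 by apply.
apply: (@bisection_ind _ 1 1) => //.
- move=> x y t tp; rewrite !mulr1 /P => p1 p2 p3 p4 h1 h2 h3 h4.
  have [||||r1 r10 H1] := p1; [by lra..|].
  have [||||r2 r20 H2] := p2; [by lra..|].
  have [||||r3 r30 H3] := p3; [by lra..|].
  have [||||r4 r40 H4] := p4; [by lra..|].
  exists (minr (minr r1 r2) (minr r3 r4)); first by rewrite !lt_min r10 r20 r30.
  move=> w v /andP[g1 g2] /andP[g3 g4].
  rewrite !lt_min => /andP[/andP[v1 v2] /andP[v3 v4]].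
  have [hx|hx] := leP (Re w) (x + t / 2); have [hy|hy] := leP (Im w) (y + t / 2).
  + by apply: H1 => //; lra.
  + by apply: H3 => //; lra.
  + by apply: H2 => //; lra.
  + by apply: H4 => //; lra.
- move=> a b; rewrite !mulr1 => ha hb.
  have [r r0 Hr] := fc (a +i* b) ha hb _ (divr_gt0 e0 (ltr0n _ 2)).
  exists (r / 4); first by rewrite divr_gt0.
  move=> x y t /andP[tp tr]; rewrite !mulr1 => /andP[a1 a2] /andP[b1 b2] _ _ _ _.
  exists (r / 2); first by rewrite divr_gt0.
  move=> w v /andP[g1 g2] /andP[g3 g4] vr.
  have wz : modulus (w - (a +i* b)) <= 2 * t.
    apply: (le_trans (modulus_le_ReIm _)).
    rewrite !Re_add !Im_add !Re_opp !Im_opp /= mulr_natl mulr2n.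
    by apply: lerD; abs_lra.
  have -> : f (w + v) - f w = (f (w + v) - f (a +i* b)) - (f w - f (a +i* b)) by ring.
  rewrite [e]splitr; apply: modulusB_le; apply: Hr; last by lra.
  rewrite addrAC; apply: (le_lt_trans (le_modulusD _ _)); lra.
Qed.

Lemma disc_square z w (S : R) : modulus z + 2 * S < 1 -> `|Re w| <= S -> `|Im w| <= S ->
  disc (z + w).
Proof.
move=> zS h1 h2; rewrite /disc /=; apply: (le_lt_trans (le_modulusD _ _)).
by apply: le_lt_trans zS; rewrite lerD2l (le_trans (modulus_le_ReIm _)) // mulr_natl mulr2n lerD.
Qed.

Lemma sqint_cderive f z (S : R) : holomorphic_on_disc f -> 0 < S ->
  modulus z + 2 * S < 1 ->
  sqint (fun w => f (z + w) * (w ^+ 2)^-1) S = cderive f z * sqint (fun w => w^-1) S.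
Proof.
move=> hf S0 zS; apply: sqint_derivative => //.
  by move=> w h1 h2; exists (cderive f (z + w)); apply: holo_cdiff => //; exact: disc_square zS h1 h2.
by apply: holo_cdiff => //; rewrite /disc /=; apply: le_lt_trans zS; rewrite lerDl mulr_ge0 // ltW.
Qed.

Lemma sqbd_box (S : R) w : sqbd S w -> `|Re w| <= S /\ `|Im w| <= S.
Proof. by move=> [h1 h2 _]; rewrite !ler_norml. Qed.

(** For [v] close to [z] the derivative at [v] is an integral of
    [f (v + w) / w ^+ 2] over one and the same square, and [f (v + w)] is
    uniformly close to [f (z + w)] there. *)
Lemma holo_cderive_cont f z : holomorphic_on_disc f -> disc z -> ccont (cderive f) z.
Proof.
move=> hf dz e e0.
pose S := (1 - modulus z) / 8.
have S0 : 0 < S by rewrite divr_gt0 // subr_gt0.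
have zS v : modulus (v - z) < S -> modulus v + 2 * S < 1.
  move=> vz; have := le_modulusD (v - z) z; rewrite subrK => h.
  have : S * 8 = 1 - modulus z by rewrite /S divfK.
  lra.
have zz : modulus (z - z) < S by rewrite subrr modulus0.
have e1 : 0 < e * S / 4 by rewrite divr_gt0 // mulr_gt0.
have [r r0 Hr] : exists2 r : R, 0 < r & forall w v, Re z - S <= Re w <= Re z - S + 2 * S ->
    Im z - S <= Im w <= Im z - S + 2 * S -> modulus v < r ->
    modulus (f (w + v) - f w) <= e * S / 4.
  apply: uniform_continuity => //; first by rewrite mulr_gt0.
  move=> w /andP[h1 h2] /andP[h3 h4]; apply: (@cdiff_cont _ _ _ (cderive f w)).
  apply: holo_cdiff => //; rewrite -[w](subrK z) addrC.
  by apply: disc_square (zS _ zz) _ _;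
    rewrite ?Re_add ?Im_add ?Re_opp ?Im_opp ler_norml; apply/andP; split; lra.
exists (minr r S); first by rewrite lt_min r0.
move=> v; rewrite lt_min => /andP[vr vS].
have E1 := sqint_cderive hf S0 (zS _ vS).
have E2 := sqint_cderive hf S0 (zS _ zz).
set W := sqint (fun w => w^-1) S in E1 E2.
have W4 : 4 <= modulus W by exact: sqint_inv_ge.
have fc u : modulus u + 2 * S < 1 -> forall w, sqbd S w -> ccont (fun w => f (u + w) * (w ^+ 2)^-1) w.
  move=> uS w bw; have [h1 h2] := sqbd_box bw.
  have /cdiff_shift/cdiff_cont fw := holo_cdiff hf (disc_square uS h1 h2).
  by apply: ccontM fw _; exact: cdiff_cont (cdiff_inv_sq (sqbd_neq0 S0 bw)).
have SN := sqbdN (ltW S0).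
have cN w : sqbd S w -> ccont (fun w => -1 * (f (z + w) * (w ^+ 2)^-1)) w.
  by move=> bw; apply: ccontM; [exact: ccont_cst|exact: fc (zS _ zz) _ bw].
have : (cderive f v - cderive f z) * W =
    sqint (fun w => f (v + w) * (w ^+ 2)^-1 + (-1) * (f (z + w) * (w ^+ 2)^-1)) S.
  rewrite /sqint rintD //; last exact: fc (zS _ vS).
  rewrite rintZ //; last exact: fc (zS _ zz).
  by rewrite -!/(sqint _ S) E1 E2 mulrBl mulN1r.
move=> /(congr1 (@modulus R)); rewrite modulusM => E.
have {}E : modulus (cderive f v - cderive f z) * modulus W <= 16 * (e * S / 4 / S ^+ 2) * S.
  rewrite E; apply: modulus_sqint_le (ltW S0) _ _ => w bw.
    by apply: ccontD; [exact: fc (zS _ vS) _ bw|exact: cN].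
  rewrite mulN1r -mulrBl modulusM modulusV modulusX.
  have /andP[m1 m2] := sqbd_modulus (ltW S0) bw.
  have [h1 h2] := sqbd_box bw.
  apply: ler_pM; rewrite ?modulus_ge0 ?invr_ge0 ?exprn_ge0 ?modulus_ge0 //.
    rewrite (_ : v + w = z + w + (v - z)); last by ring.
    move: h1 h2; rewrite !ler_norml => /andP[g1 g2] /andP[g3 g4].
    by apply: Hr; rewrite ?Re_add ?Im_add //; apply/andP; split; lra.
  rewrite lef_pV2 ?posrE ?exprn_gt0 ?(lt_le_trans S0 m1) //.
  by rewrite ler_pXn2r ?nnegrE ?modulus_ge0 ?(ltW S0).
have {}E : modulus (cderive f v - cderive f z) * modulus W <= e * 4.
  by apply: (le_trans E); apply: le_of_eq; field; rewrite gt_eqF.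
rewrite -(ler_pM2r (_ : 0 < 4)) //; apply: le_trans E.
by apply: ler_wpM2l => //; exact: modulus_ge0.
Qed.

Lemma holo_cont f z : holomorphic_on_disc f -> disc z -> ccont f z.
Proof. by move=> hf /(holo_cdiff hf)/cdiff_cont. Qed.

End Holomorphic.

(** * Integration over the plane *)

Section Plane.
Context {R : realType}.
Local Notation C := R[i].
Implicit Types (g : C -> R) (U V : set C) (z w : C) (p : R * R).
Local Notation plane_type := (measurableTypeR R * measurableTypeR R)%type.

Definition cpx p : C := p.1 +i* p.2.
Definition plane (A : set C) : set plane_type := [set p | A (cpx p)].

Definition copen U := forall z, U z ->
  exists2 r : R, 0 < r & forall w, modulus (w - z) < r -> U w.

Definition rccont g z := forall e : R, 0 < e -> exists2 r : R, 0 < r &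
  forall w, modulus (w - z) < r -> `|g w - g z| <= e.

Lemma copen_disc : copen (@disc R).
Proof. by move=> z /disc_near. Qed.

Lemma copen_gt U g (c : R) : copen U -> (forall z, U z -> rccont g z) ->
  copen (U `&` [set z | c < g z]).
Proof.
move=> oU gc z [Uz gz]; have [r r0 H] := oU z Uz.
have e0 : 0 < (g z - c) / 2 by rewrite divr_gt0 // subr_gt0.
have [s s0 K] := gc z Uz _ e0.
exists (minr r s); first by rewrite lt_min r0.
move=> w; rewrite lt_min => /andP[/H Uw /K].
by rewrite ler_norml => /andP[h _]; split => //=; lra.
Qed.

(** An open set is a countable union of products of intervals. *)
Lemma copen_measurable U : copen U -> measurable (plane U).
Proof.
move=> oU.
pose box (i : rat * rat * nat) : set plane_type :=
  `](ratr i.1.1 - i.2.+1%:R^-1)%R, (ratr i.1.1 + i.2.+1%:R^-1)%R[ `*`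
  `](ratr i.1.2 - i.2.+1%:R^-1)%R, (ratr i.1.2 + i.2.+1%:R^-1)%R[.
pose F i := if `[<box i `<=` plane U>] then box i else set0.
have -> : plane U = \bigcup_i F i.
  rewrite eqEsubset; split; last first.
    move=> p [i _]; rewrite /F; case: ifPn => [/asboolP h|_ []]; exact: h.
  move=> [x y] Up; have [r r0 H] := oU _ Up.
  have [n nr] : exists n : nat, n.+1%:R^-1 < r / 4.
    exists (Num.bound (r / 4)^-1).
    rewrite invf_plt ?posrE ?divr_gt0 //; apply: lt_le_trans (archi_boundP _) _.
      by rewrite invr_ge0 divr_ge0 // ltW.
    by rewrite ler_nat.
  have [d Ed] : exists d : R, d = n.+1%:R^-1 by exists n.+1%:R^-1.
  have d0 : 0 < d by rewrite Ed invr_gt0.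
  rewrite -Ed in nr.
  have [q1 hq1] : exists q : rat, ratr q \in `]x - d, x + d[.
    by apply: rat_in_itvoo; lra.
  have [q2 hq2] : exists q : rat, ratr q \in `]y - d, y + d[.
    by apply: rat_in_itvoo; lra.
  move: hq1 hq2; rewrite !in_itv /= => /andP[a1 a2] /andP[b1 b2].
  exists ((q1, q2), n) => //; rewrite /F.
  have Bp : box (q1, q2, n) (x, y).
    by split; rewrite /= in_itv /= -Ed; apply/andP; split; lra.
  case: ifPn => // /asboolPn nB; case: nB => -[u v] [].
  rewrite /= !in_itv /= -Ed => /andP[c1 c2] /andP[d1 d2].
  apply: H; apply: (le_lt_trans (modulus_le_ReIm _)).
  rewrite !Re_add !Im_add !Re_opp !Im_opp /=.
  have hu : `|u - x| <= 2 * d by abs_lra.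
  have hv : `|v - y| <= 2 * d by abs_lra.
  lra.
apply: countable_bigcupT_measurable; first exact: countableP.
move=> i; rewrite /F; case: ifPn => // _.
by apply: measurableX; exact: measurable_itv.
Qed.

Lemma rccont_measurable U g : copen U -> (forall z, U z -> rccont g z) ->
  measurable_fun (plane U) (fun p : plane_type => g (cpx p)).
Proof.
move=> oU gc mU; apply: (measurability _ (RGenOInfty.measurableE R)) => //.
move=> _ [_ [c ->] <-].
have -> : plane U `&` (fun p => g (cpx p)) @^-1` `]c, +oo[ =
    plane (U `&` [set z | c < g z]).
  by apply/seteqP; split => p /=; rewrite in_itv /= andbT.
by apply: copen_measurable; exact: copen_gt.
Qed.

Lemma ccont_modulus_sqr f z : ccont f z -> rccont (fun w => modulus (f w) ^+ 2) z.
Proof.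
move=> /[dup] fz /ccont_bounded[s s0 K] e e0.
pose A := 2 * modulus (f z) + 1.
have A0 : 0 < A by rewrite ltr_wpDl // mulr_ge0 ?modulus_ge0.
have [r r0 H] := fz _ (divr_gt0 e0 A0).
exists (minr r s); first by rewrite lt_min r0.
move=> w; rewrite lt_min => /andP[/H h /K k].
rewrite subr_sqr normrM.
apply: (@le_trans _ _ (e / A * A)); last by rewrite divfK // gt_eqF.
apply: ler_pM => //.
  rewrite ler_norml; apply/andP; split.
    rewrite lerNl opprB; apply: le_trans h; rewrite modulusBC; exact: modulus_sub_ge.
  by apply: le_trans h; exact: modulus_sub_ge.
by rewrite ger0_norm ?addr_ge0 ?modulus_ge0 // /A; lra.
Qed.

Lemma rccontP g z : rccont g z <-> ccont (fun w => (g w)%:C) z.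
Proof.
by split=> h e /h[r r0 H]; exists r => // w /H; rewrite -rmorphB modulus_real.
Qed.

Lemma rccontM g1 g2 z : rccont g1 z -> rccont g2 z -> rccont (fun w => g1 w * g2 w) z.
Proof.
move=> /rccontP c1 /rccontP c2; apply/rccontP.
by apply: (ccont_near ltr01 _ (ccontM c1 c2)) => w _; rewrite rmorphM.
Qed.

Lemma rccont_comp g (f : C -> C) z : ccont f z -> rccont g (f z) -> rccont (fun w => g (f w)) z.
Proof. by move=> fz /rccontP gz; apply/rccontP; exact: (ccont_comp fz gz). Qed.

Lemma ccont_Re (f : C -> C) z : ccont f z -> rccont (fun w => Re (f w)) z.
Proof.
move=> fz e /fz[r r0 H]; exists r => // w /H; apply: le_trans.
by rewrite -Re_opp -Re_add Re_le_modulus.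
Qed.

Lemma ccont_Im (f : C -> C) z : ccont f z -> rccont (fun w => Im (f w)) z.
Proof.
move=> fz e /fz[r r0 H]; exists r => // w /H; apply: le_trans.
by rewrite -Im_opp -Im_add Im_le_modulus.
Qed.

(** Half-open boxes, so that the four quarters are disjoint. *)
Definition cbox (x1 x2 y1 y2 : R) : set C :=
  [set z | x1 <= Re z < x2 /\ y1 <= Im z < y2].

Lemma measurable_cbox_preimage U (f : C -> C) (x1 x2 y1 y2 : R) : copen U ->
  (forall z, U z -> ccont f z) -> measurable (plane (U `&` f @^-1` cbox x1 x2 y1 y2)).
Proof.
move=> oU fc.
have mR : measurable_fun (plane U) (fun p : plane_type => Re (f (cpx p))).
  by apply: (rccont_measurable (g := fun z => Re (f z))) => // z /fc /ccont_Re.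
have mI : measurable_fun (plane U) (fun p : plane_type => Im (f (cpx p))).
  by apply: (rccont_measurable (g := fun z => Im (f z))) => // z /fc /ccont_Im.
have mU := copen_measurable oU.
have -> : plane (U `&` f @^-1` cbox x1 x2 y1 y2) =
   (plane U `&` (fun p => Re (f (cpx p))) @^-1` `[x1, x2[) `&`
   (plane U `&` (fun p => Im (f (cpx p))) @^-1` `[y1, y2[).
  apply/seteqP; split => p /=; rewrite !in_itv /=; first by move=> [? []].
  by move=> [[? ?] [? ?]].
by apply: measurableI; [exact: mR|exact: mI].
Qed.

(** The integral of [F] over the part of [A] that [f] maps to a box is additive
    in the box. *)
Section Split.
Variables (U : set C) (f : C -> C) (F : plane_type -> \bar R) (A : set plane_type).
Hypotheses (oU : copen U) (fc : forall z, U z -> ccont f z).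
Hypotheses (mA : measurable A) (mF : measurable_fun (plane U) F).
Hypothesis F0 : forall p, (0 <= F p)%E.

Let B x1 x2 y1 y2 := A `&` plane (U `&` f @^-1` cbox x1 x2 y1 y2).

Let mB x1 x2 y1 y2 : measurable (B x1 x2 y1 y2).
Proof. by apply: measurableI => //; exact: measurable_cbox_preimage. Qed.

Let mFB x1 x2 y1 y2 : measurable_fun (B x1 x2 y1 y2) F.
Proof.
apply: measurable_funS mF => //; first exact: copen_measurable.
by move=> p [_ []].
Qed.

Lemma integral_cbox_split_hor (x1 x2 x3 y1 y2 : R) : x1 <= x2 -> x2 <= x3 ->
  (\int[mu2]_(p in B x1 x3 y1 y2) F p =
   \int[mu2]_(p in B x1 x2 y1 y2) F p + \int[mu2]_(p in B x2 x3 y1 y2) F p)%E.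
Proof.
move=> x12 x23; have E : B x1 x3 y1 y2 = B x1 x2 y1 y2 `|` B x2 x3 y1 y2.
  apply/seteqP; split => p.
    move=> [Ap [Up [/andP[h1 h2] h3]]]; case: (ltP (Re (f (cpx p))) x2) => h; [left|right];
    by split => //; split => //; split => //; apply/andP.
  move=> [] [Ap [Up [/andP[h1 h2] h3]]]; split => //; split => //; split => //; apply/andP; split => //.
    exact: lt_le_trans x23.
  exact: le_trans h1.
rewrite E ge0_integral_setU //; first by rewrite -E.
apply/disj_setPS => p [[_ [_ [/andP[_ h] _]]] [_ [_ [/andP[h' _] _]]]].
by have := lt_le_trans h h'; rewrite ltxx.
Qed.

Lemma integral_cbox_split_ver (x1 x2 y1 y2 y3 : R) : y1 <= y2 -> y2 <= y3 ->
  (\int[mu2]_(p in B x1 x2 y1 y3) F p =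
   \int[mu2]_(p in B x1 x2 y1 y2) F p + \int[mu2]_(p in B x1 x2 y2 y3) F p)%E.
Proof.
move=> y12 y23; have E : B x1 x2 y1 y3 = B x1 x2 y1 y2 `|` B x1 x2 y2 y3.
  apply/seteqP; split => p.
    move=> [Ap [Up [h3 /andP[h1 h2]]]]; case: (ltP (Im (f (cpx p))) y2) => h; [left|right];
    by split => //; split => //; split => //; apply/andP.
  move=> [] [Ap [Up [h3 /andP[h1 h2]]]]; split => //; split => //; split => //; apply/andP; split => //.
    exact: lt_le_trans y23.
  exact: le_trans h1.
rewrite E ge0_integral_setU //; first by rewrite -E.
apply/disj_setPS => p [[_ [_ [_ /andP[_ h]]]] [_ [_ [_ /andP[h' _]]]]].
by have := lt_le_trans h h'; rewrite ltxx.
Qed.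

Lemma integral_cbox_quarters (x y t : R) : 0 <= t ->
  (\int[mu2]_(p in B x (x + t + t) y (y + t + t)) F p =
   (\int[mu2]_(p in B x (x + t) y (y + t)) F p +
    \int[mu2]_(p in B x (x + t) (y + t) (y + t + t)) F p) +
   (\int[mu2]_(p in B (x + t) (x + t + t) y (y + t)) F p +
    \int[mu2]_(p in B (x + t) (x + t + t) (y + t) (y + t + t)) F p))%E.
Proof.
move=> t0; have xt u : u <= u + t by rewrite lerDl.
rewrite (integral_cbox_split_hor y (y + t + t) (xt x) (xt (x + t))).
rewrite (integral_cbox_split_ver x (x + t) (xt y) (xt (y + t))).
by rewrite (integral_cbox_split_ver (x + t) (x + t + t) (xt y) (xt (y + t))).
Qed.

End Split.

Lemma mu2_box (x1 x2 y1 y2 : R) : x1 <= x2 -> y1 <= y2 ->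
  mu2 (`[x1, x2] `*` `[y1, y2]) = ((x2 - x1) * (y2 - y1))%:E.
Proof. by move=> h1 h2; rewrite product_measure1E //= !mu_itv // -EFinM. Qed.

Lemma mu2_cbox (x1 x2 y1 y2 : R) : x1 <= x2 -> y1 <= y2 ->
  mu2 (plane (cbox x1 x2 y1 y2)) = ((x2 - x1) * (y2 - y1))%:E.
Proof.
move=> h1 h2.
have -> : plane (cbox x1 x2 y1 y2) = `[x1, x2[ `*` `[y1, y2[.
  by apply/seteqP; split => p /=; rewrite !in_itv.
by rewrite product_measure1E //= !mu_itv // -EFinM.
Qed.

End Plane.

(** * Change of variables under a conformal automorphism, up to a constant *)

Section AreaComparison.
Context {R : realType}.
Local Notation C := R[i].
Local Notation plane_type := (measurableTypeR R * measurableTypeR R)%type.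

Variables (phi al : C -> C) (G : C -> R).
Hypotheses (hphi : holomorphic_on_disc phi) (hal : holomorphic_on_disc al).
Hypothesis inv : mutually_inverse_on_disc phi al.
Hypotheses (G0 : forall z, 0 <= G z) (Gc : forall z, disc z -> rccont G z).

Let F (p : plane_type) : \bar R :=
  (G (phi (cpx p)) * modulus (cderive phi (cpx p)) ^+ 2)%:E.
Let H (p : plane_type) : \bar R := (G (cpx p))%:E.

Let F0 p : (0 <= F p)%E.
Proof. by rewrite lee_fin mulr_ge0 // sqr_ge0. Qed.
Let H0 p : (0 <= H p)%E.
Proof. by rewrite lee_fin. Qed.

Let phic z : disc z -> ccont phi z.
Proof. exact: holo_cont. Qed.

Let mF : measurable_fun (plane disc) F.
Proof.
apply/measurable_EFinP.
apply: (rccont_measurable (g := fun z => G (phi z) * modulus (cderive phi z) ^+ 2)).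
  exact: copen_disc.
move=> z dz; apply: rccontM.
  by apply: rccont_comp (phic dz) _; apply: Gc; have [h _ _ _] := inv; exact: h.
by apply: ccont_modulus_sqr; exact: holo_cderive_cont.
Qed.

Let mH : measurable_fun (plane disc) H.
Proof.
by apply/measurable_EFinP; apply: rccont_measurable => //; exact: copen_disc.
Qed.

Let mD : measurable (plane (@disc R)).
Proof. by apply: copen_measurable; exact: copen_disc. Qed.

Lemma derivative_inverse z : disc z -> cderive phi (al z) * cderive al z = 1.
Proof.
have [phiD alD alphi phial] := inv => dz.
have d1 := holo_cdiff hal dz; have d2 := holo_cdiff hphi (alD _ dz).
have [r r0 near_z] := disc_near dz.
apply: (cdiff_unique (cdiff_comp d1 d2)).
apply: (cdiff_near r0 _ (@cdiff_id _ z)) => w /near_z dw.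
by rewrite phial.
Qed.

(** Near [z0] the inverse map expands distances by at most twice the modulus of
    its derivative, so that the preimage of a small square of side [t] lies in
    a square of side [8 * |al' z0| * t], on which the Jacobian of [phi] is at
    most [4 / |al' z0| ^+ 2]. *)
Lemma area_comparison_local (a b e : R) : disc (a +i* b) -> 0 < e ->
  exists2 d : R, 0 < d & forall x y t, 0 < t < d -> x <= a <= x + t -> y <= b <= y + t ->
    (\int[mu2]_(p in plane (disc `&` phi @^-1` cbox x (x + t) y (y + t))) F p <=
     (16 ^+ 2)%:E * \int[mu2]_(p in plane (disc `&` id @^-1` cbox x (x + t) y (y + t))) H p
     + (e * t ^+ 2)%:E)%E.
Proof.
have [phiD alD alphi phial] := inv => dz e0.
set z0 := a +i* b in dz *; pose w0 := al z0; pose eta := e / (2 * 16 ^+ 2).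
have k0 : 0 < 16 ^+ 2 :> R by rewrite exprn_gt0 // ltr0n.
have eta0 : 0 < eta by rewrite divr_gt0 // mulr_gt0.
have dw0 : disc w0 by exact: alD.
have [d1 d1E] : {d : R | d = modulus (cderive al z0)} := exist _ _ erefl.
have [d2 d2E] : {d : R | d = modulus (cderive phi w0)} := exist _ _ erefl.
have d12 : d2 * d1 = 1 by rewrite d1E d2E -modulusM derivative_inverse // modulus1.
have d20 : 0 < d2 by rewrite d2E modulus_gt0; have [] := modulus_mul_eq1 (derivative_inverse dz).
have d10 : 0 < d1 by rewrite -(pmulr_rgt0 d1 d20) d12.
have [r1 r10 K1] := disc_near dz.
have [r2 r20 K2] := holo_cdiff hal dz d10.
have [r3 r30 K3] := ccont_comp (holo_cont hal dz) (holo_cderive_cont hphi dw0) d20.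
have [r4 r40 K4] := Gc dz eta0.
pose r := minr (minr r1 r2) (minr r3 r4).
have r0 : 0 < r by rewrite !lt_min r10 r20 r30.
exists (r / 4); first by rewrite divr_gt0.
move=> x y t /andP[t0 tr] /andP[xa ax] /andP[yb bY].
have close w : cbox x (x + t) y (y + t) w ->
    [/\ disc w, modulus (al w - w0) <= 4 * d1 * t,
        modulus (cderive phi (al w)) <= 2 * d2 & `|G w - G z0| <= eta].
  move=> [/andP[h1 h2] /andP[h3 h4]].
  have wz : modulus (w - z0) <= 2 * t.
    apply: (le_trans (modulus_le_ReIm _)).
    rewrite !Re_add !Im_add !Re_opp !Im_opp /= mulr_natl mulr2n.
    by apply: lerD; abs_lra.
  have : modulus (w - z0) < r by lra.
  rewrite !lt_min => /andP[/andP[l1 l2] /andP[l3 l4]]; split.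
  - exact: K1.
  - have -> : al w - w0 = (al w - al z0 - cderive al z0 * (w - z0)) + cderive al z0 * (w - z0).
      by rewrite subrK.
    apply: (le_trans (le_modulusD _ _)); rewrite modulusM -d1E.
    apply: (@le_trans _ _ (d1 * modulus (w - z0) + d1 * modulus (w - z0))).
      by rewrite lerD2r; exact: K2.
    have -> : 4 * d1 * t = d1 * (2 * t) + d1 * (2 * t) by ring.
    exact: (lerD (ler_wpM2l (ltW d10) wz) (ler_wpM2l (ltW d10) wz)).
  - have k3 : modulus (cderive phi (al w) - cderive phi w0) <= d2 by exact: (K3 w l3).
    have h : modulus (cderive phi (al w)) - d2 <= d2.
      by rewrite {1}d2E; exact: (le_trans (modulus_sub_ge _ _) k3).
    by rewrite (mulr_natl d2 2) mulr2n -lerBlDr.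
  - exact: K4.
have mE : measurable (plane (disc `&` phi @^-1` cbox x (x + t) y (y + t))).
  by apply: measurable_cbox_preimage => //; exact: copen_disc.
have mQ : measurable (plane (disc `&` id @^-1` cbox x (x + t) y (y + t))).
  by apply: measurable_cbox_preimage => [|z _]; [exact: copen_disc|exact: cdiff_cont (@cdiff_id _ z)].
set E := plane _ in mE *; set Q := plane (disc `&` id @^-1` _) in mQ *.
pose S : set plane_type := `[Re w0 - 4 * d1 * t, Re w0 + 4 * d1 * t] `*`
                           `[Im w0 - 4 * d1 * t, Im w0 + 4 * d1 * t].
have dt0 : 0 <= 4 * d1 * t by exact: (mulr_ge0 (mulr_ge0 (ler0n _ 4) (ltW d10)) (ltW t0)).
have muS : mu2 S = ((8 * d1 * t) ^+ 2)%:E.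
  by rewrite mu2_box; [congr EFin; ring|lra|lra].
have ES : E `<=` S.
  move=> p [dp /close[_ h _ _]]; rewrite alphi // in h.
  have hr := le_trans (Re_le_modulus _) h; have hi := le_trans (Im_le_modulus _) h.
  move: hr hi; rewrite !Re_add !Im_add !Re_opp !Im_opp !ler_norml.
  by move=> /andP[a1 a2] /andP[a3 a4]; split; rewrite /= in_itv /=; apply/andP; split; lra.
pose M := (G z0 + eta) * (2 * d2) ^+ 2.
have M0 : 0 <= M by rewrite mulr_ge0 ?sqr_ge0 // addr_ge0 // ltW.
have mFE : measurable_fun E F by apply: measurable_funS mF => // p [].
have NE : (\int[mu2]_(p in E) F p <= (16 ^+ 2 * (G z0 * t ^+ 2) + 16 ^+ 2 * (eta * t ^+ 2))%:E)%E.
  apply: (@le_trans _ _ (\int[mu2]_(p in E) (cst M%:E) p)%E).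
    apply: ge0_le_integral => //.
    move=> p [dp /close[_ _ h1 h2]]; rewrite alphi // in h1.
    rewrite lee_fin; apply: ler_pM; rewrite ?sqr_ge0 //.
      by rewrite -lerBlDl; apply: le_trans h2; exact: ler_norm.
    by rewrite ler_pXn2r ?nnegrE ?modulus_ge0 ?mulr_ge0 // ltW.
  rewrite integral_cst //.
  apply: (@le_trans _ _ (M%:E * mu2 S)%E).
    apply: lee_wpmul2l; first by rewrite lee_fin.
    by apply: le_measure; rewrite ?inE //; apply: measurableX; exact: measurable_itv.
  rewrite muS -EFinM lee_fin le_eqVlt; apply/orP; left; apply/eqP.
  have -> : M * (8 * d1 * t) ^+ 2 = (G z0 + eta) * (d2 * d1) ^+ 2 * 16 ^+ 2 * t ^+ 2.
    by rewrite /M; ring.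
  by rewrite d12; ring.
have QE : Q = plane (cbox x (x + t) y (y + t)).
  by apply/seteqP; split => p /=; [case|move=> h; split => //; have [] := close _ h].
have mHQ : measurable_fun Q H by apply: measurable_funS mH => // p [].
have LE : ((G z0 * t ^+ 2)%:E <= \int[mu2]_(p in Q) H p + (eta * t ^+ 2)%:E)%E.
  have muQ : mu2 Q = (t ^+ 2)%:E.
    by rewrite QE mu2_cbox ?lerDl ?(ltW t0) //; congr EFin; ring.
  have -> : ((G z0 * t ^+ 2)%:E = \int[mu2]_(p in Q) (cst (G z0)%:E) p)%E.
    by rewrite integral_cst // EFinM -muQ.
  have -> : ((eta * t ^+ 2)%:E = \int[mu2]_(p in Q) (cst eta%:E) p)%E.
    by rewrite integral_cst // EFinM -muQ.
  have eta0' (p : plane_type) : (0 <= cst eta%:E p)%E by rewrite lee_fin ltW.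
  rewrite -ge0_integralD //.
  apply: ge0_le_integral => //.
  - by move=> p _; rewrite lee_fin.
  - by apply: emeasurable_funD.
  - rewrite QE => p /close[_ _ _]; rewrite ler_norml => /andP[h _].
    have : G z0 <= G (cpx p) + eta by lra.
    by rewrite -lee_fin EFinD.
apply: (le_trans NE).
move: LE; set L := (\int[mu2]_(p in Q) H p)%E.
have : (0 <= L)%E by exact: integral_ge0.
case: L => [l| |] //; last by move=> _ _; rewrite gt0_muley ?lte_fin // addye ?leey.
move=> _; rewrite -EFinD -EFinM -EFinD !lee_fin => LE.
have -> : e = 16 ^+ 2 * eta + 16 ^+ 2 * eta.
  by rewrite -mulr2n -(mulr_natl _ 2) mulrA mulrC divfK // gt_eqF // mulr_gt0.
rewrite mulrDl addrA -mulrA lerD2r -mulrDr ler_pM2l //.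
Qed.

Let A (c : R) : set plane_type :=
  plane disc `&` (fun p => modulus (phi (cpx p)) ^+ 2) @^-1` `]-oo, c].

Let mA c : measurable (A c).
Proof.
have /(_ mD) h : measurable_fun (plane disc)
    (fun p : plane_type => modulus (phi (cpx p)) ^+ 2).
  apply: (rccont_measurable (g := fun z => modulus (phi z) ^+ 2)).
    exact: copen_disc.
  by move=> z /phic /ccont_modulus_sqr.
by apply: h; exact: measurable_itv.
Qed.

Let idc (z : C) : disc z -> ccont id z.
Proof. by move=> _; exact: cdiff_cont (@cdiff_id _ z). Qed.

Lemma quarters_le (k u : R) (n1 n2 n3 n4 l1 l2 l3 l4 : \bar R) : 0 <= k ->
  (0 <= l1 -> 0 <= l2 -> 0 <= l3 -> 0 <= l4 ->
   n1 <= k%:E * l1 + u%:E -> n2 <= k%:E * l2 + u%:E ->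
   n3 <= k%:E * l3 + u%:E -> n4 <= k%:E * l4 + u%:E ->
   n1 + n2 + (n3 + n4) <= k%:E * (l1 + l2 + (l3 + l4)) + ((u + u + (u + u))%R)%:E)%E.
Proof.
move=> k0 a1 a2 a3 a4 h1 h2 h3 h4; apply: (le_trans (leeD (leeD h1 h2) (leeD h3 h4))).
rewrite !ge0_muleDr ?adde_ge0 // !EFinD.
by rewrite (addeACA (_ * l1)%E) (addeACA (_ * l3)%E) (addeACA (_ * l1 + _)%E).
Qed.

(** Keeping away from the boundary of the target makes the local estimate
    available at every point of the closed square. *)
Lemma area_comparison_inner (c : R) : c < 1 ->
  (\int[mu2]_(p in A c) F p <= (16 ^+ 2)%:E * \int[mu2]_(p in plane disc) H p)%E.
Proof.
move=> c1; apply/lee_addgt0Pr => e' e'0.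
have [e e0 ->] : exists2 e : R, 0 < e & e' = e * 2 ^+ 2.
  by exists (e' / 2 ^+ 2); rewrite ?divr_gt0 ?exprn_gt0 // divfK // expf_neq0.
have [phiD alD alphi phial] := inv.
pose N x1 x2 y1 y2 := (\int[mu2]_(p in A c `&` plane (disc `&` phi @^-1` cbox x1 x2 y1 y2)) F p)%E.
pose L x1 x2 y1 y2 := (\int[mu2]_(p in setT `&` plane (disc `&` id @^-1` cbox x1 x2 y1 y2)) H p)%E.
pose P (x y t : R) : Prop := (N x (x + t)%R y (y + t)%R <=
  (16 ^+ 2)%:E * L x (x + t)%R y (y + t)%R + (e * t ^+ 2)%:E)%E.
have : P (-1) (-1) 2.
  apply: (@bisection_ind _ 1 1) => //.
  - move=> x y t t0; rewrite !mulr1 /P => p1 p2 p3 p4.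
    have tt u : u + t = u + t / 2 + t / 2 by rewrite -addrA -splitr.
    have t20 : 0 <= t / 2 by rewrite divr_ge0 // ltW.
    have NQ := integral_cbox_quarters copen_disc phic (mA c) mF F0 x y t20.
    have LQ := integral_cbox_quarters copen_disc idc measurableT mH H0 x y t20.
    rewrite (tt x) (tt y).
    have -> : N x (x + t / 2 + t / 2) y (y + t / 2 + t / 2) = _ := NQ.
    have -> : L x (x + t / 2 + t / 2) y (y + t / 2 + t / 2) =
      (L x (x + t / 2)%R y (y + t / 2)%R +
       L x (x + t / 2)%R (y + t / 2)%R (y + t / 2 + t / 2)%R +
      (L (x + t / 2)%R (x + t / 2 + t / 2)%R y (y + t / 2)%R +
       L (x + t / 2)%R (x + t / 2 + t / 2)%R (y + t / 2)%R (y + t / 2 + t / 2)%R))%E := LQ.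
    have L0 x1 x2 y1 y2 : (0 <= L x1 x2 y1 y2)%E by apply: integral_ge0 => p _; exact: H0.
    have -> : e * t ^+ 2 = (e * (t / 2) ^+ 2 + e * (t / 2) ^+ 2)
        + (e * (t / 2) ^+ 2 + e * (t / 2) ^+ 2) by field.
    by apply: quarters_le => //; exact: sqr_ge0.
  - move=> a b _ _; have [h|h] := leP (modulus (a +i* b) ^+ 2) c.
    + have dz : disc (a +i* b).
        rewrite /disc /= -(ltr_pXn2r (n := 2)) ?nnegrE ?modulus_ge0 // expr1n.
        exact: le_lt_trans c1.
      have [d d0 K] := area_comparison_local dz e0.
      exists d => // x y t td; rewrite !mulr1 => xa yb.
      rewrite /P /N /L setTI; apply: le_trans (K x y t td xa yb).
      have mB : measurable (plane (disc `&` phi @^-1` cbox x (x + t) y (y + t))).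
        by apply: measurable_cbox_preimage => //; exact: copen_disc.
      apply: ge0_subset_integral => //; first exact: measurableI.
      by apply: measurable_funS mF => // p [].
    + have e1 : 0 < (modulus (a +i* b) ^+ 2 - c) / 2 by rewrite divr_gt0 // subr_gt0.
      have [r r0 K] := ccont_modulus_sqr (cdiff_cont (@cdiff_id _ (a +i* b))) e1.
      exists (r / 4); first by rewrite divr_gt0.
      move=> x y t /andP[t0 tr]; rewrite !mulr1 => /andP[xa ax] /andP[yb bY].
      rewrite /P /N (_ : _ `&` _ = set0); last first.
        rewrite -subset0 => p [[_ +] [_ [/andP[h1 h2] /andP[h3 h4]]]].
        rewrite /= in_itv /= => hc.
        have : modulus (phi (cpx p) - (a +i* b)) < r.
          apply: (le_lt_trans (modulus_le_ReIm _)).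
          rewrite !Re_add !Im_add !Re_opp !Im_opp /=.
          have i1 : `|Re (phi (cpx p)) - a| <= t by abs_lra.
          have i2 : `|Im (phi (cpx p)) - b| <= t by abs_lra.
          lra.
        move=> /K; rewrite ler_norml => /andP[k _]; lra.
      rewrite integral_set0; apply: adde_ge0.
        by apply: mule_ge0; [rewrite lee_fin sqr_ge0|apply: integral_ge0 => p _; exact: H0].
      by rewrite lee_fin mulr_ge0 ?sqr_ge0 // ltW.
have inbox z : disc z -> cbox (-1) (-1 + 2) (-1) (-1 + 2) z.
  rewrite /disc /= => dz; have hr := le_lt_trans (Re_le_modulus z) dz.
  have hi := le_lt_trans (Im_le_modulus z) dz.
  move: hr hi; rewrite !ltr_norml => /andP[a1 a2] /andP[a3 a4].
  by split; apply/andP; split; lra.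
rewrite /P /N /L setTI (_ : A c `&` _ = A c); last first.
  apply/seteqP; split => p; first by case.
  by move=> Ap; have [dp _] := Ap; split => //; split => //; apply/inbox/phiD.
rewrite (_ : plane (disc `&` id @^-1` _) = plane disc) //.
by apply/seteqP; split => p; [case|move=> dp; split => //; exact: inbox].
Qed.

(** The subsets on which the modulus of [phi] is bounded away from [1] exhaust
    the disc. *)
Lemma area_comparison :
  (\int[mu2]_(p in plane disc) (G (phi (cpx p)) * modulus (cderive phi (cpx p)) ^+ 2)%:E <=
   (16 ^+ 2)%:E * \int[mu2]_(p in plane disc) (G (cpx p))%:E)%E.
Proof.
pose c n : R := 1 - n.+1%:R^-1.
have c1 n : c n < 1 by rewrite ltrBlDr ltrDl invr_gt0.
have cup : \bigcup_n A (c n) = plane disc.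
  apply/seteqP; split => p; first by move=> [n _ []].
  move=> dp; have [phiD _ _ _] := inv; have := phiD _ dp.
  rewrite /disc /= => h.
  have h2 : modulus (phi (cpx p)) ^+ 2 < 1 by rewrite expr_lt1 ?modulus_ge0.
  have [n hn] : exists n : nat, n.+1%:R^-1 < 1 - modulus (phi (cpx p)) ^+ 2.
    exists (Num.bound (1 - modulus (phi (cpx p)) ^+ 2)^-1).
    rewrite invf_plt ?posrE ?subr_gt0 //; apply: lt_le_trans (archi_boundP _) _.
      by rewrite invr_ge0 subr_ge0 ltW.
    by rewrite ler_nat.
  exists n => //; split => //=; rewrite in_itv /= /c lerBrDr -lerBrDl; exact: ltW.
have : ((\int[mu2]_(p in A (c n)) F p)%E @[n --> \oo] -->
    (\int[mu2]_(p in \bigcup_n A (c n)) F p)%E).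
  apply: ge0_nondecreasing_set_cvg_integral => //.
  - move=> n m nm; apply/subsetPset => p [dp]; rewrite /= !in_itv /= => h; split => //=.
    rewrite in_itv /=; apply: (le_trans h); rewrite lerD2l lerN2.
    by rewrite lef_pV2 ?posrE // ler_nat.
  - by move=> n; apply: measurable_funS mF => // p [].
rewrite cup => cv; rewrite -(cvg_lim _ cv) //.
apply: lime_le; first by apply/cvg_ex; exists (\int[mu2]_(p in plane disc) F p)%E.
by apply: nearW => n; exact: area_comparison_inner.
Qed.

End AreaComparison.

(** * The derivative at the origin is controlled by the Dirichlet integral *)

Section DerivativeBound.
Context {R : realType}.
Local Notation C := R[i].
Local Notation plane_type := (measurableTypeR R * measurableTypeR R)%type.

Definition energy (f : C -> C) : \bar R :=
  (\int[mu2]_(p in plane disc) (modulus (cderive f (cpx p)) ^+ 2)%:E)%E.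

Lemma energy_ge0 f : (0 <= energy f)%E.
Proof. by apply: integral_ge0 => p _; rewrite lee_fin sqr_ge0. Qed.

Lemma dirichlet_integralE f : dirichlet_integral f = ((pi^-1)%:E * energy f)%E.
Proof.
by rewrite /dirichlet_integral /energy; congr (_ * _)%E; apply: eq_integral => p _;
  rewrite cderiveE.
Qed.

(** The inequality of Cauchy and Schwarz in the additive form
    [2 * |F| <= k + |F| ^+ 2 / k], where [k] remains to be chosen. *)
Lemma cint_young (F : R -> C) (a b k : R) : a <= b -> 0 < k -> rcont_on F a b ->
  modulus (cint F a b) <= k * (b - a) + k^-1 * \int[mu]_(t in `[a, b]) (modulus (F t) ^+ 2).
Proof.
move=> ab k0 Fc; have [iR iI] := rcont_on_integrable Fc.
have iM := rcont_on_modulus_sqr Fc; have icst := integrable_itv_cst a b.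
have iMk : mu.-integrable `[a, b] (EFin \o (fun t => k^-1 * modulus (F t) ^+ 2)).
  by have := integrableZl _ k^-1 iM; exact.
have S (g : R -> R) : mu.-integrable `[a, b] (EFin \o g) ->
    (forall t, `|g t| <= modulus (F t)) ->
    `|\int[mu]_(t in `[a, b]) g t| <= 2^-1 * (k * (b - a)
        + k^-1 * \int[mu]_(t in `[a, b]) (modulus (F t) ^+ 2)).
  move=> ig gM; apply: (le_trans (le_normr_Rintegral _ ig)) => //.
  apply: (@le_trans _ _ (\int[mu]_(t in `[a, b]) (2^-1 * (k + k^-1 * modulus (F t) ^+ 2)))).
    apply: le_Rintegral; first by [].
    - exact: (integrable_norm ig).
    - by have := integrableZl _ 2^-1 (integrableD _ (icst k) iMk); exact.
    move=> t _; apply: (le_trans (gM t)).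
    rewrite -(ler_pM2l (_ : 0 < 2)) // mulVKf //.
    rewrite -(ler_pM2l k0) mulrDr mulVKf ?gt_eqF //.
    by have := sqr_ge0 (k - modulus (F t)); rewrite sqrrB; lra.
  rewrite RintegralZl //; last by have := integrableD _ (icst k) iMk; exact.
  rewrite RintegralD // RintegralZl // Rintegral_cst //= mu_itv //.
apply: (le_trans (modulus_le_ReIm _)); rewrite Re_cint Im_cint.
set Q := _ + _ in S *.
have -> : Q = 2^-1 * Q + 2^-1 * Q by rewrite [LHS]splitr [Q / 2]mulrC.
by apply: lerD; apply: S => // t; [exact: Re_le_modulus|exact: Im_le_modulus].
Qed.

(** A quantity that is integrable over a strip is small on some line. *)
Lemma exists_small (J : R -> \bar R) (a b I M : R) : a < b ->
  measurable_fun `[a, b] J -> (forall x, 0 <= J x)%E ->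
  (\int[mu]_(x in `[a, b]) J x <= I%:E)%E -> I < (b - a) * M ->
  exists2 x : R, a <= x <= b & (J x < M%:E)%E.
Proof.
move=> ab mJ J0 JI IM; apply: contrapT => nH.
have JM x : a <= x <= b -> (M%:E <= J x)%E.
  by move=> h; rewrite leNgt; apply/negP => h'; apply: nH; exists x.
have I0 : 0 <= I.
  by rewrite -lee_fin; apply: le_trans JI; apply: integral_ge0.
have M0 : 0 <= M.
  have := le_lt_trans I0 IM; rewrite pmulr_rgt0 ?subr_gt0 // => /ltW.
  by [].
have : ((M * (b - a))%:E <= I%:E)%E.
  apply: le_trans JI; have -> : (M * (b - a))%:E = (\int[mu]_(x in `[a, b]) (cst M%:E) x)%E.
    by rewrite integral_cst //= mu_itv ?ltW.
  exact: ge0_le_integral.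
by rewrite lee_fin mulrC leNgt IM.
Qed.

Variable f : C -> C.
Hypothesis hf : holomorphic_on_disc f.

Let sq (z : C) := modulus (cderive f z) ^+ 2.
Let G (p : plane_type) : \bar R := (sq (cpx p))%:E.
Let mD : measurable (plane (@disc R)).
Proof. by apply: copen_measurable; exact: copen_disc. Qed.

Lemma measurable_cderive_sqr :
  measurable_fun (plane disc) (fun p : plane_type => (modulus (cderive f (cpx p)) ^+ 2)%:E).
Proof.
apply/measurable_EFinP.
apply: (rccont_measurable (g := fun z => modulus (cderive f z) ^+ 2)).
  exact: copen_disc.
by move=> z dz; apply: ccont_modulus_sqr; exact: holo_cderive_cont.
Qed.

Let GD := G \_ (plane disc).
Let mGD : measurable_fun setT GD.
Proof. by apply/(measurable_restrictT _ _).1 => //; exact: measurable_cderive_sqr. Qed.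
Let GD0 p : (0 <= GD p)%E.
Proof. by apply: erestrict_ge0 => q _; rewrite lee_fin sqr_ge0. Qed.
Let energyE : energy f = (\int[mu2]_p GD p)%E.
Proof. by rewrite /energy integral_mkcond. Qed.

Let Jv (x : R) : \bar R := (\int[mu]_y GD (x, y))%E.
Let Jh (y : R) : \bar R := (\int[mu]_x GD (x, y))%E.

Let intJv : (\int[mu]_x Jv x)%E = energy f.
Proof. by rewrite energyE fubini_tonelli1. Qed.
Let intJh : (\int[mu]_y Jh y)%E = energy f.
Proof. by rewrite energyE fubini_tonelli2. Qed.
Let mJv : measurable_fun setT Jv.
Proof. exact: measurable_fun_fubini_tonelli_F. Qed.
Let mJh : measurable_fun setT Jh.
Proof. exact: measurable_fun_fubini_tonelli_G. Qed.
Let Jv0 x : (0 <= Jv x)%E.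
Proof. exact: integral_ge0. Qed.
Let Jh0 x : (0 <= Jh x)%E.
Proof. exact: integral_ge0. Qed.

Let small_line (J : R -> \bar R) (a b M : R) : a < b -> measurable_fun setT J ->
  (forall x, 0 <= J x)%E -> (\int[mu]_x J x)%E = energy f ->
  (energy f < ((b - a) * M)%:E)%E -> exists2 x : R, a <= x <= b & (J x < M%:E)%E.
Proof.
move=> ab mJ J0 JE; have := energy_ge0 f.
case E : (energy f) => [I| |] // _; rewrite lte_fin => IM.
apply: (exists_small ab (I := I)) => //.
  exact: measurable_funS mJ.
by rewrite -E -JE; apply: ge0_subset_integral.
Qed.
(** The horizontal and the vertical sides of a rectangle are treated alike: [g]
    parametrizes a line that keeps the distance [1 / 4] from the origin. *)
Let line_bound (g : R -> C) (a b k M : R) : a <= b -> b - a <= 1 -> 0 < k ->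
  (forall t, a <= t <= b -> disc (g t) /\ 4^-1 <= modulus (g t)) ->
  rcont_on (fun t => cderive f (g t)) a b ->
  rcont_on (fun t => cderive f (g t) * (g t)^-1) a b ->
  measurable_fun setT (fun t : measurableTypeR R => GD (Re (g t), Im (g t))) ->
  (\int[mu]_t GD (Re (g t), Im (g t)) < M%:E)%E ->
  modulus (cint (fun t => cderive f (g t) * (g t)^-1) a b) <= k + k^-1 * (4 ^+ 2 * M).
Proof.
move=> ab ab1 k0 gd c1 c2 mg JM.
apply: (le_trans (cint_young ab k0 c2)); apply: lerD.
  by rewrite ler_piMr // ltW.
rewrite ler_pM2l ?invr_gt0 //.
have i1 := rcont_on_modulus_sqr c1; have i2 := rcont_on_modulus_sqr c2.
apply: (@le_trans _ _ (\int[mu]_(t in `[a, b]) (4 ^+ 2 * modulus (cderive f (g t)) ^+ 2))).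
  apply: le_Rintegral; first by [].
  - exact: i2.
  - by have := integrableZl _ (4 ^+ 2) i1; exact.
  move=> t /=; rewrite in_itv /= => /gd[_ g4].
  rewrite modulusM exprMn mulrC; apply: ler_wpM2r; first exact: sqr_ge0.
  rewrite modulusV ler_pXn2r ?nnegrE ?invr_ge0 ?modulus_ge0 //.
  by rewrite -[leRHS]invrK lef_pV2 // posrE ?invr_gt0 //; apply: lt_le_trans g4; rewrite invr_gt0.
rewrite RintegralZl // ler_pM2l ?exprn_gt0 // -lee_fin.
apply: le_trans (ltW JM).
rewrite /Rintegral fineK; last exact: integrable_fin_num.
apply: (@le_trans _ _ (\int[mu]_(t in `[a, b]) GD (Re (g t), Im (g t)))%E).
  apply: le_of_eq; apply: eq_integral => t.
  rewrite inE /= in_itv /= => /gd[dg _]; rewrite /GD patchE mem_set //; last first.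
    by rewrite /plane /= /cpx /=; case: (g t) dg.
  by rewrite /G /sq /cpx /=; case: (g t).
exact: ge0_subset_integral.
Qed.

Let box_disc (w : C) : `|Re w| <= 2^-1 -> `|Im w| <= 2^-1 -> disc w.
Proof.
move=> h1 h2; rewrite /disc /= -(ltr_pXn2r (n := 2)) ?nnegrE ?modulus_ge0 // expr1n modulus_sqr.
have h (x : R) : `|x| <= 2^-1 -> x ^+ 2 <= 4^-1.
  move=> hx; rewrite -[leLHS]real_normK ?num_real //.
  have -> : 4^-1 = (2^-1) ^+ 2 :> R by rewrite expr2 -invfM -natrM.
  by rewrite ler_pXn2r ?nnegrE ?invr_ge0.
have := h _ h1; have := h _ h2; lra.
Qed.

(** [f' / w - f / w ^+ 2] is the derivative of [f / w], so that the integral of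
    [f / w ^+ 2] around the rectangle, which gives [f' 0], is that of [f' / w]. *)
Lemma cderive0_rect (x1 x2 y1 y2 : R) : - 2^-1 <= x1 <= - 4^-1 -> 4^-1 <= x2 <= 2^-1 ->
  - 2^-1 <= y1 <= - 4^-1 -> 4^-1 <= y2 <= 2^-1 ->
  4 * modulus (cderive f 0) <= modulus (rint (fun w => cderive f w * w^-1) x1 x2 y1 y2).
Proof.
move=> /andP[a1 a2] /andP[b1 b2] /andP[c1 c2] /andP[d1 d2].
have s0 : 0 < 8^-1 :> R by rewrite invr_gt0.
have in_disc w : x1 <= Re w <= x2 -> y1 <= Im w <= y2 -> disc w.
  by move=> /andP[? ?] /andP[? ?]; apply: box_disc; abs_lra.
have bd w : rbd x1 x2 y1 y2 w -> disc w /\ w != 0.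
  move=> [h1 h2 h]; split; first exact: in_disc.
  apply/eqP => w0; rewrite w0 /= in h; case: h => h; lra.
have x12 : x1 <= x2 by lra.
have y12 : y1 <= y2 by lra.
have z8 : modulus (0 : C) + 2 * 8^-1 < 1 by rewrite modulus0; lra.
have E := sqint_cderive hf s0 z8.
have A : rint (fun w => f (0 + w) * (w ^+ 2)^-1) x1 x2 y1 y2 =
    sqint (fun w => f (0 + w) * (w ^+ 2)^-1) 8^-1.
  apply: rint_annulus => //; [lra|lra|lra|lra|].
  move=> z h1 h2 z0; have dz : disc (0 + z) by rewrite add0r; exact: in_disc.
  by eexists; exact: (cdiffM (cdiff_shift (holo_cdiff hf dz)) (cdiff_inv_sq z0)).
pose g w := cderive f w * w^-1 + f w * - (w ^+ 2)^-1.
have gc w : rbd x1 x2 y1 y2 w -> ccont g w.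
  move=> /bd[dw w0]; apply: ccontD; apply: ccontM.
  - exact: holo_cderive_cont.
  - exact: cdiff_cont (cdiff_inv w0).
  - exact: holo_cont.
  - exact: cdiff_cont (cdiffN (cdiff_inv_sq w0)).
have g0 : rint g x1 x2 y1 y2 = 0.
  apply: (rint_derivative x12 y12 (f := fun w => f w * w^-1)) => // w /bd[dw w0].
  exact: cdiffM (holo_cdiff hf dw) (cdiff_inv w0).
have -> : rint (fun w => cderive f w * w^-1) x1 x2 y1 y2 =
    rint (fun w => g w + f (0 + w) * (w ^+ 2)^-1) x1 x2 y1 y2.
  by apply: eq_rint => // w _; rewrite /g add0r mulrN subrK.
rewrite rintD //; last first.
  move=> w /bd[dw w0]; apply: ccontM; last exact: cdiff_cont (cdiff_inv_sq w0).
  by apply: (ccont_near ltr01 _ (holo_cont hf dw)) => v _; rewrite add0r.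
rewrite g0 add0r A E modulusM mulrC; apply: ler_wpM2l; first exact: modulus_ge0.
exact: sqint_inv_ge.
Qed.

(** By Fubini's theorem each of four strips of width [1 / 4] contains a line on
    which the integral of [|f'| ^+ 2] is less than [4 * M]; these lines bound a
    rectangle around the origin. *)
Lemma cderive0_bound (M : R) : (energy f < M%:E)%E ->
  modulus (cderive f 0) ^+ 2 <= 16 ^+ 2 * M.
Proof.
move=> fM.
have M4 : ((energy f < ((4^-1) * (4 * M))%:E)%E) by rewrite mulrA mulVf // mul1r.
have [x1 hx1 J1] : exists2 x : R, - 2^-1 <= x <= - 4^-1 & (Jv x < (4 * M)%:E)%E.
  by apply: small_line => //; [lra|rewrite (_ : _ - _ = 4^-1) //; field].
have [x2 hx2 J2] : exists2 x : R, 4^-1 <= x <= 2^-1 & (Jv x < (4 * M)%:E)%E.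
  by apply: small_line => //; [lra|rewrite (_ : _ - _ = 4^-1) //; field].
have [y1 hy1 J3] : exists2 x : R, - 2^-1 <= x <= - 4^-1 & (Jh x < (4 * M)%:E)%E.
  by apply: small_line => //; [lra|rewrite (_ : _ - _ = 4^-1) //; field].
have [y2 hy2 J4] : exists2 x : R, 4^-1 <= x <= 2^-1 & (Jh x < (4 * M)%:E)%E.
  by apply: small_line => //; [lra|rewrite (_ : _ - _ = 4^-1) //; field].
have := cderive0_rect hx1 hx2 hy1 hy2.
have M0 : 0 <= M by rewrite -lee_fin; apply: le_trans (energy_ge0 f) (ltW fM).
set D := modulus (cderive f 0).
have [->|D0] := eqVneq D 0.
  by rewrite expr0n /= => _; rewrite mulr_ge0 ?sqr_ge0.
have {}D0 : 0 < D by rewrite lt_neqAle eq_sym D0 modulus_ge0.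
(* The choice of [k] that lets the term [k] of the estimate be absorbed. *)
pose k := D / 2; have k0 : 0 < k by rewrite divr_gt0.
move: hx1 hx2 hy1 hy2 => /andP[a1 a2] /andP[b1 b2] /andP[c1 c2] /andP[d1 d2].
pose B := k + k^-1 * (4 ^+ 2 * (4 * M)).
have side (g : R -> C) (a b : R) : a <= b -> b - a <= 1 ->
    (forall t, a <= t <= b -> [/\ `|Re (g t)| <= 2^-1, `|Im (g t)| <= 2^-1
      & 4^-1 <= `|Re (g t)| \/ 4^-1 <= `|Im (g t)|]) ->
    (forall F t, ccont F (g t) -> rcont (fun s => F (g s)) t) ->
    measurable_fun setT (fun t : measurableTypeR R => GD (Re (g t), Im (g t))) ->
    (\int[mu]_t GD (Re (g t), Im (g t)) < (4 * M)%:E)%E ->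
    modulus (cint (fun t => cderive f (g t) * (g t)^-1) a b) <= B.
  move=> ab ab1 hg gc mg JM.
  have gd t : a <= t <= b -> disc (g t) /\ 4^-1 <= modulus (g t).
    move=> /hg[h1 h2 h3]; split; first exact: box_disc.
    by case: h3 => h; apply: (le_trans h); rewrite ?Re_le_modulus ?Im_le_modulus.
  apply: line_bound => //.
    by move=> t /gd[dt _]; apply: gc; exact: holo_cderive_cont.
  move=> t /gd[dt g4]; apply: (gc (fun w => cderive f w * w^-1)); apply: ccontM; first exact: holo_cderive_cont.
  apply: cdiff_cont (cdiff_inv _); rewrite -modulus_gt0; apply: lt_le_trans g4.
  by rewrite invr_gt0.
have norm_in (u v t : R) : - 2^-1 <= u -> v <= 2^-1 -> u <= t <= v -> `|t| <= 2^-1.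
  by move=> hu hv /andP[ut tv]; rewrite ler_norml (le_trans hu ut) (le_trans tv hv).
have far (x : R) : - 2^-1 <= x <= - 4^-1 \/ 4^-1 <= x <= 2^-1 -> 4^-1 <= `|x| /\ `|x| <= 2^-1.
  by move=> h; case: (ler0P x) => x0; case: h => /andP[h1 h2]; split; lra.
have y12 : y1 <= y2 by lra.
have x12 : x1 <= x2 by lra.
have y21 : y2 - y1 <= 1 by lra.
have x21 : x2 - x1 <= 1 by lra.
have ver x : - 2^-1 <= x <= - 4^-1 \/ 4^-1 <= x <= 2^-1 -> (Jv x < (4 * M)%:E)%E ->
    modulus ('i * vint (fun w => cderive f w * w^-1) x y1 y2) <= B.
  move=> /far[x4 x2'] J; rewrite modulusM modulus_i mul1r.
  apply: (side (fun y => x +i* y) _ _ y12 y21) => [t ht|F t||]; [|exact: rcont_ver|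
    exact: measurableT_comp mGD (measurable_pair1 _)|exact: J].
  by split; [exact: x2'|exact: norm_in ht|left; exact: x4].
have hor y : - 2^-1 <= y <= - 4^-1 \/ 4^-1 <= y <= 2^-1 -> (Jh y < (4 * M)%:E)%E ->
    modulus (hint (fun w => cderive f w * w^-1) y x1 x2) <= B.
  move=> /far[y4 y2'] J.
  apply: (side (fun x => x +i* y) _ _ x12 x21) => [t ht|F t||]; [|exact: rcont_hor|
    exact: measurableT_comp mGD (measurable_pair2 _)|exact: J].
  by split; [exact: norm_in ht|exact: y2'|right; exact: y4].
move=> h; have {h} : 4 * D <= 4 * B.
  apply: (le_trans h); have -> : 4 * B = B + B + B + B by ring.
  apply: modulusB_le; last by apply: ver => //; left; rewrite a1.
  apply: modulusB_le; last by apply: hor => //; right; rewrite d1.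
  by apply: modulusD_le; [apply: hor => //; left; rewrite c1|apply: ver => //; right; rewrite b1].
rewrite ler_pM2l // /B => h.
have -> : 16 ^+ 2 * M = 4 ^+ 2 * (4 * M) * 4 by ring.
move: h; move: (4 ^+ 2 * (4 * M)) => Q h.
have h1 : D * k <= k * k + Q.
  have -> : k * k + Q = (k + k^-1 * Q) * k by field; rewrite gt_eqF.
  by rewrite ler_pM2r.
move: h1; have -> : D = 2 * k by rewrite /k mulrC divfK.
rewrite expr2; lra.
Qed.

End DerivativeBound.

(** * The Dirichlet space *)

Section Dirichlet.
Context {R : realType}.
Local Notation C := R[i].
Local Notation plane_type := (measurableTypeR R * measurableTypeR R)%type.
Implicit Types (f g : C -> C).

(** Members of the Dirichlet space vanish off the disc, so that a composition
    has to be cut off there. *)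
Definition dres g : C -> C := fun z => if `[< disc z >] then g z else 0.

Lemma dresE g z : disc z -> dres g z = g z.
Proof. by move=> dz; rewrite /dres asboolT. Qed.

Lemma dres_on g : on_disc (dres g).
Proof. by move=> z nz; rewrite /dres asboolF. Qed.

Lemma holo_eq f g : (forall z, disc z -> f z = g z) ->
  holomorphic_on_disc f -> holomorphic_on_disc g.
Proof.
move=> fg hf; apply: cdiff_holo => z dz; have [r r0 H] := disc_near dz.
by exists (cderive f z); apply: (cdiff_near r0 _ (holo_cdiff hf dz)) => w /H /fg.
Qed.

Lemma cderive_eq f g z : (forall z, disc z -> f z = g z) ->
  holomorphic_on_disc f -> disc z -> cderive g z = cderive f z.
Proof.
move=> fg hf dz; apply: cdiff_cderive; have [r r0 H] := disc_near dz.
by apply: (cdiff_near r0 _ (holo_cdiff hf dz)) => w /H /fg.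
Qed.

Lemma holo_dres g : holomorphic_on_disc g -> holomorphic_on_disc (dres g).
Proof. by apply: holo_eq => z dz; rewrite dresE. Qed.

Lemma cderive_dres g z : holomorphic_on_disc g -> disc z -> cderive (dres g) z = cderive g z.
Proof. by move=> hg; apply: cderive_eq => // w dw; rewrite dresE. Qed.

Lemma energy_dres g : holomorphic_on_disc g -> energy (dres g) = energy g.
Proof.
by move=> hg; apply: eq_integral => p; rewrite inE => dp; rewrite cderive_dres.
Qed.

Fact Dsq_sealed : {D : (C -> C) -> R | forall f, D f = fine (dirichlet_integral f)}.
Proof. by exists (fun f => fine (dirichlet_integral f)). Qed.

(** The square of the Dirichlet seminorm, sealed like the derivative. *)
Definition Dsq : (C -> C) -> R := sval Dsq_sealed.

Lemma DsqE f : Dsq f = fine (dirichlet_integral f).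
Proof. exact: (svalP Dsq_sealed). Qed.

Definition Nsq f : R := modulus (f 0) ^+ 2 + Dsq f.

Lemma dirichlet_integral_ge0 f : (0 <= dirichlet_integral f)%E.
Proof.
rewrite dirichlet_integralE mule_ge0 ?energy_ge0 // lee_fin invr_ge0; exact: pi_ge0.
Qed.

Lemma Dsq_ge0 f : 0 <= Dsq f.
Proof. by rewrite DsqE; apply: fine_ge0; exact: dirichlet_integral_ge0. Qed.

Lemma Nsq_ge0 f : 0 <= Nsq f.
Proof. by rewrite addr_ge0 ?sqr_ge0 ?Dsq_ge0. Qed.

Lemma Dsq_le_Nsq f : Dsq f <= Nsq f.
Proof. by rewrite lerDr sqr_ge0. Qed.

Lemma dirichlet_DsqE f : dirichlet f -> dirichlet_integral f = (Dsq f)%:E.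
Proof.
by move=> [_ _ fin]; rewrite DsqE fineK // ge0_fin_numE ?dirichlet_integral_ge0.
Qed.

Lemma dirichlet_energyE f : dirichlet f -> energy f = (pi * Dsq f)%:E.
Proof.
move=> df; have := dirichlet_DsqE df; rewrite dirichlet_integralE => E.
rewrite EFinM -E muleA -EFinM divff ?mul1e // gt_eqF //; exact: pi_gt0.
Qed.

(** Membership in the space and bounds for the seminorm are always obtained
    from a pointwise bound of the derivative by derivatives of members. *)
Lemma Dsq_dominated (I : Type) (s : seq I) (c : I -> R) (F : I -> C -> C) g :
  holomorphic_on_disc g -> (forall i, 0 <= c i) -> (forall i, dirichlet (F i)) ->
  (forall z, disc z -> modulus (cderive g z) ^+ 2 <=
     \sum_(i <- s) c i * modulus (cderive (F i) z) ^+ 2) ->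
  (dirichlet_integral g < +oo)%E /\ Dsq g <= \sum_(i <- s) c i * Dsq (F i).
Proof.
move=> hg c0 dF H.
have mD : measurable (plane (@disc R)) by apply: copen_measurable; exact: copen_disc.
have : (energy g <= (\sum_(i <- s) c i * (pi * Dsq (F i)))%:E)%E.
  apply: (@le_trans _ _ (\int[mu2]_(p in plane disc)
     (\sum_(i <- s) (c i)%:E * (modulus (cderive (F i) (cpx p)) ^+ 2)%:E))%E).
    apply: ge0_le_integral => //.
    - by move=> p _; rewrite lee_fin sqr_ge0.
    - exact: measurable_cderive_sqr.
    - apply: emeasurable_sum => i; apply: measurable_funeM.
      by apply: measurable_cderive_sqr; have [] := dF i.
    - move=> p dp; under eq_bigr do rewrite -EFinM.
      by rewrite sumEFin lee_fin; exact: H.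
  rewrite ge0_integral_sum //; last 2 first.
  - by move=> i; apply: measurable_funeM; apply: measurable_cderive_sqr; have [] := dF i.
  - by move=> i p _; rewrite mule_ge0 ?lee_fin ?sqr_ge0.
  rewrite -sumEFin; apply: lee_sum => i _.
  rewrite ge0_integralZl ?lee_fin //; last 2 first.
  - by apply: measurable_cderive_sqr; have [] := dF i.
  - by move=> p _; rewrite lee_fin sqr_ge0.
  by rewrite -/(energy (F i)) dirichlet_energyE // -EFinM.
move=> H1.
have pi0 : (0 <= (pi^-1)%:E :> \bar R)%E by rewrite lee_fin invr_ge0; exact: pi_ge0.
have : (dirichlet_integral g <= (\sum_(i <- s) c i * Dsq (F i))%:E)%E.
  rewrite dirichlet_integralE; apply: (le_trans (lee_wpmul2l pi0 H1)).
  rewrite -EFinM lee_fin mulr_sumr le_eqVlt; apply/orP; left; apply/eqP.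
  apply: eq_bigr => i _; rewrite mulrCA mulKf //.
  by rewrite gt_eqF // pi_gt0.
move=> H2; have fin : (dirichlet_integral g < +oo)%E by apply: (le_lt_trans H2); rewrite ltry.
split => //; rewrite -lee_fin DsqE fineK // ge0_fin_numE //; exact: dirichlet_integral_ge0.
Qed.

Lemma dirichlet_dres g : holomorphic_on_disc g -> (dirichlet_integral g < +oo)%E ->
  dirichlet (dres g).
Proof.
move=> hg fin; split; [exact: dres_on|exact: holo_dres|].
by rewrite dirichlet_integralE energy_dres // -dirichlet_integralE.
Qed.

Lemma Dsq_dres g : holomorphic_on_disc g -> Dsq (dres g) = Dsq g.
Proof. by move=> hg; rewrite !DsqE !dirichlet_integralE energy_dres. Qed.

Lemma dirichlet_on_eq f g : dirichlet f -> (forall z, disc z -> g z = f z) ->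
  on_disc g -> g = f.
Proof.
move=> [of_ _ _] gf og; apply/funext => z; have [dz|nz] := pselect (disc z); first exact: gf.
by rewrite of_ // og.
Qed.

Lemma dirichlet1 : dirichlet (dres (fun=> 1)) /\ Nsq (dres (fun=> 1)) = 1.
Proof.
have h1 : holomorphic_on_disc (fun=> 1 : C).
  by apply: cdiff_holo => z _; exists 0; exact: cdiff_cst.
have d1 z : cderive (fun=> 1 : C) z = 0 by apply: cdiff_cderive; exact: cdiff_cst.
have e0 : dirichlet_integral (fun=> 1 : C) = 0%E.
  rewrite dirichlet_integralE /energy integral0_eq ?mule0 // => p _.
  by rewrite d1 modulus0 expr0n.
split; first by apply: dirichlet_dres => //; rewrite e0.
rewrite /Nsq Dsq_dres // DsqE e0 /= addr0 dresE ?modulus1 ?expr1n //; exact: disc0.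
Qed.

Lemma dirichlet_lin (a b : C) f g : dirichlet f -> dirichlet g ->
  dirichlet (fun z => a * f z + b * g z) /\
  Nsq (fun z => a * f z + b * g z) <= 2 * modulus a ^+ 2 * Nsq f + 2 * modulus b ^+ 2 * Nsq g.
Proof.
move=> df dg; have [of_ hf _] := df; have [og hg _] := dg.
have dd z : disc z -> cdiff (fun z => a * f z + b * g z) z (a * cderive f z + b * cderive g z).
  by move=> dz; apply: cdiffD; apply: cdiffZ; exact: holo_cdiff.
have hfg : holomorphic_on_disc (fun z => a * f z + b * g z).
  by apply: cdiff_holo => z /dd ?; eexists; eassumption.
pose F (i : bool) := if i then f else g.
pose c (i : bool) := 2 * modulus (if i then a else b) ^+ 2.
have [] := @Dsq_dominated _ [:: true; false] c F _ hfg.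
- by move=> i; rewrite mulr_ge0 ?sqr_ge0.
- by case; [exact: df|exact: dg].
- move=> z dz; rewrite (cdiff_cderive (dd z dz)) !big_cons big_nil addr0 /c /F /=.
  apply: (le_trans (sqr_modulusD _ _)).
  by rewrite !modulusM !exprMn !mulrA.
move=> fin le; split.
  by split => // z nz; rewrite of_ // og // !mulr0 addr0.
rewrite !big_cons big_nil addr0 in le.
have {}le : Dsq (fun z => a * f z + b * g z) <=
   2 * modulus a ^+ 2 * Dsq f + 2 * modulus b ^+ 2 * Dsq g := le.
have le0 : modulus (a * f 0 + b * g 0) ^+ 2 <=
   2 * modulus a ^+ 2 * modulus (f 0) ^+ 2 + 2 * modulus b ^+ 2 * modulus (g 0) ^+ 2.
  by apply: (le_trans (sqr_modulusD _ _)); rewrite !modulusM !exprMn !mulrA.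
by rewrite /Nsq !mulrDr addrACA; exact: (lerD le0 le).
Qed.

End Dirichlet.

(** * Automorphisms of the disc and composition operators *)

Section Automorphisms.
Context {R : realType}.
Local Notation C := R[i].
Implicit Types (f g phi al : C -> C) (p z w : C).

Definition autpair phi al := [/\ holomorphic_on_disc phi, holomorphic_on_disc al
  & mutually_inverse_on_disc phi al].

Lemma autpair_sym phi al : autpair phi al -> autpair al phi.
Proof. by move=> [h1 h2 [h3 h4 h5 h6]]; split. Qed.

Lemma autpairD phi al z : autpair phi al -> disc z -> disc (phi z).
Proof. by move=> [_ _ [h _ _ _]]; exact: h. Qed.

Lemma autpairK phi al z : autpair phi al -> disc z -> al (phi z) = z.
Proof. by move=> [_ _ [_ _ h _]]; exact: h. Qed.

Lemma holo_comp f phi : holomorphic_on_disc f -> holomorphic_on_disc phi ->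
  (forall z, disc z -> disc (phi z)) -> holomorphic_on_disc (fun z => f (phi z)).
Proof.
move=> hf hp pD; apply: cdiff_holo => z dz.
by eexists; exact: (cdiff_comp (holo_cdiff hp dz) (holo_cdiff hf (pD _ dz))).
Qed.

Lemma cderive_comp f phi z : holomorphic_on_disc f -> holomorphic_on_disc phi ->
  disc z -> disc (phi z) ->
  cderive (fun z => f (phi z)) z = cderive f (phi z) * cderive phi z.
Proof.
move=> hf hp dz dp; apply: cdiff_cderive.
exact: (cdiff_comp (holo_cdiff hp dz) (holo_cdiff hf dp)).
Qed.

Lemma autpair_comp phi al phi' al' : autpair phi al -> autpair phi' al' ->
  autpair (fun z => phi (phi' z)) (fun z => al' (al z)).
Proof.
move=> h h'; have [h1 h2 _] := h; have [h1' h2' _] := h'.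
have hs := autpair_sym h; have hs' := autpair_sym h'.
split.
- by apply: holo_comp => // z; exact: autpairD h'.
- by apply: holo_comp => // z; exact: autpairD hs.
split=> z dz.
- by apply: (autpairD h); exact: (autpairD h').
- by apply: (autpairD hs'); exact: (autpairD hs).
- by rewrite (autpairK h) ?(autpairK h') //; exact: (autpairD h').
- by rewrite (autpairK hs') ?(autpairK hs) //; exact: (autpairD hs).
Qed.

Lemma autpair_id : autpair id id.
Proof.
have h : holomorphic_on_disc (@id C).
  by apply: cdiff_holo => z _; exists 1; exact: cdiff_id.
by split.
Qed.

Lemma autpair_iter phi al n : autpair phi al ->
  autpair (fun z => iter n phi z) (fun z => iter n al z).
Proof.
move=> h; elim: n => [|n IH]; first exact: autpair_id.
have := autpair_comp h IH; congr autpair; apply/funext => z /=.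
by rewrite -iterSr.
Qed.

(** Composition with an automorphism is bounded for the Dirichlet seminorm,
    with a constant that does not depend on the automorphism; it is this
    uniformity that matters for the iterates. *)
Lemma dirichlet_comp f phi al : autpair phi al -> dirichlet f ->
  dirichlet (dres (fun z => f (phi z))) /\
  Dsq (dres (fun z => f (phi z))) <= 16 ^+ 2 * Dsq f.
Proof.
move=> h df; have [hp ha inv] := h; have [_ hf _] := df.
have pD z : disc z -> disc (phi z) by exact: autpairD h.
have hfp : holomorphic_on_disc (fun z => f (phi z)) by exact: holo_comp.
have E : (energy (fun z => f (phi z)) <= (16 ^+ 2)%:E * energy f)%E.
  have Gc z : disc z -> rccont (fun z => modulus (cderive f z) ^+ 2) z.
    by move=> dz; apply: ccont_modulus_sqr; exact: holo_cderive_cont.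
  have := area_comparison hp ha inv (fun z => sqr_ge0 (modulus (cderive f z))) Gc.
  apply: le_trans; apply: le_of_eq.
  apply: eq_integral => q; rewrite inE => dq.
  by rewrite cderive_comp // ?modulusM ?exprMn //; exact: pD.
have pi0 : (0 <= (pi^-1)%:E :> \bar R)%E by rewrite lee_fin invr_ge0; exact: pi_ge0.
have E2 : (dirichlet_integral (fun z => f (phi z)) <= (16 ^+ 2 * Dsq f)%:E)%E.
  rewrite dirichlet_integralE; apply: (le_trans (lee_wpmul2l pi0 E)).
  by rewrite muleCA -dirichlet_integralE dirichlet_DsqE.
have fin : (dirichlet_integral (fun z => f (phi z)) < +oo)%E.
  by apply: (le_lt_trans E2); rewrite ltry.
split; first exact: dirichlet_dres.
rewrite Dsq_dres // -lee_fin DsqE fineK // ge0_fin_numE //; exact: dirichlet_integral_ge0.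
Qed.

(** The involutive automorphism that exchanges [0] and [p]. *)
Definition moebius p z : C := (p - z) / (1 - p^* * z).

Lemma modulus_conj p : modulus (p^*)%R = modulus p.
Proof.
have -> : (p^*)%R = conjc p by [].
by apply/eqP; rewrite -(eqrXn2 (n := 2)) ?modulus_ge0 // !modulus_sqr; case: p => x y /=; rewrite sqrrN.
Qed.

Lemma moebius_den p z : disc p -> modulus z <= 1 -> 1 - p^* * z != 0.
Proof.
rewrite /disc /= => dp dz; rewrite subr_eq0; apply/eqP => h.
have : modulus (p^* * z) < 1.
  rewrite modulusM modulus_conj; apply: le_lt_trans dp.
  by rewrite ler_piMr ?modulus_ge0.
by rewrite -h modulus1 ltxx.
Qed.

Lemma moebius_disc p z : disc p -> disc z -> disc (moebius p z).
Proof.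
move=> dp dz; have d0 := moebius_den dp (ltW dz).
move: dp dz; rewrite /disc /= => dp dz.
rewrite modulusM modulusV ltr_pdivrMr ?modulus_gt0 // mul1r.
rewrite -(ltr_pXn2r (n := 2)) ?nnegrE ?modulus_ge0 //.
have p2 : modulus p ^+ 2 < 1 by rewrite expr_lt1 ?modulus_ge0.
have z2 : modulus z ^+ 2 < 1 by rewrite expr_lt1 ?modulus_ge0.
rewrite -subr_gt0.
suff -> : modulus (1 - p^* * z) ^+ 2 - modulus (p - z) ^+ 2 =
    (1 - modulus p ^+ 2) * (1 - modulus z ^+ 2) by rewrite mulr_gt0 // subr_gt0.
rewrite !modulus_sqr; case: p {d0 dp p2} => a b; case: z {dz z2} => x y.
rewrite !Re_add !Im_add !Re_opp !Im_opp !Re_mul !Im_mul /=; ring.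
Qed.

Lemma conj_mul_disc p : disc p -> 1 - p^* * p != 0.
Proof. by move=> dp; apply: moebius_den => //; exact: ltW. Qed.

Lemma moebiusK p z : disc p -> disc z -> moebius p (moebius p z) = z.
Proof.
move=> dp dz; have d0 := moebius_den dp (ltW dz).
have d1 := moebius_den dp (ltW (moebius_disc dp dz)).
have d2 := conj_mul_disc dp.
move: d0 d1 d2; rewrite /moebius; move: (p^*)%R => q d0 d1 d2.
have -> : p - (p - z) / (1 - q * z) = z * (1 - q * p) / (1 - q * z) by field.
have -> : 1 - q * ((p - z) / (1 - q * z)) = (1 - q * p) / (1 - q * z) by field.
by field; rewrite d0 d2.
Qed.

Lemma cdiff_moebius p z : disc p -> disc z -> exists d, cdiff (moebius p) z d.
Proof.
move=> dp dz; have d0 := moebius_den dp (ltW dz).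
have h := cdiffM (cdiffB (cdiff_cst p z) (@cdiff_id _ z))
  (cdiffV (f := fun w => 1 - (p^*)%R * w) d0
     (cdiffB (cdiff_cst 1 z) (cdiffZ (p^*)%R (@cdiff_id _ z)))).
by eexists; exact: (cdiff_near ltr01 (fun w _ => erefl) h).
Qed.

Lemma autpair_moebius p : disc p -> autpair (moebius p) (moebius p).
Proof.
move=> dp; have h : holomorphic_on_disc (moebius p).
  by apply: cdiff_holo => z dz; exact: cdiff_moebius.
by split => //; split => z dz; by [exact: moebius_disc|exact: moebiusK].
Qed.

Lemma cderive_moebius0 p : disc p -> cderive (moebius p) 0 = p^* * p - 1.
Proof.
move=> dp; have d0 := moebius_den dp (ltW (@disc0 R)).
apply: cdiff_cderive.
have h := cdiffM (cdiffB (cdiff_cst p 0) (@cdiff_id _ 0))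
  (cdiffV (f := fun w => 1 - (p^*)%R * w) d0
     (cdiffB (cdiff_cst 1 0) (cdiffZ (p^*)%R (@cdiff_id _ 0)))).
apply: cdiff_eq (cdiff_near ltr01 (fun w _ => erefl) h).
by rewrite mulr0 !subr0 expr1n !invr1; ring.
Qed.

Lemma moebius0 p : moebius p 0 = p.
Proof. by rewrite /moebius mulr0 !subr0 divr1. Qed.

Lemma autpair_rotation (u : C) : modulus u = 1 ->
  autpair (fun z => u * z) (fun z => u^-1 * z).
Proof.
move=> u1; have u0 : u != 0 by rewrite -modulus_gt0 u1.
have h (v : C) : holomorphic_on_disc (fun z => v * z).
  by apply: cdiff_holo => z _; eexists; exact: (cdiffZ v (@cdiff_id _ z)).
split; [exact: h|exact: h|split] => z dz.
- by rewrite /disc /= modulusM u1 mul1r.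
- by rewrite /disc /= modulusM modulusV u1 invr1 mul1r.
- by rewrite mulKf.
- by rewrite mulVKf.
Qed.

Lemma modulus_cos_sin (theta : R) : modulus (cos theta +i* sin theta) = 1.
Proof.
apply/eqP; rewrite -(eqrXn2 (n := 2)) ?modulus_ge0 // modulus_sqr /= expr1n.
by rewrite cos2Dsin2.
Qed.

Lemma autpair_disc_automorphism p (theta : R) : disc p ->
  autpair (disc_automorphism p theta)
    (fun z => moebius p ((cos theta +i* sin theta)^-1 * z)).
Proof.
by move=> dp; apply: autpair_comp (autpair_rotation (modulus_cos_sin theta)) (autpair_moebius dp).
Qed.

Lemma autpair_eq phi al phi' : (forall z, disc z -> phi' z = phi z) ->
  autpair phi al -> autpair phi' al.
Proof.
move=> E [hp ha [pD aD ap pa]]; split; [|exact: ha|split=> z dz].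
- by apply: holo_eq hp => z dz; rewrite E.
- by rewrite E //; exact: pD.
- exact: aD.
- by rewrite E // ap.
- by rewrite E ?pa //; exact: aD.
Qed.

(** Bounds of derivatives and values by the seminorm: at the origin by the
    area estimate, elsewhere by moving the point to the origin. *)
Lemma cderive0_Dsq f : dirichlet f ->
  modulus (cderive f 0) ^+ 2 <= 16 ^+ 2 * pi * Dsq f.
Proof.
move=> df; have [_ hf _] := df.
apply/ler_addgt0Pr => e e0.
have k0 : 0 < 16 ^+ 2 :> R by rewrite exprn_gt0 // ltr0n.
have : modulus (cderive f 0) ^+ 2 <= 16 ^+ 2 * (pi * Dsq f + e / 16 ^+ 2).
  apply: cderive0_bound => //; rewrite dirichlet_energyE // lte_fin ltrDl.
  exact: divr_gt0.
by rewrite mulrDr mulrA [_ * (e / _)]mulrC divfK // gt_eqF.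
Qed.

Lemma cderive_Dsq (r : R) : 0 <= r -> r < 1 -> exists2 B : R, 0 < B &
  forall f z, dirichlet f -> modulus z <= r -> modulus (cderive f z) ^+ 2 <= B * Dsq f.
Proof.
move=> r0 r1; have r2 : r ^+ 2 < 1 by rewrite expr_lt1.
pose K : R := 16 ^+ 2 * pi * 16 ^+ 2; pose q := (1 - r ^+ 2) ^+ 2.
have q0 : 0 < q by rewrite exprn_gt0 // subr_gt0.
have k0 : 0 < 16 ^+ 2 :> R by rewrite exprn_gt0 // ltr0n.
have K0 : 0 < K by rewrite mulr_gt0 // mulr_gt0 // pi_gt0.
exists (K / q); first exact: divr_gt0.
move=> f z df zr; have dz : disc z by exact: le_lt_trans r1.
have [_ hf _] := df; have az := autpair_moebius dz; have [hm _ _] := az.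
have [dc Ec] := dirichlet_comp az df.
have hfm : holomorphic_on_disc (fun w => f (moebius z w)).
  by apply: holo_comp => // w; exact: autpairD az.
have := cderive0_Dsq dc; rewrite cderive_dres //; last exact: disc0.
rewrite cderive_comp ?moebius0 //; last exact: disc0.
rewrite cderive_moebius0 // modulusM exprMn => h.
have h2 : q <= modulus (z^* * z - 1) ^+ 2.
  rewrite ler_pXn2r ?nnegrE ?modulus_ge0 ?subr_ge0 ?(ltW r2) //.
  rewrite modulusBC; apply: le_trans (modulus_sub_ge _ _).
  rewrite modulus1 modulusM modulus_conj lerD2l lerN2 -expr2.
  by rewrite ler_pXn2r ?nnegrE ?modulus_ge0.
rewrite mulrAC ler_pdivlMr //.
apply: (@le_trans _ _ (modulus (cderive f z) ^+ 2 * modulus (z^* * z - 1) ^+ 2)).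
  by apply: ler_wpM2l => //; exact: sqr_ge0.
apply: (le_trans h); rewrite /K -[leRHS]mulrA; apply: ler_wpM2l => //.
by rewrite mulr_ge0 ?pi_ge0 // ltW.
Qed.

(** The mean value inequality on a disc, from the integral of the derivative
    along a segment; the factor two comes from separating real and imaginary
    parts. *)
Lemma mean_value f (r B : R) z w : holomorphic_on_disc f -> r < 1 ->
  modulus z <= r -> modulus w <= r ->
  (forall v, modulus v <= r -> modulus (cderive f v) <= B) ->
  modulus (f w - f z) <= 2 * B * modulus (w - z).
Proof.
move=> hf r1 zr wr fB.
pose g (u : C) : C := z + u * (w - z).
have gr t : 0 <= t <= 1 -> modulus (g (t +i* 0)) <= r.
  move=> /andP[t0 t1]; have s0 : 0 <= 1 - t by rewrite subr_ge0.
  have -> : g (t +i* 0) = (1 - t)%:C * z + t%:C * w by rewrite /g (_ : t +i* 0 = t%:C) // rmorphB rmorph1; ring.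
  have -> : r = (1 - t) * r + t * r by ring.
  apply: modulusD_le; rewrite modulusM modulus_real ger0_norm //; exact: ler_wpM2l.
have disc_g t : 0 <= t <= 1 -> disc (g (t +i* 0)) by move=> /gr h; exact: le_lt_trans r1.
have dg u : cdiff g u (w - z).
  apply: cdiff_eq (cdiffD (cdiff_cst z u) (cdiffM (@cdiff_id _ u) (cdiff_cst (w - z) u))).
  by rewrite mulr0 addr0 mul1r add0r.
have Fc : rcont_on (fun t => cderive f (g (t +i* 0)) * (w - z)) 0 1.
  move=> t ht; apply: (rcont_hor (f := fun u => cderive f (g u) * (w - z))).
  apply: ccontM (ccont_cst _ _); apply: ccont_comp (cdiff_cont (dg _)) _.
  exact: holo_cderive_cont hf (disc_g t ht).
have E : cint (fun t => cderive f (g (t +i* 0)) * (w - z)) 0 1 = f (g (1 +i* 0)) - f (g (0 +i* 0)).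
  apply: (cint_FTC (G := fun t => f (g (t +i* 0))) ler01 Fc) => t ht.
  apply: (rdiff_hor (f := fun u => f (g u))).
  exact: cdiff_comp (dg _) (holo_cdiff hf (disc_g t ht)).
have -> : f w - f z = f (g (1 +i* 0)) - f (g (0 +i* 0)).
  by rewrite /g (_ : 1 +i* 0 = 1 :> C) // (_ : 0 +i* 0 = 0 :> C) // mul1r mul0r addr0 subrKC.
rewrite -E; have -> : 2 * B * modulus (w - z) = 2 * (B * modulus (w - z)) * (1 - 0).
  by rewrite subr0; ring.
apply: modulus_cint_le => // t ht; rewrite modulusM.
by apply: ler_wpM2r; [exact: modulus_ge0|apply: fB; exact: gr].
Qed.

(** Values are compared along segments, as the seminorm ignores constants. *)
Lemma value_Dsq (r : R) : 0 <= r -> r < 1 -> exists2 B : R, 0 < B &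
  forall f z w, dirichlet f -> modulus z <= r -> modulus w <= r ->
    modulus (f w - f z) ^+ 2 <= B * Dsq f.
Proof.
move=> r0 r1; have [B B0 H] := cderive_Dsq r0 r1.
exists (4 ^+ 2 * B); first by rewrite mulr_gt0 // exprn_gt0.
move=> f z w df zr wr; have [_ hf _] := df.
pose b := Num.sqrt (B * Dsq f).
have b2 : b ^+ 2 = B * Dsq f.
  by rewrite sqr_sqrtr // mulr_ge0 ?Dsq_ge0 // ltW.
have b0 : 0 <= b by exact: sqrtr_ge0.
have fb v : modulus v <= r -> modulus (cderive f v) <= b.
  move=> vr; rewrite -(ler_pXn2r (n := 2)) ?nnegrE ?modulus_ge0 // b2; exact: H.
have h := mean_value hf r1 zr wr fb.
have wz : modulus (w - z) <= 2.
  apply: (le_trans (le_modulusB _ _)); apply: (le_trans (lerD wr zr)); lra.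
rewrite -mulrA -b2 -exprMn ler_pXn2r ?nnegrE ?modulus_ge0 ?mulr_ge0 //.
apply: (le_trans h); apply: (@le_trans _ _ (2 * b * 2)).
  by apply: ler_wpM2l => //; rewrite mulr_ge0.
by rewrite mulrAC -natrM.
Qed.

Lemma point_Nsq (r : R) : 0 <= r -> r < 1 -> exists2 B : R, 0 < B &
  forall f z, dirichlet f -> modulus z <= r -> modulus (f z) ^+ 2 <= B * Nsq f.
Proof.
move=> r0 r1; have [B B0 H] := value_Dsq r0 r1.
exists (2 * B + 2); first by rewrite addr_gt0 // mulr_gt0.
move=> f z df zr; have := H f 0 z df; rewrite modulus0 => /(_ r0 zr) h.
have -> : f z = (f z - f 0) + f 0 by rewrite subrK.
apply: (le_trans (sqr_modulusD _ _)); rewrite /Nsq.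
have := Dsq_ge0 f; have := sqr_ge0 (modulus (f 0)).
move: h; move: (modulus _ ^+ 2) (modulus (f 0) ^+ 2) (Dsq f) => u v d h v0 d0.
have := mulr_ge0 (ltW B0) v0; nra.
Qed.

End Automorphisms.

(** * Growth along the iterates of an automorphism *)

Section Iterates.
Context {R : realType}.
Local Notation C := R[i].
Implicit Types (f g u : C -> C) (z w : C).

(** The seminorm does not grow along the iterates, and every step moves the
    value at the origin by at most a constant times the seminorm. *)
Lemma iterate_Nsq (phi al : C -> C) : autpair phi al -> exists2 B : R, 0 < B &
  forall n g, dirichlet g -> dirichlet (dres (fun z => g (iter n phi z))) /\
    Nsq (dres (fun z => g (iter n phi z))) <= B * n.+1%:R ^+ 2 * Nsq g.
Proof.
move=> pa; have d0 := @disc0 R; have dp0 : disc (phi 0) by exact: autpairD pa d0.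
have [B0 B00 H] := value_Dsq (modulus_ge0 (phi 0)) dp0.
pose k : R := 16 ^+ 2; have k0 : 0 <= k by exact: sqr_ge0.
pose B1 := B0 * k; have B10 : 0 <= B1 by rewrite mulr_ge0 // ltW.
exists (2 + 2 * B1 + k).
  by apply: ltr_wpDr k0 _; apply: ltr_wpDr (mulr_ge0 (ler0n _ 2) B10) _; exact: ltr0n.
move=> n g dg.
have comp m : dirichlet (dres (fun z => g (iter m phi z))) /\
    Dsq (dres (fun z => g (iter m phi z))) <= k * Dsq g.
  exact: (dirichlet_comp (autpair_iter m pa) dg).
have [dn En] := comp n; split; first exact: dn.
pose b := Num.sqrt (B1 * Dsq g).
have b2 : b ^+ 2 = B1 * Dsq g by rewrite sqr_sqrtr // mulr_ge0 ?Dsq_ge0.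
have b0 : 0 <= b by exact: sqrtr_ge0.
have step m : modulus (g (iter m phi (phi 0)) - g (iter m phi 0)) <= b.
  have [dm Em] := comp m.
  have := H _ 0 (phi 0) dm; rewrite modulus0 modulus_ge0 lexx => /(_ isT isT).
  rewrite !dresE // => h.
  rewrite -(ler_pXn2r (n := 2)) ?nnegrE ?modulus_ge0 // b2 /B1 -mulrA.
  by apply: (le_trans h); apply: ler_wpM2l => //; exact: ltW.
have val m : modulus (g (iter m phi 0)) <= modulus (g 0) + m%:R * b.
  elim: m => [|m IH]; first by rewrite mul0r addr0.
  rewrite iterSr -[g _](subrK (g (iter m phi 0))).
  apply: (le_trans (le_modulusD _ _)); rewrite -natr1 mulrDl mul1r addrA [leLHS]addrC.
  exact: (lerD IH (step m)).
have v2 : modulus (g (iter n phi 0)) ^+ 2 <= 2 * modulus (g 0) ^+ 2 + 2 * (n%:R ^+ 2 * (B1 * Dsq g)).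
  rewrite -b2 -exprMn; have := val n; move: (mulr_ge0 (ler0n R n) b0).
  move: (modulus_ge0 (g (iter n phi 0))) (modulus_ge0 (g 0)).
  move: (modulus _) (modulus (g 0)) (_ * b) => x y t x0 y0 t0 xy.
  apply: (@le_trans _ _ ((y + t) ^+ 2)).
    by rewrite ler_pXn2r ?nnegrE ?addr_ge0.
  by have := sqr_ge0 (y - t); rewrite sqrrB sqrrD; lra.
rewrite {1}/Nsq dresE //; apply: (le_trans (lerD v2 En)); have D0 := Dsq_le_Nsq g.
have n1 : 1 <= n.+1%:R ^+ 2 :> R by rewrite exprn_ege1 // ler1n.
have nn : n%:R ^+ 2 <= n.+1%:R ^+ 2 :> R by rewrite ler_pXn2r ?nnegrE ?ler0n // ler_nat.
have g0 : modulus (g 0) ^+ 2 <= Nsq g by rewrite lerDl Dsq_ge0.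
have bound (x t v : R) : 0 <= x -> 0 <= t -> t <= n.+1%:R ^+ 2 -> v <= Nsq g ->
    x * (t * v) <= x * n.+1%:R ^+ 2 * Nsq g.
  move=> x0 t0 tn vN; rewrite -[leRHS]mulrA; apply: (ler_wpM2l x0).
  by apply: (le_trans (ler_wpM2l t0 vN)); exact: (ler_wpM2r (Nsq_ge0 g)).
have i1 := bound 2 1 _ (ler0n _ 2) ler01 n1 g0.
have i2 := bound (2 * B1) (n%:R ^+ 2) _ (mulr_ge0 (ler0n _ 2) B10) (sqr_ge0 _) nn D0.
have i3 := bound k 1 _ k0 ler01 n1 D0.
have -> : 2 * modulus (g 0) ^+ 2 + 2 * (n%:R ^+ 2 * (B1 * Dsq g)) + k * Dsq g =
  2 * (1 * modulus (g 0) ^+ 2) + 2 * B1 * (n%:R ^+ 2 * Dsq g) + k * (1 * Dsq g) by ring.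
by apply: (le_trans (lerD (lerD i1 i2) i3)); apply: le_of_eq; ring.
Qed.

Lemma weighted_cauchy_schwarz (n : nat) (t w : nat -> R) : (forall k, 0 < w k) ->
  (\sum_(0 <= k < n) t k) ^+ 2 <=
  (\sum_(0 <= k < n) w k) * \sum_(0 <= k < n) (w k)^-1 * t k ^+ 2.
Proof.
move=> w0; elim: n => [|n IH]; first by rewrite !big_geq // expr0n mul0r.
have W0 : 0 <= \sum_(0 <= k < n) w k by apply: sumr_ge0 => k _; exact: ltW.
have Q0 : 0 <= \sum_(0 <= k < n) (w k)^-1 * t k ^+ 2.
  by apply: sumr_ge0 => k _; rewrite mulr_ge0 ?sqr_ge0 // invr_ge0 ltW.
rewrite !big_nat_recr //=.
move: IH W0 Q0; move: (\sum_(0 <= k < n) t k) (\sum_(0 <= k < n) w k)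
  (\sum_(0 <= k < n) (w k)^-1 * t k ^+ 2) (t n) (w n) (w0 n) => T W Q s v v0 IH W0 Q0.
have -> : (W + v) * (Q + v^-1 * s ^+ 2) = W * Q + v * Q + W * (v^-1 * s ^+ 2) + s ^+ 2.
  by field; rewrite gt_eqF.
suff : 2 * (T * s) <= v * Q + W * (v^-1 * s ^+ 2).
  by rewrite sqrrD mulr2n; lra.
move: W0; rewrite le_eqVlt => /predU1P[W0|W0].
  move: IH; rewrite -W0 mul0r => h.
  have -> : T = 0 by apply/eqP; rewrite -sqrf_eq0 eq_le h sqr_ge0.
  by rewrite !mul0r mulr0 addr0 mulr_ge0 // ltW.
rewrite -(ler_pM2l (mulr_gt0 W0 v0)).
have -> : W * v * (v * Q + W * (v^-1 * s ^+ 2)) = v ^+ 2 * (W * Q) + (W * s) ^+ 2.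
  by field; rewrite gt_eqF.
apply: (@le_trans _ _ (v ^+ 2 * T ^+ 2 + (W * s) ^+ 2)).
  have := sqr_ge0 (v * T - W * s); rewrite sqrrB exprMn mulr2n.
  have -> : W * v * (2 * (T * s)) = v * T * (W * s) + v * T * (W * s) by ring.
  lra.
by rewrite lerD2r; apply: ler_wpM2l => //; exact: sqr_ge0.
Qed.

Lemma sqr_modulus_sum (n : nat) (x : nat -> C) (w : nat -> R) : (forall k, 0 < w k) ->
  modulus (\sum_(0 <= k < n) x k) ^+ 2 <=
  (\sum_(0 <= k < n) w k) * \sum_(0 <= k < n) (w k)^-1 * modulus (x k) ^+ 2.
Proof.
move=> w0; apply: (le_trans _ (weighted_cauchy_schwarz n (fun k => modulus (x k)) w0)).
rewrite ler_pXn2r ?nnegrE ?modulus_ge0 //; last by apply: sumr_ge0 => k _; exact: modulus_ge0.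
elim: n => [|n IH]; first by rewrite !big_geq // modulus0.
by rewrite !big_nat_recr //=; apply: (le_trans (le_modulusD _ _)); rewrite lerD2r.
Qed.

(** A weight whose multiplication operator and whose values are bounded above
    and below. *)
Section Products.
Variables (phi al u : C -> C) (M b : R).
Hypothesis pa : autpair phi al.
Hypothesis hu : holomorphic_on_disc u.
Hypothesis uM : forall g, dirichlet g ->
  dirichlet (fun z => u z * g z) /\ Nsq (fun z => u z * g z) <= M * Nsq g.
Hypothesis u0 : forall z, disc z -> u z != 0.
Hypothesis ub : forall z, disc z -> (modulus (u z))^-1 <= b.
Hypothesis M0 : 0 < M.

Definition wprod n z : C := \prod_(0 <= k < n) u (iter k phi z).

Let pn n z : disc z -> disc (iter n phi z).
Proof. exact: (autpairD (autpair_iter n pa)). Qed.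

Lemma wprod0 z : wprod 0 z = 1.
Proof. by rewrite /wprod big_geq. Qed.

Lemma wprodS n z : wprod n.+1 z = wprod n z * u (iter n phi z).
Proof. by rewrite /wprod big_nat_recr. Qed.

Let uk k g z := u (iter k phi z) * g z.

Let huk k : holomorphic_on_disc (fun z => u (iter k phi z)).
Proof.
have [hk _ _] := autpair_iter k pa.
exact: (holo_comp hu hk (@pn k)).
Qed.

(** [(u o phi_k) g = (u (g o phi_k^-1)) o phi_k], so that the seminorm of this
    product is bounded by conformal invariance and the boundedness of
    multiplication by [u]. *)
Lemma weight_iterate_Dsq : exists2 K : R, 0 < K & forall k g, dirichlet g ->
  dirichlet (dres (uk k g)) /\ Dsq (dres (uk k g)) <= K * k.+1%:R ^+ 2 * Nsq g.
Proof.
have [B B0 HB] := iterate_Nsq (autpair_sym pa).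
have k16 : 0 < 16 ^+ 2 :> R by rewrite exprn_gt0 // ltr0n.
exists (16 ^+ 2 * (M * B)); first by rewrite mulr_gt0 // mulr_gt0.
move=> k g dg; have [d1 E1] := HB k g dg; have [d2 E2] := uM d1.
have [d3 E3] := dirichlet_comp (autpair_iter k pa) d2.
have E : dres (uk k g) = dres (fun z => u (iter k phi z) *
     dres (fun w => g (iter k al w)) (iter k phi z)).
  apply/funext => z; rewrite /dres; case: asboolP => // dz.
  by rewrite asboolT ?(autpairK (autpair_iter k pa)) //; exact: pn.
rewrite E; split; first exact: d3.
apply: (le_trans E3).
have -> : 16 ^+ 2 * (M * B) * k.+1%:R ^+ 2 * Nsq g =
  16 ^+ 2 * (M * (B * k.+1%:R ^+ 2 * Nsq g)) by ring.
apply: ler_wpM2l; first exact: ltW.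
apply: (le_trans (Dsq_le_Nsq _)); apply: (le_trans E2).
by apply: ler_wpM2l E1; exact: ltW.
Qed.

(** The rule for the derivative of a product, rearranged so that the derivatives
    of the factors only enter through the functions [(u o phi_k) g]; the last
    term corrects for the [n] copies of [g'] that these contain. *)
Lemma cdiff_wprod n g z : holomorphic_on_disc g -> disc z ->
  cdiff (fun w => wprod n w * g w) z
    (\sum_(0 <= k < n) wprod n z / u (iter k phi z) * cderive (uk k g) z
       - (n%:R - 1) * wprod n z * cderive g z).
Proof.
move=> hg dz; elim: n => [|n IH].
  rewrite big_geq // wprod0 sub0r !mulr0n; apply: cdiff_eq (cdiff_near ltr01 _ (holo_cdiff hg dz)).
    by rewrite sub0r mulr1 mulN1r opprK.
  by move=> w _; rewrite wprod0 mul1r.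
have dn := pn n dz; have un0 := u0 dn.
have du := holo_cdiff (@huk n) dz.
have E : cderive (uk n g) z = cderive (fun z => u (iter n phi z)) z * g z
    + u (iter n phi z) * cderive g z.
  by apply: cdiff_cderive; exact: cdiffM du (holo_cdiff hg dz).
apply: cdiff_eq (cdiff_near ltr01 _ (cdiffM du IH)); last first.
  by move=> w _; rewrite wprodS; ring.
rewrite big_nat_recr //= wprodS.
have -> : \sum_(0 <= k < n) wprod n z * u (iter n phi z) / u (iter k phi z) * cderive (uk k g) z
  = u (iter n phi z) * \sum_(0 <= k < n) wprod n z / u (iter k phi z) * cderive (uk k g) z.
  by rewrite mulr_sumr; apply: eq_bigr => k _; ring.
rewrite mulfK // E -natr1; ring.
Qed.

(** The derivative of the product is a sum of [n + 1] terms, and each of them is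
    at most [(n + 1) * (1 + b) * c * L ^+ n] times the derivative of a function
    whose seminorm grows polynomially. *)
Lemma wprod_Nsq (c L : R) : 0 < c -> 0 < L ->
  (forall n z, disc z -> modulus (wprod n z) <= c * L ^+ n) ->
  exists2 K : R, 0 < K & forall n g, dirichlet g ->
    dirichlet (dres (fun z => wprod n z * g z)) /\
    Nsq (dres (fun z => wprod n z * g z)) <= K * n.+1%:R ^+ 5 * (L ^+ n) ^+ 2 * Nsq g.
Proof.
move=> c0 L0 wb; have [K K0 HK] := weight_iterate_Dsq; have d0 := @disc0 R.
have b0 : 0 <= b by apply: le_trans (ub d0); rewrite invr_ge0 modulus_ge0.
pose B := (1 + b) * c; have B0 : 0 < B by rewrite mulr_gt0 // ltr_wpDr.
have K1 : 0 < 1 + K by exact: addr_gt0.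
exists (4 * (1 + K) * B ^+ 2); first by rewrite mulr_gt0 ?exprn_gt0 // mulr_gt0.
move=> n g dg; have [_ hg _] := dg.
pose N : R := n.+1%:R; have N1 : 1 <= N by rewrite /N ler1n.
have N0 : 0 <= N by exact: ler0n.
have nN : n%:R <= N by rewrite ler_nat.
have [Z ZE] : exists Z, Z = B * L ^+ n by exists (B * L ^+ n).
have Z0 : 0 <= Z by rewrite ZE mulr_ge0 ?exprn_ge0 // ltW.
have ZD : Z = c * L ^+ n + b * (c * L ^+ n) by rewrite ZE /B; ring.
have cL0 : 0 <= c * L ^+ n by rewrite mulr_ge0 ?exprn_ge0 // ltW.
have wZ z : disc z -> modulus (wprod n z) <= Z.
  by move=> /(wb n) h; apply: (le_trans h); rewrite ZD lerDl mulr_ge0.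
have uZ k z : disc z -> modulus (wprod n z / u (iter k phi z)) <= Z.
  move=> dz; rewrite modulusM modulusV mulrC; apply: (@le_trans _ _ (b * (c * L ^+ n))).
    by apply: ler_pM; rewrite ?invr_ge0 ?modulus_ge0 //; [exact: ub (pn k dz)|exact: wb].
  by rewrite ZD lerDr.
have dwp z : disc z -> _ := @cdiff_wprod n g z hg.
have hp : holomorphic_on_disc (fun z => wprod n z * g z).
  by apply: cdiff_holo => z dz; eexists; exact: dwp.
have hk k : holomorphic_on_disc (uk k g).
  by apply: cdiff_holo => z dz; eexists; exact: cdiffM (holo_cdiff (@huk k) dz) (holo_cdiff hg dz).
pose F i := if i is k.+1 then dres (uk k g) else g.
pose y := 2 * (N * Z) ^+ 2; have y0 : 0 <= y by exact: (mulr_ge0 (ler0n _ 2) (sqr_ge0 _)).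
have sq (x v t : R) : 0 <= x -> x <= v -> 0 <= t -> 2 * (x ^+ 2 * t) <= 2 * v ^+ 2 * t.
  move=> x0 xv t0; rewrite mulrA; apply: (ler_wpM2r t0); apply: ler_wpM2l => //.
  by rewrite ler_pXn2r ?nnegrE // (le_trans x0).
have [] := @Dsq_dominated _ nat (index_iota 0 n.+1) (fun=> y) F _ hp (fun=> y0).
- by case=> [|k]; [exact: dg|exact: (HK k g dg).1].
- move=> z dz; rewrite (cdiff_cderive (dwp z dz)) big_nat_recl //.
  apply: (le_trans (sqr_modulusD _ _)); rewrite modulusN addrC; apply: lerD.
    rewrite modulusM exprMn; apply: sq; rewrite ?modulus_ge0 ?sqr_ge0 //.
    rewrite modulusM; apply: ler_pM (wZ z dz); rewrite ?modulus_ge0 //.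
    have -> : (n%:R - 1 : C) = (n%:R - 1 : R)%:C by rewrite rmorphB rmorph1 rmorph_nat.
    by rewrite modulus_real; have := ler0n R n => n0; abs_lra.
  have := sqr_modulus_sum n (fun k => wprod n z / u (iter k phi z) * cderive (uk k g) z)
    (fun=> @ltr01 R).
  rewrite sumr_const_nat subn0 => h; apply: (le_trans (ler_wpM2l (ler0n _ 2) h)).
  rewrite mulrA mulr_sumr; apply: ler_sum => k _.
  rewrite invr1 mul1r modulusM exprMn (cderive_dres (hk k) dz) /y.
  rewrite mulrA; apply: ler_wpM2r; first exact: sqr_ge0.
  rewrite -mulrA; apply: ler_wpM2l => //; rewrite exprMn; apply: ler_pM.
  + exact: ler0n.
  + exact: sqr_ge0.
  + by apply: (le_trans nN); rewrite expr2 ler_peMl.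
  + by rewrite ler_pXn2r ?nnegrE ?modulus_ge0 //; exact: uZ.
move=> fin le; split; first exact: (dirichlet_dres hp fin).
have g0 := Nsq_ge0 g.
pose T := (1 + K) * N ^+ 2 * Nsq g.
have N2 : 1 <= N ^+ 2 by rewrite exprn_ege1.
have gT : Nsq g <= T.
  by apply: ler_peMl => //; apply: mulr_ege1 => //; rewrite lerDl ltW.
have {}le : Dsq (fun z => wprod n z * g z) <= N * (y * T).
  apply: (le_trans le); rewrite mulr_natl -[X in _ *+ X]subn0 -sumr_const_nat big_nat [leRHS]big_nat.
  apply: ler_sum => -[|k] /andP[_ kn]; apply: ler_wpM2l => //.
    exact: le_trans (Dsq_le_Nsq g) gT.
  apply: (le_trans (HK k g dg).2); apply: ler_wpM2r => //.
  apply: ler_pM; [exact: ltW|exact: exprn_ge0|by rewrite lerDr|].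
  by rewrite ler_pXn2r ?nnegrE ?ler0n // ler_nat ltnW.
have v0 : modulus (wprod n 0 * g 0) ^+ 2 <= N * (y * T).
  apply: (@le_trans _ _ (y * T)); last exact: (ler_peMl (mulr_ge0 y0 (le_trans g0 gT)) N1).
  rewrite modulusM exprMn; apply: ler_pM; rewrite ?sqr_ge0 //.
    apply: (@le_trans _ _ (Z ^+ 2)); first by rewrite ler_pXn2r ?nnegrE ?modulus_ge0 //; exact: wZ.
    rewrite /y exprMn mulrA ler_peMl ?sqr_ge0 //; lra.
  by apply: le_trans gT; rewrite lerDl Dsq_ge0.
rewrite /Nsq dresE // (Dsq_dres hp); apply: (le_trans (lerD v0 le)); apply: le_of_eq.
by rewrite -/N /T /y ZE /Nsq; ring.
Qed.

End Products.
End Iterates.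

(** * Geometrically convergent series in the Dirichlet space *)

Section Series.
Context {R : realType}.
Local Notation C := R[i].
Local Notation plane_type := (measurableTypeR R * measurableTypeR R)%type.
Implicit Types (f g : C -> C) (z w : C) (q D A : R).

Lemma poly_geometric (p : nat) (x y : R) : 0 <= x -> x < y ->
  exists2 K : R, 0 < K & forall n, n.+1%:R ^+ p * x ^+ n <= K * y ^+ n.
Proof.
elim: p y => [|p IH] y x0 xy.
  exists 1 => // n; rewrite expr0 !mul1r lerXn2r ?nnegrE ?(ltW xy) //.
  exact: ltW (le_lt_trans x0 xy).
pose t := (x + y) / 2.
have xt : x < t by rewrite /t; lra.
have ty : t < y by rewrite /t; lra.
have t0 : 0 < t by exact: le_lt_trans xt.
have [K K0 H] := IH t x0 xt.
pose d := y / t - 1.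
have d0 : 0 < d by rewrite subr_gt0 ltr_pdivlMr // mul1r.
have yt : y / t = 1 + d by rewrite addrC subrK.
have bern n : 1 + n%:R * d <= (1 + d) ^+ n.
  elim: n => [|n IHn]; first by rewrite mul0r addr0 expr0.
  rewrite exprS -natr1; apply: le_trans (ler_wpM2l _ IHn); last by lra.
  have := mulr_ge0 (ler0n R n) (mulr_ge0 (ltW d0) (ltW d0)).
  by rewrite !mulrDl !mulrDr !mul1r !mulr1; lra.
exists (K * (1 + d^-1)); first by rewrite mulr_gt0 // addr_gt0 // invr_gt0.
move=> n; rewrite exprS -mulrA.
apply: (@le_trans _ _ (n.+1%:R * (K * t ^+ n))).
  by apply: ler_wpM2l => //; exact: ler0n.
have -> : y ^+ n = t ^+ n * (1 + d) ^+ n.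
  by rewrite -yt -exprMn mulrCA mulfV ?mulr1 // gt_eqF.
have -> : n.+1%:R * (K * t ^+ n) = K * t ^+ n * n.+1%:R by ring.
have -> : K * (1 + d^-1) * (t ^+ n * (1 + d) ^+ n) = K * t ^+ n * ((1 + d^-1) * (1 + d) ^+ n) by ring.
apply: ler_wpM2l; first by rewrite mulr_ge0 ?exprn_ge0 // ltW.
apply: (@le_trans _ _ ((1 + d^-1) * (1 + n%:R * d))); last first.
  by apply: ler_wpM2l => //; rewrite addr_ge0 // invr_ge0 ltW.
have -> : (1 + d^-1) * (1 + n%:R * d) = 1 + d^-1 + n%:R * d + n%:R.
  by field; rewrite gt_eqF.
have := mulr_ge0 (ler0n R n) (ltW d0); have : 0 <= d^-1 by rewrite invr_ge0 ltW.
rewrite -natr1; lra.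
Qed.

Lemma real_series_limit (x : nat -> R) D q : q < 1 ->
  (forall n, `|x n| <= D * q ^+ n) ->
  exists l, forall n, `|l - \sum_(0 <= k < n) x k| <= D / (1 - q) * q ^+ n.
Proof.
move=> q1 H; have p0 : 1 - q != 0 by rewrite subr_eq0 gt_eqF.
pose s n := \sum_(0 <= k < n) x k; pose t n := D / (1 - q) * q ^+ n.
have tS n : t n = t n.+1 + D * q ^+ n by rewrite /t exprS; field.
have sS n : s n.+1 = s n + x n by rewrite /s big_nat_recr.
have step n : s n - t n <= s n.+1 - t n.+1 /\ s n.+1 + t n.+1 <= s n + t n.
  by have := H n; rewrite sS (tS n) ler_norml => /andP[h1 h2]; split; lra.
have mono n k : s n - t n <= s (n + k)%N - t (n + k)%N /\ s (n + k)%N + t (n + k)%N <= s n + t n.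
  elim: k => [|k [h1 h2]]; first by rewrite addn0.
  by have [g1 g2] := step (n + k)%N; rewrite addnS; split; [exact: le_trans g1|exact: le_trans h2].
have t0 n : 0 <= t n.
  have d0 : 0 <= D * q ^+ n by apply: le_trans (H n); exact: normr_ge0.
  by rewrite /t mulrAC divr_ge0 // subr_ge0 ltW.
have ub n k : s k - t k <= s n + t n.
  have [h1 _] := mono k n; have [_ h2] := mono n k.
  rewrite addnC in h2; have := t0 (k + n)%N; lra.
exists (sup [set s k - t k | k in [set: nat]]) => n.
have lo : s n - t n <= sup [set s k - t k | k in [set: nat]].
  apply: ub_le_sup; last by exists n.
  by exists (s 0%N + t 0%N) => _ [k _ <-]; exact: ub.
have hi : sup [set s k - t k | k in [set: nat]] <= s n + t n.
  apply: ge_sup; first by exists (s 0%N - t 0%N); exists 0%N.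
  by move=> _ [k _ <-]; exact: ub.
rewrite -/(s n) -/(t n) ler_norml; apply/andP; split; lra.
Qed.

Lemma complex_series_limit (x : nat -> C) D q : q < 1 ->
  (forall n, modulus (x n) <= D * q ^+ n) ->
  exists l, forall n, modulus (l - \sum_(0 <= k < n) x k) <= 2 * (D / (1 - q) * q ^+ n).
Proof.
move=> q1 H.
have [a Ha] := real_series_limit q1 (fun n => le_trans (Re_le_modulus (x n)) (H n)).
have [b Hb] := real_series_limit q1 (fun n => le_trans (Im_le_modulus (x n)) (H n)).
have ReS n : Re (\sum_(0 <= k < n) x k) = \sum_(0 <= k < n) Re (x k).
  by elim: n => [|n IH]; [rewrite !big_geq|rewrite !big_nat_recr //= Re_add IH].
have ImS n : Im (\sum_(0 <= k < n) x k) = \sum_(0 <= k < n) Im (x k).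
  by elim: n => [|n IH]; [rewrite !big_geq|rewrite !big_nat_recr //= Im_add IH].
exists (a +i* b) => n; apply: (le_trans (modulus_le_ReIm _)).
rewrite Re_add Im_add Re_opp Im_opp ReS ImS mulr_natl mulr2n.
exact: (lerD (Ha n) (Hb n)).
Qed.

Lemma geometric_sum_le q n : 0 < q -> q < 1 -> \sum_(0 <= k < n) q ^+ k <= (1 - q)^-1.
Proof.
move=> q0 q1; have p0 : 0 < 1 - q by rewrite subr_gt0.
have -> : \sum_(0 <= k < n) q ^+ k = (1 - q ^+ n) / (1 - q).
  elim: n => [|n IH]; first by rewrite big_geq // subrr mul0r.
  by rewrite big_nat_recr //= IH exprS; field; rewrite gt_eqF.
apply: ler_piMl; first by rewrite invr_ge0 ltW.
by rewrite gerBl exprn_ge0 // ltW.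
Qed.

Lemma limit_unique (x : nat -> C) (l l' : C) :
  (forall e : R, 0 < e -> exists N, forall n, (N <= n)%N -> modulus (l - x n) <= e) ->
  (forall e : R, 0 < e -> exists N, forall n, (N <= n)%N -> modulus (l' - x n) <= e) ->
  l = l'.
Proof.
move=> h h'; apply/eqP; rewrite -subr_eq0 -modulus_eq0; apply/eqP/le_anti.
rewrite modulus_ge0 andbT; apply/ler_addgt0Pl => e e0; rewrite addr0.
have e20 : 0 < e / 2 by rewrite divr_gt0.
have [N HN] := h _ e20; have [N' HN'] := h' _ e20.
have -> : l - l' = (l - x (maxn N N')) - (l' - x (maxn N N')) by ring.
apply: (le_trans (le_modulusB _ _)); rewrite [e]splitr.
by apply: lerD; [apply: HN|apply: HN']; rewrite ?leq_maxl ?leq_maxr.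
Qed.

Lemma complex_series_limit_uniform (x : nat -> C) q : 0 < q -> q < 1 ->
  (exists D, forall n, modulus (x n) <= D * q ^+ n) ->
  exists l, forall D, (forall n, modulus (x n) <= D * q ^+ n) ->
    forall n, modulus (l - \sum_(0 <= k < n) x k) <= 2 * (D / (1 - q) * q ^+ n).
Proof.
move=> q0 q1 [D0 H0]; have [l Hl] := complex_series_limit q1 H0.
exists l => D H; have [l' Hl'] := complex_series_limit q1 H.
suff -> : l = l' by [].
have lim D1 l1 : (forall n, modulus (l1 - \sum_(0 <= k < n) x k) <= 2 * (D1 / (1 - q) * q ^+ n)) ->
    forall e, 0 < e -> exists N, forall n, (N <= n)%N -> modulus (l1 - \sum_(0 <= k < n) x k) <= e.
  move=> h e e0; have [N HN] := geometric_small (2 * (D1 / (1 - q))) q0 q1 e0.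
  by exists N => n /HN; apply: le_trans; rewrite -mulrA; exact: h.
exact: (limit_unique (lim _ _ Hl) (lim _ _ Hl')).
Qed.

Lemma cdiff_sum (n : nat) (F : nat -> C -> C) z :
  (forall k, holomorphic_on_disc (F k)) -> disc z ->
  cdiff (fun w => \sum_(0 <= k < n) F k w) z (\sum_(0 <= k < n) cderive (F k) z).
Proof.
move=> hF dz; elim: n => [|n IH].
  rewrite big_geq //; apply: (cdiff_near ltr01 _ (cdiff_cst 0 z)) => w _.
  by rewrite big_geq.
rewrite big_nat_recr //=.
apply: (cdiff_near ltr01 _ (cdiffD IH (holo_cdiff (hF n) dz))) => w _.
by rewrite big_nat_recr.
Qed.

Section Limit.
Variables (q : R) (A : R) (F : nat -> C -> C).
Hypotheses (q0 : 0 < q) (q1 : q < 1) (A0 : 0 <= A).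
Hypothesis dF : forall n, dirichlet (F n).
Hypothesis FA : forall n, Nsq (F n) <= A * (q ^+ n) ^+ 2.

Let hF n : holomorphic_on_disc (F n).
Proof. by have [] := dF n. Qed.

Let S n z := \sum_(0 <= k < n) F k z.
Let S' n z := \sum_(0 <= k < n) cderive (F k) z.

Let geometric_bound (r : R) : 0 <= r -> r < 1 -> exists T, forall n z, modulus z <= r ->
  modulus (F n z) <= T * q ^+ n /\ modulus (cderive (F n) z) <= T * q ^+ n.
Proof.
move=> r0 r1; have [B1 B10 H1] := point_Nsq r0 r1; have [B2 B20 H2] := cderive_Dsq r0 r1.
pose T := Num.sqrt ((B1 + B2) * A).
have T2 : T ^+ 2 = (B1 + B2) * A.
  by rewrite sqr_sqrtr // mulr_ge0 // addr_ge0 // ltW.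
have T0 : 0 <= T by exact: sqrtr_ge0.
exists T => n z zr.
have Q0 : 0 <= q ^+ n by rewrite exprn_ge0 // ltW.
have key (v B : R) : 0 <= v -> 0 <= B -> B <= B1 + B2 -> v ^+ 2 <= B * Nsq (F n) ->
    v <= T * q ^+ n.
  move=> v0 B0 BB h; rewrite -(ler_pXn2r (n := 2)) ?nnegrE ?mulr_ge0 // exprMn T2 -mulrA.
  apply: (le_trans h); apply: ler_pM => //; exact: Nsq_ge0.
split.
- by apply: (key _ B1); [exact: modulus_ge0|exact: ltW|rewrite lerDl ltW|exact: H1].
- apply: (key _ B2); [exact: modulus_ge0|exact: ltW|rewrite lerDr ltW //|].
  apply: (le_trans (H2 _ _ (dF n) zr)); apply: ler_wpM2l; [exact: ltW|exact: Dsq_le_Nsq].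
Qed.

(** The termwise differentiated series converges locally uniformly, so that
    the sum of the series is holomorphic with the expected derivative. *)
Lemma series_limit : exists G g : C -> C, forall r : R, 0 <= r -> r < 1 ->
  exists T, forall n z, modulus z <= r ->
    modulus (G z - S n z) <= 2 * (T / (1 - q) * q ^+ n) /\
    modulus (g z - S' n z) <= 2 * (T / (1 - q) * q ^+ n).
Proof.
have sum (X : nat -> C -> C) : (forall z, disc z -> exists T, forall n, modulus (X n z) <= T * q ^+ n) ->
    exists G : C -> C, forall z, disc z -> forall D, (forall n, modulus (X n z) <= D * q ^+ n) ->
      forall n, modulus (G z - \sum_(0 <= k < n) X k z) <= 2 * (D / (1 - q) * q ^+ n).
  move=> HX; have /choice[G HG] z : exists l, disc z -> forall D,
      (forall n, modulus (X n z) <= D * q ^+ n) ->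
      forall n, modulus (l - \sum_(0 <= k < n) X k z) <= 2 * (D / (1 - q) * q ^+ n).
    have [dz|nz] := pselect (disc z); last by exists 0.
    by have [l Hl] := complex_series_limit_uniform q0 q1 (HX z dz); exists l.
  by exists G.
have bound z : disc z -> exists T, forall n, modulus (F n z) <= T * q ^+ n /\
    modulus (cderive (F n) z) <= T * q ^+ n.
  move=> dz; have [T HT] := geometric_bound (modulus_ge0 z) dz.
  by exists T => n; exact: HT.
have [|G HG] := sum F; first by move=> z /bound[T HT]; exists T => n; have [] := HT n.
have [|g Hg] := sum (fun n => cderive (F n)).
  by move=> z /bound[T HT]; exists T => n; have [] := HT n.
exists G, g => r r0 r1; have [T HT] := geometric_bound r0 r1.
exists T => n z zr; have dz : disc z by exact: le_lt_trans r1.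
by split; [apply: HG|apply: Hg] => // k; have [] := HT k z zr.
Qed.

Variables (G g : C -> C).
Hypothesis Gg : forall r : R, 0 <= r -> r < 1 ->
  exists T, forall n z, modulus z <= r ->
    modulus (G z - S n z) <= 2 * (T / (1 - q) * q ^+ n) /\
    modulus (g z - S' n z) <= 2 * (T / (1 - q) * q ^+ n).

Let tail (r e : R) : 0 <= r -> r < 1 -> 0 < e -> exists N, forall n z, (N <= n)%N ->
  modulus z <= r -> modulus (G z - S n z) <= e /\ modulus (g z - S' n z) <= e.
Proof.
move=> r0 r1 e0; have [T HT] := Gg r0 r1.
have [N HN] := geometric_small (2 * (T / (1 - q))) q0 q1 e0.
exists N => n z Nn zr; have [h1 h2] := HT n z zr; have := HN n Nn.
by rewrite -mulrA => h; split; [exact: le_trans h|exact: le_trans h].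
Qed.

Lemma series_cdiff z : disc z -> cdiff G z (g z).
Proof.
move=> dz e e0; pose r := (1 + modulus z) / 2.
have z1 : modulus z < 1 by [].
have zr : modulus z < r by rewrite /r; lra.
have r1 : r < 1 by rewrite /r; lra.
have r0 : 0 <= r by apply: (le_trans (modulus_ge0 z)); exact: ltW.
pose e' := e / 6; have e'0 : 0 < e' by rewrite divr_gt0.
have [N HN] := tail r0 r1 e'0.
have dS n v : disc v -> cdiff (S n) v (S' n v) by exact: cdiff_sum.
have [d d0 Hd] := dS N z dz e' e'0.
exists (minr d (r - modulus z)); first by rewrite lt_min d0 subr_gt0.
move=> w; rewrite lt_min => /andP[/Hd h1 h2].
have wr : modulus w <= r.
  by rewrite -[w](subrK z); apply: (le_trans (le_modulusD _ _)); rewrite -lerBrDr ltW.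
set m := modulus (w - z) in h1 *.
have m0 : 0 <= m by exact: modulus_ge0.
have h3 : modulus ((G w - S N w) - (G z - S N z)) <= 4 * e' * m.
  apply/ler_addgt0Pr => x x0; have [N' HN'] := tail r0 r1 (divr_gt0 x0 (ltr0n _ 2)).
  pose n := maxn N N'.
  have [k1 k2] : (N <= n)%N /\ (N' <= n)%N by rewrite leq_maxl leq_maxr.
  have [a1 _] := HN' n w k2 wr; have [a2 _] := HN' n z k2 (ltW zr).
  have dD v : disc v -> cdiff (fun v => S n v - S N v) v (S' n v - S' N v).
    by move=> dv; apply: cdiffB; exact: dS.
  have hD : holomorphic_on_disc (fun v => S n v - S N v).
    by apply: cdiff_holo => v dv; eexists; exact: dD.
  have bD v : modulus v <= r -> modulus (cderive (fun v => S n v - S N v) v) <= 2 * e'.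
    move=> vr; rewrite (cdiff_cderive (dD v (le_lt_trans vr r1))).
    have [_ b1] := HN n v k1 vr; have [_ b2] := HN N v (leqnn N) vr.
    have -> : S' n v - S' N v = (g v - S' N v) - (g v - S' n v) by ring.
    apply: (le_trans (le_modulusB _ _)); rewrite mulr_natl mulr2n; exact: (lerD b2 b1).
  have mv := mean_value hD r1 (ltW zr) wr bD.
  have -> : G w - S N w - (G z - S N z) =
    (S n w - S N w - (S n z - S N z)) + ((G w - S n w) - (G z - S n z)) by ring.
  apply: modulusD_le.
    by apply: (le_trans mv); rewrite mulrA -natrM.
  by apply: (le_trans (le_modulusB _ _)); rewrite [x]splitr; exact: lerD.
have [_ h4] := HN N z (leqnn N) (ltW zr).
have -> : G w - G z - g z * (w - z) = (G w - S N w - (G z - S N z))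
   + (S N w - S N z - S' N z * (w - z)) - (g z - S' N z) * (w - z) by ring.
have -> : e * m = 4 * e' * m + e' * m + e' * m by rewrite /e'; field.
apply: modulusB_le.
  by exact: modulusD_le.
by rewrite modulusM; apply: ler_wpM2r.
Qed.

Let hG : holomorphic_on_disc G.
Proof. by apply: cdiff_holo => z dz; exists (g z); exact: series_cdiff. Qed.

Let p0 : 0 < 1 - q. Proof. by rewrite subr_gt0. Qed.

(** Cauchy-Schwarz with the weights [q ^+ k] leaves a factor [1 / q ^+ k], which
    the decay [q ^+ (2 * k)] of the squared norms outweighs. *)
Lemma partial_sum_sqr (x : nat -> C) n : modulus (\sum_(0 <= k < n) x k) ^+ 2 <=
  \sum_(0 <= k < n) (1 - q)^-1 * (q ^+ k)^-1 * modulus (x k) ^+ 2.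
Proof.
have qk k : 0 < q ^+ k by exact: exprn_gt0.
apply: (le_trans (sqr_modulus_sum n x qk)); under [leRHS]eq_bigr do rewrite -mulrA.
rewrite -mulr_sumr; apply: ler_wpM2r; last exact: geometric_sum_le.
by apply: sumr_ge0 => k _; rewrite mulr_ge0 ?sqr_ge0 // invr_ge0 ltW.
Qed.

Lemma series_dirichlet_integral : (dirichlet_integral G <= (A / (1 - q) ^+ 2)%:E)%E.
Proof.
pose c k := (1 - q)^-1 * (q ^+ k)^-1.
have c0 k : 0 <= c k by rewrite mulr_ge0 ?invr_ge0 ?exprn_ge0 ?(ltW q0) ?(ltW p0).
pose f k (p : plane_type) := ((c k)%:E * (modulus (cderive (F k) (cpx p)) ^+ 2)%:E)%E.
have f0 k p : (0 <= f k p)%E by rewrite mule_ge0 ?lee_fin ?sqr_ge0.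
have mD : measurable (plane (@disc R)) by apply: copen_measurable; exact: copen_disc.
have mf k : measurable_fun (plane disc) (f k).
  by apply: measurable_funeM; apply: measurable_cderive_sqr; exact: hF.
have E : (energy G <= \sum_(0 <= k <oo) \int[mu2]_(p in plane disc) f k p)%E.
  rewrite -integral_nneseries //; apply: ge0_le_integral => //.
  - by move=> p _; rewrite lee_fin sqr_ge0.
  - exact: (measurable_cderive_sqr hG).
  - by apply: ge0_emeasurable_sum => // k p _; exact: f0.
  move=> p dp; rewrite (cdiff_cderive (series_cdiff dp)).
  apply/lee_addgt0Pr => e e0.
  have Gc : ccont (fun w => w) (g (cpx p)) by exact: cdiff_cont (@cdiff_id _ _).
  have [d d0 Hd] := ccont_modulus_sqr Gc e0.
  have [N HN] := tail (modulus_ge0 (cpx p)) dp (divr_gt0 d0 (ltr0n _ 2)).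
  have [_ h] := HN N (cpx p) (leqnn N) (lexx _).
  have := Hd (S' N (cpx p)); rewrite modulusBC => /(_ _)/wrap[].
    by apply: le_lt_trans h _; rewrite ltr_pdivrMr // ltr_pMr ?ltr1n.
  rewrite ler_norml => /andP[h1 _].
  apply: (@le_trans _ _ ((modulus (S' N (cpx p)) ^+ 2)%:E + e%:E)%E).
    by rewrite -EFinD lee_fin; lra.
  apply: leeD => //.
  apply: (@le_trans _ _ (\sum_(0 <= k < N) f k p)%E).
    rewrite /f; under eq_bigr do rewrite -EFinM.
    by rewrite sumEFin lee_fin; exact: partial_sum_sqr.
  by apply: nneseries_lim_ge => *; exact: f0.
have pi0 : (0 <= (pi^-1)%:E :> \bar R)%E by rewrite lee_fin invr_ge0; exact: pi_ge0.
have E2 : (energy G <= (pi * (A / (1 - q) ^+ 2))%:E)%E.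
  apply: (le_trans E); apply: lime_le.
    by apply: is_cvg_nneseries => k _ _; apply: integral_ge0 => p _; exact: f0.
  apply: nearW => n.
  apply: (@le_trans _ _ (\sum_(0 <= k < n) (c k * (pi * (A * (q ^+ k) ^+ 2)))%:E)%E).
    apply: lee_sum => k _.
    have -> : (\int[mu2]_(p in plane disc) f k p = (c k)%:E * energy (F k))%E.
      rewrite /f /energy; apply: ge0_integralZl.
      - exact: mD.
      - by apply: measurable_cderive_sqr; exact: hF.
      - by move=> p _; rewrite lee_fin sqr_ge0.
      - by rewrite lee_fin.
    rewrite (dirichlet_energyE (dF k)) -EFinM lee_fin.
    apply: ler_wpM2l => //; apply: ler_wpM2l; first exact: pi_ge0.
    by apply: le_trans (FA k); exact: Dsq_le_Nsq.
  rewrite sumEFin lee_fin.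
  have -> : \sum_(0 <= k < n) c k * (pi * (A * (q ^+ k) ^+ 2)) =
      pi * (A / (1 - q)) * \sum_(0 <= k < n) q ^+ k.
    rewrite mulr_sumr; apply: eq_bigr => k _; rewrite /c.
    by field; rewrite expf_neq0 ?gt_eqF.
  have -> : pi * (A / (1 - q) ^+ 2) = pi * (A / (1 - q)) * (1 - q)^-1.
    by field; rewrite gt_eqF.
  apply: ler_wpM2l; last exact: geometric_sum_le.
  by rewrite mulr_ge0 ?pi_ge0 // divr_ge0 // ltW.
rewrite dirichlet_integralE; apply: (le_trans (lee_wpmul2l pi0 E2)).
by rewrite -EFinM mulKf // gt_eqF // pi_gt0.
Qed.

Lemma series_Nsq : dirichlet (dres G) /\ Nsq (dres G) <= 2 / (1 - q) ^+ 2 * A.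
Proof.
have le := series_dirichlet_integral.
have fin : (dirichlet_integral G < +oo)%E by apply: (le_lt_trans le); rewrite ltry.
split; first exact: dirichlet_dres.
rewrite /Nsq Dsq_dres // dresE; last exact: disc0.
have D1 : Dsq G <= A / (1 - q) ^+ 2.
  by rewrite -lee_fin DsqE fineK // ge0_fin_numE // dirichlet_integral_ge0.
have G0 : modulus (G 0) ^+ 2 <= A / (1 - q) ^+ 2.
  apply/ler_addgt0Pr => e e0.
  have Gc : ccont (fun w => w) (G 0) by exact: cdiff_cont (@cdiff_id _ _).
  have [d d0 Hd] := ccont_modulus_sqr Gc e0.
  have [N HN] := tail (lexx 0) ltr01 (divr_gt0 d0 (ltr0n _ 2)).
  have := HN N 0 (leqnn N); rewrite modulus0 lexx => /(_ isT)[h _].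
  have Sd : modulus (S N 0 - G 0) < d.
    by rewrite modulusBC; apply: le_lt_trans h _; rewrite ltr_pdivrMr // ltr_pMr ?ltr1n.
  have := Hd _ Sd; rewrite ler_norml => /andP[h1 _].
  suff : modulus (S N 0) ^+ 2 <= A / (1 - q) ^+ 2 by lra.
  apply: (le_trans (partial_sum_sqr _ _)).
  apply: (@le_trans _ _ (\sum_(0 <= k < N) A / (1 - q) * q ^+ k)).
    apply: ler_sum => k _; have qk : 0 < q ^+ k by exact: exprn_gt0.
    have -> : A / (1 - q) * q ^+ k = (1 - q)^-1 * (q ^+ k)^-1 * (A * (q ^+ k) ^+ 2).
      by field; rewrite !gt_eqF.
    apply: ler_wpM2l; first by rewrite mulr_ge0 ?invr_ge0 ?(ltW qk) ?(ltW p0).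
    by apply: le_trans (FA k); rewrite lerDl Dsq_ge0.
  rewrite -mulr_sumr.
  have -> : A / (1 - q) ^+ 2 = A / (1 - q) * (1 - q)^-1 by field; rewrite gt_eqF.
  apply: ler_wpM2l; last exact: geometric_sum_le.
  by rewrite divr_ge0 // ltW.
have -> : 2 / (1 - q) ^+ 2 * A = A / (1 - q) ^+ 2 + A / (1 - q) ^+ 2 by ring.
exact: lerD.
Qed.

End Limit.

(** Completeness of the Dirichlet space, in the form that the Neumann series
    calls for: the limit is taken pointwise, and the partial sums of [F] converge
    to it. *)
Lemma series_dirichlet q : 0 < q -> q < 1 -> exists2 K : R, 0 < K &
  forall (A : R) (F : nat -> C -> C), 0 <= A -> (forall n, dirichlet (F n)) ->
    (forall n, Nsq (F n) <= A * (q ^+ n) ^+ 2) ->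
    exists G : C -> C, [/\ dirichlet G, Nsq G <= K * A &
      forall z, disc z -> forall e : R, 0 < e -> exists N, forall n, (N <= n)%N ->
        modulus (G z - \sum_(0 <= k < n) F k z) <= e].
Proof.
move=> q0 q1; exists (2 / (1 - q) ^+ 2).
  by rewrite divr_gt0 // exprn_gt0 // subr_gt0.
move=> A F A0 dF FA.
have [G [g Gg]] := series_limit q0 q1 A0 dF FA.
have [dG NG] := series_Nsq q0 q1 A0 dF FA Gg.
exists (dres G); split => // z dz e e0.
have [T HT] := Gg _ (modulus_ge0 z) dz.
have [N HN] := geometric_small (2 * (T / (1 - q))) q0 q1 e0.
exists N => n /HN h; rewrite dresE //; have [h1 _] := HT n z (lexx _).
by apply: (le_trans h1); rewrite mulrA.
Qed.

End Series.

(** * Invertible operators and the Neumann series *)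

Section Operators.
Context {R : realType}.
Local Notation C := R[i].
Local Notation op := ((C -> C) -> (C -> C)).
Implicit Types (f g : C -> C) (z w : C) (T U S : op).

Lemma dirichlet_normE f : dirichlet_norm f = Num.sqrt (Nsq f).
Proof. by rewrite /dirichlet_norm /Nsq DsqE. Qed.

Lemma bounded_operatorI T (M : R) : 0 <= M ->
  (forall f, dirichlet f -> dirichlet (T f)) ->
  (forall (k : C) f g, dirichlet f -> dirichlet g ->
     T (fun z => k * f z + g z) = (fun z => k * T f z + T g z)) ->
  (forall f, dirichlet f -> Nsq (T f) <= M * Nsq f) -> bounded_operator T.
Proof.
move=> M0 dT lT NT; split; [exact: dT|exact: lT|].
exists (Num.sqrt M) => f df; rewrite !dirichlet_normE -sqrtrM //.
by rewrite ler_wsqrtr // NT.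
Qed.

Lemma bounded_operator_Nsq T : bounded_operator T ->
  exists2 M : R, 0 < M & forall f, dirichlet f -> Nsq (T f) <= M * Nsq f.
Proof.
move=> [_ _ [M HM]]; exists (M ^+ 2 + 1); first by rewrite ltr_wpDl ?sqr_ge0.
move=> f df; have := HM f df; rewrite !dirichlet_normE => h.
have e g : Num.sqrt (Nsq g) ^+ 2 = Nsq g by rewrite sqr_sqrtr // Nsq_ge0.
rewrite -(e (T f)) -(e f); have s0 := sqrtr_ge0 (Nsq (T f)).
move: h s0; move: (Num.sqrt _) (Num.sqrt (Nsq f)) => x y h x0.
apply: (@le_trans _ _ ((M * y) ^+ 2)).
  by rewrite ler_pXn2r ?nnegrE // (le_trans x0).
by rewrite exprMn; apply: ler_wpM2r; [exact: sqr_ge0|rewrite lerDl].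
Qed.

Lemma dirichlet_lin1 (k : C) f g : dirichlet f -> dirichlet g ->
  dirichlet (fun z => k * f z + g z).
Proof.
move=> df dg; have [d _] := dirichlet_lin k 1 df dg.
by move: d; congr dirichlet; apply/funext => z; rewrite mul1r.
Qed.

Lemma dirichlet_scale (k : C) f : dirichlet f ->
  dirichlet (fun z => k * f z) /\ Nsq (fun z => k * f z) <= 2 * modulus k ^+ 2 * Nsq f.
Proof.
move=> df; have := dirichlet_lin k 0 df df.
have -> : (fun z => k * f z + 0 * f z) = (fun z => k * f z).
  by apply/funext => z; rewrite mul0r addr0.
by rewrite modulus0 expr0n /= mulr0 mul0r addr0.
Qed.

Lemma bounded_operator_eq T U : (forall f, dirichlet f -> T f = U f) ->
  bounded_operator T -> bounded_operator U.
Proof.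
move=> TU [dT lT [M HM]]; split.
- by move=> f df; rewrite -(TU f df); exact: (dT f df).
- move=> k f g df dg; rewrite -(TU f df) -(TU g dg) -(TU _ (dirichlet_lin1 k df dg)).
  exact: (lT k f g df dg).
- by exists M => f df; rewrite -(TU f df); exact: (HM f df).
Qed.

Lemma bounded_operator_comp T U : bounded_operator T -> bounded_operator U ->
  bounded_operator (fun f => T (U f)).
Proof.
move=> bT bU; have [M M0 HM] := bounded_operator_Nsq bT.
have [N N0 HN] := bounded_operator_Nsq bU.
have [dT lT _] := bT; have [dU lU _] := bU.
apply: (@bounded_operatorI _ (M * N)); first by rewrite mulr_ge0 // ltW.
- by move=> f df; exact: (dT _ (dU _ df)).
- by move=> k f g df dg; rewrite (lU k f g df dg); exact: (lT _ _ _ (dU _ df) (dU _ dg)).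
- move=> f df; apply: (le_trans (HM _ (dU _ df))); rewrite -mulrA.
  by apply: ler_wpM2l; [exact: ltW|exact: HN].
Qed.

Lemma invertible_operator_comp T U : invertible_operator T -> invertible_operator U ->
  invertible_operator (fun f => T (U f)).
Proof.
move=> [bT [T' [bT' T'T TT']]] [bU [U' [bU' U'U UU']]].
have [dT _ _] := bT; have [dU _ _] := bU; have [dT' _ _] := bT'; have [dU' _ _] := bU'.
split; first exact: bounded_operator_comp.
exists (fun f => U' (T' f)); split; first exact: bounded_operator_comp.
- by move=> f df; rewrite (T'T _ (dU _ df)) (U'U _ df).
- by move=> f df; rewrite (UU' _ (dT' _ df)) (TT' _ df).
Qed.

Lemma invertible_operator_eq T U : (forall f, dirichlet f -> T f = U f) ->
  invertible_operator T -> invertible_operator U.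
Proof.
move=> TU [bT [S [bS ST TS]]]; split; first exact: bounded_operator_eq bT.
have [dS _ _] := bS.
exists S; split; first exact: bS.
- by move=> f df; rewrite -(TU f df) (ST f df).
- by move=> f df; rewrite -(TU _ (dS _ df)) (TS f df).
Qed.

Lemma bounded_operator_scale (c : C) : bounded_operator (fun f z => c * f z).
Proof.
apply: (@bounded_operatorI _ (2 * modulus c ^+ 2)); first by rewrite mulr_ge0 ?sqr_ge0.
- by move=> f df; have [] := dirichlet_scale c df.
- by move=> k f g _ _; apply/funext => z; ring.
- by move=> f df; have [] := dirichlet_scale c df.
Qed.

Lemma invertible_operator_scale (c : C) : c != 0 -> invertible_operator (fun f z => c * f z).
Proof.
move=> c0; split; first exact: bounded_operator_scale.
exists (fun f z => c^-1 * f z); split; first exact: bounded_operator_scale.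
- by move=> f _; apply/funext => z; rewrite mulKf.
- by move=> f _; apply/funext => z; rewrite mulVKf.
Qed.

(** As [T] is a weighted composition operator, its series can be summed
    pointwise, and the identities for the inverse hold pointwise. *)
Section Neumann.
Variables (k be : C -> C) (A q : R).
Local Notation T := (weighted_composition k be).
Hypotheses (k_on : on_disc k) (beD : forall z, disc z -> disc (be z)).
Hypothesis dT : forall f, dirichlet f -> dirichlet (T f).
Hypotheses (q0 : 0 < q) (q1 : q < 1) (A0 : 0 <= A).
Hypothesis NT : forall n f, dirichlet f -> Nsq (iter n T f) <= A * (q ^+ n) ^+ 2 * Nsq f.

Let T_lin (c : C) f g : T (fun z => c * f z + g z) = (fun z => c * T f z + T g z).
Proof. by apply/funext => z; rewrite /weighted_composition; ring. Qed.

Let iter_lin n (c : C) f g :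
  iter n T (fun z => c * f z + g z) = (fun z => c * iter n T f z + iter n T g z).
Proof. by elim: n => [//|n IH]; rewrite !iterS IH T_lin. Qed.

Let iter_dir n f : dirichlet f -> dirichlet (iter n T f).
Proof. by move=> df; elim: n => [//|n IH]; rewrite iterS; exact: dT. Qed.

Let limit_of f (G : C -> C) := forall z, disc z -> forall e : R, 0 < e ->
  exists N, forall n, (N <= n)%N -> modulus (G z - \sum_(0 <= j < n) iter j T f z) <= e.

Let limit_eq f G G' : dirichlet G -> dirichlet G' -> limit_of f G -> limit_of f G' -> G = G'.
Proof.
move=> dG dG' l l'; have [onG _ _] := dG; apply: (dirichlet_on_eq dG' _ onG).
by move=> z dz; exact: (limit_unique (l z dz) (l' z dz)).
Qed.

Lemma neumann : invertible_operator (fun f z => f z - T f z).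
Proof.
have [K K0 HK] := series_dirichlet q0 q1.
have /choice[S HS] : forall f, exists G, dirichlet f ->
    [/\ dirichlet G, Nsq G <= K * A * Nsq f & limit_of f G].
  move=> f; have [df|nf] := pselect (dirichlet f); last by exists f.
  have [|n|n|G [dG NG lG]] := HK (A * Nsq f) (fun n => iter n T f).
  - by rewrite mulr_ge0 ?Nsq_ge0.
  - exact: (iter_dir n df).
  - by rewrite mulrAC; exact: (NT n df).
  - by exists G => _; split; [exact: dG|rewrite -mulrA|exact: lG].
have dS f : dirichlet f -> dirichlet (S f) by move=> /HS[].
have lS f : dirichlet f -> limit_of f (S f) by move=> /HS[].
have sub f g : (fun z => f z - g z) = (fun z => -1 * g z + f z).
  by apply/funext => z; rewrite mulN1r addrC.
have Sb : bounded_operator S.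
  apply: (@bounded_operatorI _ (K * A)); first by rewrite mulr_ge0 // ltW.
  - exact: dS.
  - move=> c f g df dg; apply: (@limit_eq (fun z => c * f z + g z)).
    + exact: (dS _ (dirichlet_lin1 c df dg)).
    + exact: (dirichlet_lin1 c (dS _ df) (dS _ dg)).
    + exact: (lS _ (dirichlet_lin1 c df dg)).
    + move=> z dz e e0; pose m := modulus c + 1.
      have m0 : 0 < m by rewrite ltr_wpDl ?modulus_ge0.
      have e1 : 0 < e / 2 / m by rewrite !divr_gt0.
      have e2 : 0 < e / 2 by rewrite divr_gt0.
      have [N1 H1] := lS f df z dz _ e1; have [N2 H2] := lS g dg z dz _ e2.
      exists (maxn N1 N2) => n; rewrite geq_max => /andP[/H1 h1 /H2 h2].
      have -> : \sum_(0 <= j < n) iter j T (fun z => c * f z + g z) z =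
          c * (\sum_(0 <= j < n) iter j T f z) + \sum_(0 <= j < n) iter j T g z.
        by rewrite mulr_sumr -big_split /=; apply: eq_bigr => j _; rewrite iter_lin.
      have E (x y s t : C) : c * x + y - (c * s + t) = c * (x - s) + (y - t) by ring.
      rewrite E.
      rewrite [e]splitr; apply: modulusD_le => //.
      rewrite modulusM; apply: (@le_trans _ _ (m * (e / 2 / m))).
        by apply: ler_pM; rewrite ?modulus_ge0 // lerDl.
      by rewrite mulrC divfK // gt_eqF.
  - by move=> f /HS[].
have Tb : bounded_operator (fun f z => f z - T f z).
  apply: (@bounded_operatorI _ (2 * (A * q ^+ 2) + 2)).
  - by rewrite addr_ge0 // mulr_ge0 // mulr_ge0 ?sqr_ge0.
  - by move=> f df; rewrite sub; exact: (dirichlet_lin1 (-1) (dT df) df).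
  - by move=> c f g df dg; rewrite T_lin; apply/funext => z; ring.
  - move=> f df; have [_ h] := dirichlet_lin (-1) 1 (dT df) df.
    rewrite sub (_ : (fun z => _ + f z) = (fun z => -1 * T f z + 1 * f z)); last first.
      by apply/funext => z; rewrite mul1r.
    apply: (le_trans h); rewrite modulusN modulus1 expr1n !mulr1 [leRHS]mulrDl lerD2r -[leRHS]mulrA.
    by apply: ler_wpM2l => //; have := NT 1 df; rewrite /= expr1.
have sumS f z n : \sum_(0 <= j < n.+1) iter j T f z =
    f z + \sum_(0 <= j < n) iter j T (T f) z.
  rewrite big_nat_recl //=; congr (_ + _); apply: eq_bigr => j _.
  by rewrite -iterS iterSr.
have sumT f z n : \sum_(0 <= j < n.+1) iter j T f z =
    f z + k z * \sum_(0 <= j < n) iter j T f (be z).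
  by rewrite big_nat_recl //= mulr_sumr.
have SfT f : dirichlet f -> (fun z => S f z - T (S f) z) = f.
  move=> df; apply: (dirichlet_on_eq df); last first.
    by move=> z nz; have [onS _ _] := dS f df; rewrite /weighted_composition onS // k_on // mul0r subr0.
  move=> z dz; apply/eqP; rewrite subr_eq; apply/eqP.
  apply: (@limit_unique R (fun n => \sum_(0 <= j < n.+1) iter j T f z)).
    move=> e e0; have [N HN] := lS f df z dz e e0.
    by exists N => n Nn; apply: HN; exact: leqW.
  move=> e e0; pose m := modulus (k z) + 1.
  have m0 : 0 < m by rewrite ltr_wpDl ?modulus_ge0.
  have [N HN] := lS f df (be z) (beD dz) _ (divr_gt0 e0 m0).
  exists N => n /HN h; rewrite sumT opprD addrACA subrr add0r -mulrBr modulusM.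
  apply: (@le_trans _ _ (m * (e / m))); last by rewrite mulrC divfK // gt_eqF.
  by apply: ler_pM; rewrite ?modulus_ge0 // lerDl.
have STf f : dirichlet f -> S (T f) = (fun z => S f z - f z).
  move=> df; apply: (@limit_eq (T f)).
  - exact: (dS _ (dT df)).
  - by rewrite sub; exact: (dirichlet_lin1 (-1) df (dS _ df)).
  - exact: (lS _ (dT df)).
  - move=> z dz e e0; have [N HN] := lS f df z dz e e0.
    exists N => n Nn; have := HN n.+1 (leqW Nn); rewrite sumS.
    by rewrite opprD addrA.
split; first exact: Tb.
exists S; split; first exact: Sb.
- move=> f df; have [_ lS' _] := Sb.
  rewrite sub (lS' _ _ _ (dT df) df).
  by rewrite (STf f df); apply/funext => z; ring.
- exact: SfT.
Qed.

End Neumann.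
End Operators.

(** * Orbits of a hyperbolic automorphism *)

Section Orbits.
Context {R : realType}.
Local Notation C := R[i].
Implicit Types (z w : C).

(** A geometric sequence [Q] visits the window from [d] to [1 / d] at most [m]
    times, so that all but [m] factors of the product are at most [L]. *)
Lemma window_product (ka d L b c : R) (m : nat) : 0 < ka -> ka <= 1 -> 0 < d -> 0 < L ->
  1 <= c -> b <= c * L -> ka ^+ m * d^-1 < d ->
  forall (n : nat) (Q v : nat -> R), (forall k, Q k.+1 = ka * Q k) -> (forall k, 0 <= Q k) ->
    (forall k, 0 <= v k <= b) -> (forall k, Q k < d \/ d^-1 < Q k -> v k <= L) ->
    \prod_(0 <= k < n) v k <= c ^+ m * L ^+ n.
Proof.
move=> ka0 ka1 d0 L0 c1 bcL md.
have c0 : 0 <= c by exact: le_trans ler01 c1.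
have below j : forall (n : nat) (Q v : nat -> R), (forall k, Q k.+1 = ka * Q k) -> (forall k, 0 <= Q k) ->
    (forall k, 0 <= v k <= b) -> (forall k, Q k < d \/ d^-1 < Q k -> v k <= L) ->
    ka ^+ j * Q 0%N < d -> \prod_(0 <= k < n) v k <= c ^+ j * L ^+ n.
  move=> n; elim: n j => [|n IH] j Q v QS Q0 vb vL jd.
    by rewrite big_geq // expr0 mulr1 exprn_ege1.
  rewrite big_nat_recl //.
  have v0 : 0 <= v 0%N by have /andP[] := vb 0%N.
  have rest i : ka ^+ i * Q 1%N < d -> \prod_(0 <= k < n) v k.+1 <= c ^+ i * L ^+ n.
    move=> h; exact: (IH i (fun k => Q k.+1) (fun k => v k.+1) (fun k => QS k.+1)
      (fun k => Q0 k.+1) (fun k => vb k.+1) (fun k => vL k.+1) h).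
  have P0 : 0 <= \prod_(0 <= k < n) v k.+1.
    by apply: prodr_ge0 => k _; have /andP[] := vb k.+1.
  case: j jd => [|j] jd.
    have h0 : v 0%N <= L by apply: vL; left; move: jd; rewrite expr0 mul1r.
    rewrite expr0 mul1r exprS; apply: ler_pM => //.
    rewrite -[leRHS]mul1r -[1 in leRHS](expr0 c); apply: rest; rewrite expr0 mul1r QS.
    by apply: (@le_lt_trans _ _ (Q 0%N)); [apply: ler_piMl|move: jd; rewrite expr0 mul1r].
  have h0 : v 0%N <= c * L by have /andP[_ h] := vb 0%N; exact: le_trans bcL.
  have -> : c ^+ j.+1 * L ^+ n.+1 = (c * L) * (c ^+ j * L ^+ n) by rewrite !exprS; ring.
  by apply: ler_pM => //; apply: rest; rewrite QS mulrA -exprSr.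
elim=> [|n IH] Q v QS Q0 vb vL; first by rewrite big_geq // expr0 mulr1 exprn_ege1.
have [h|h] := leP (Q 0%N) d^-1.
  apply: (below m _ Q) => //; apply: le_lt_trans md.
  by apply: ler_wpM2l => //; rewrite exprn_ge0 // ltW.
rewrite big_nat_recl //.
have -> : c ^+ m * L ^+ n.+1 = L * (c ^+ m * L ^+ n) by rewrite exprS; ring.
apply: ler_pM.
- by have /andP[] := vb 0%N.
- by apply: prodr_ge0 => k _; have /andP[] := vb k.+1.
- by apply: vL; right.
- exact: (IH (fun k => Q k.+1) (fun k => v k.+1) (fun k => QS k.+1)
    (fun k => Q0 k.+1) (fun k => vb k.+1) (fun k => vL k.+1)).
Qed.

(** In the coordinate [(z - a) / (z - b)] an automorphism that fixes [a] and
    [b] is multiplication by a constant. *)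
Lemma fixed_points_ratio (phi : C -> C) (p a b : C) (theta : R) : disc p ->
  (forall z, modulus z <= 1 -> phi z = disc_automorphism p theta z) ->
  circle a -> circle b -> phi a = a -> phi b = b ->
  exists2 ka : R, 0 < ka & forall z, disc z ->
    modulus (phi z - a) / modulus (phi z - b) = ka * (modulus (z - a) / modulus (z - b)).
Proof.
move=> dp phiE ca cb pa pb.
have a1 : modulus a <= 1 by rewrite ca.
have b1 : modulus b <= 1 by rewrite cb.
have da := moebius_den dp a1; have db := moebius_den dp b1.
exists (modulus (1 - (p^*)%R * b) / modulus (1 - (p^*)%R * a)).
  by rewrite divr_gt0 // modulus_gt0.
move=> z dz; have z1 : modulus z <= 1 by exact: ltW.
have dzz := moebius_den dp z1.
have E c : modulus c <= 1 -> phi c = c -> 1 - (p^*)%R * c != 0 ->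
    modulus (phi z - c) = modulus (z - c) * modulus ((p^*)%R * p - 1) /
      (modulus (1 - (p^*)%R * z) * modulus (1 - (p^*)%R * c)).
  move=> c1 pc dc; rewrite -{1}pc !phiE // /disc_automorphism -mulrBr modulusM.
  rewrite modulus_cos_sin mul1r -!modulusM -modulusV -modulusM.
  congr modulus; move: dzz dc; move: (p^*)%R => s dzz dc.
  by field; rewrite dzz dc.
rewrite (E a) // (E b) //.
have ne c : circle c -> modulus (z - c) != 0.
  rewrite modulus_eq0 subr_eq0 => cc; apply/eqP => zc.
  by move: dz; rewrite zc /disc /= cc ltxx.
have zb := ne b cb.
have pp : modulus ((p^*)%R * p - 1) != 0.
  by rewrite modulusBC modulus_eq0; exact: conj_mul_disc.
by field; rewrite ?zb ?pp ?modulus_eq0 ?dzz ?da ?db.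
Qed.

Lemma attractive_small (phi : C -> C) (a : C) z (e : R) : attractive_fixed_point phi a ->
  disc z -> 0 < e -> exists n, modulus (iter n phi z - a) < e.
Proof.
move=> [_ _ H] dz e0.
have : nbhs (a : C^o) [set w | modulus (w - a) < e] by apply/nbhs_modulusP; exists e.
by move=> /(H z dz)[n _ Hn]; exists n; apply: (Hn n) => /=.
Qed.

(** The quotient of the distances to [a] and to [b] decreases geometrically along
    an orbit, at a rate that does not depend on the orbit.  Where the quotient is
    less than [d] the orbit is close to [a], where it exceeds [1 / d] it is close
    to [b], and between these it stays for at most [m] steps. *)
Lemma orbit_product (phi al u : C -> C) (p a b : C) (theta B L r : R) :
  disc p -> (forall z, modulus z <= 1 -> phi z = disc_automorphism p theta z) ->
  autpair phi al -> attractive_fixed_point phi a -> circle b -> phi b = b -> a != b ->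
  (forall z, disc z -> modulus (u z) <= B) -> 0 < L -> 0 < r ->
  (forall z, disc z -> modulus (z - a) < r -> modulus (u z) <= L) ->
  (forall z, disc z -> modulus (z - b) < r -> modulus (u z) <= L) ->
  exists2 c : R, 0 < c & forall n z, disc z -> modulus (wprod phi u n z) <= c * L ^+ n.
Proof.
move=> dp phiE pa att cb pb ab uB L0 r0 ua ub.
have [ca fa _] := att.
have [ka ka0 Hka] := fixed_points_ratio dp phiE ca cb fa pb.
have dn n z : disc z -> disc (iter n phi z) by exact: (autpairD (autpair_iter n pa)).
pose Q z n := modulus (iter n phi z - a) / modulus (iter n phi z - b).
have QS z : disc z -> forall n, Q z n.+1 = ka * Q z n.
  by move=> dz n; rewrite /Q iterS Hka //; exact: dn.
have Q0 z n : 0 <= Q z n by rewrite divr_ge0 ?modulus_ge0.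
have ne z c : disc z -> circle c -> 0 < modulus (z - c).
  move=> dz cc; rewrite modulus_gt0 subr_eq0; apply/eqP => zc.
  by move: dz; rewrite zc /disc /= cc ltxx.
(* Otherwise the orbit of [0], where the quotient is [1], could not converge to
   [a]. *)
have ka1 : ka < 1.
  rewrite ltNge; apply/negP => ka1.
  have Q1 n : 1 <= Q 0 n.
    elim: n => [|n IH].
      by rewrite /Q /= !sub0r !modulusN ca cb divr1.
    by rewrite QS; [apply: (le_trans IH); rewrite ler_peMl|exact: disc0].
  have D0 : 0 < modulus (a - b) by rewrite modulus_gt0 subr_eq0.
  have [n Hn] := attractive_small att (@disc0 R) (divr_gt0 D0 (ltr0n _ 2)).
  have := Q1 n; rewrite /Q ler_pdivlMr ?mul1r; last by apply: ne => //; exact: dn (@disc0 R).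
  have := le_modulusD (a - iter n phi 0) (iter n phi 0 - b).
  rewrite addrA subrK (modulusBC a); lra.
pose d := r / 2; have d0 : 0 < d by rewrite divr_gt0.
have dd0 : 0 < d * d / 2 by rewrite divr_gt0 // mulr_gt0.
have [m Hm] := geometric_small 1 ka0 ka1 dd0.
have md : ka ^+ m * d^-1 < d.
  rewrite ltr_pdivrMr //; have := Hm m (leqnn m); rewrite mul1r => h.
  apply: le_lt_trans h _; rewrite ltr_pdivrMr // ltr_pMr ?mulr_gt0 ?ltr1n //.
pose c := maxr 1 (B / L).
have c1 : 1 <= c by rewrite le_max lexx.
have bcL : B <= c * L by rewrite -ler_pdivrMr // le_max lexx orbT.
exists (c ^+ m); first by rewrite exprn_gt0 // (lt_le_trans ltr01).
move=> n z dz.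
have -> : modulus (wprod phi u n z) = \prod_(0 <= k < n) modulus (u (iter k phi z)).
  rewrite /wprod; elim: n => [|n IH]; first by rewrite !big_geq // modulus1.
  by rewrite !big_nat_recr //= modulusM IH.
apply: (@window_product ka d L B c m ka0 (ltW ka1) d0 L0 c1 bcL md n (Q z)
  (fun k => modulus (u (iter k phi z))) (QS z dz) (Q0 z)).
  by move=> k; rewrite modulus_ge0 uB //; exact: dn.
have two w e : disc w -> circle e -> modulus (w - e) < 2.
  move=> dw ce; apply: (le_lt_trans (le_modulusB _ _)); rewrite ce.
  by have : modulus w < 1 by []; lra.
move=> k; have dk := dn k z dz; have pb0 := ne _ _ dk cb.
rewrite /Q => -[h|h].
  apply: ua => //; move: h; rewrite ltr_pdivrMr // => h; apply: (lt_le_trans h).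
  have -> : r = d * 2 by rewrite /d divfK.
  by apply: ler_wpM2l; [exact: ltW|exact: ltW (two _ _ dk cb)].
apply: ub => //; move: h; rewrite ltr_pdivlMr // mulrC ltr_pdivrMr // => h.
apply: (lt_le_trans h); rewrite mulrC; have -> : r = d * 2 by rewrite /d divfK.
by apply: ler_wpM2l; [exact: ltW|exact: ltW (two _ _ dk ca)].
Qed.

(** A multiplier is bounded by its multiplier norm: compare the powers of the
    multiplier with the bound for point evaluation. *)
Lemma multiplier_bounded (u : C -> C) (M : R) : 0 < M ->
  (forall g, dirichlet g -> dirichlet (fun z => u z * g z) /\
     Nsq (fun z => u z * g z) <= M * Nsq g) ->
  forall z, disc z -> modulus (u z) ^+ 2 <= M.
Proof.
move=> M0 uM z dz; rewrite leNgt; apply/negP => h.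
have [d1 N1] := @dirichlet1 R.
have pw n : dirichlet (fun w => u w ^+ n * dres (fun=> 1) w) /\
    Nsq (fun w => u w ^+ n * dres (fun=> 1) w) <= M ^+ n.
  elim: n => [|n [dn Nn]].
    have -> : (fun w => u w ^+ 0 * dres (fun=> 1) w) = dres (fun=> 1 : C).
      by apply/funext => w; rewrite expr0 mul1r.
    by split; [exact: d1|rewrite N1].
  have [d2 N2] := uM _ dn.
  have -> : (fun w => u w ^+ n.+1 * dres (fun=> 1) w) =
     (fun w => u w * (u w ^+ n * dres (fun=> 1) w)).
    by apply/funext => w; rewrite exprS mulrA.
  split; first exact: d2.
  by apply: (le_trans N2); rewrite exprS; apply: ler_wpM2l => //; exact: ltW.
have [B B0 HB] := point_Nsq (modulus_ge0 z) dz.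
have [K K0 HK] := poly_geometric 1 (ltW M0) h.
pose n := Num.bound (K * B).
have KB : 0 <= K * B by rewrite mulr_ge0 // ltW.
have : n.+1%:R * M ^+ n <= K * B * M ^+ n.
  have := HK n; rewrite expr1 => /le_trans; apply; rewrite -mulrA.
  apply: ler_wpM2l; first exact: ltW.
  have [dn Nn] := pw n; have := HB _ z dn (lexx _).
  rewrite dresE // mulr1 modulusX -exprM mulnC exprM => /le_trans; apply.
  by apply: ler_wpM2l => //; exact: ltW.
rewrite ler_pM2r ?exprn_gt0 // leNgt => /negP; apply.
by apply: (lt_trans (archi_boundP KB)); rewrite ltr_nat.
Qed.

End Orbits.

(** * Weighted composition operators *)

Section WeightedComposition.
Context {R : realType}.
Local Notation C := R[i].
Local Notation W := weighted_composition.
Implicit Types (f g h k : C -> C) (z : C).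

Lemma wprodSl (phi u : C -> C) n z : wprod phi u n.+1 z = u z * wprod phi u n (phi z).
Proof.
rewrite /wprod big_nat_recl //=; congr (_ * _); apply: eq_bigr => j _.
by rewrite -iterS iterSr.
Qed.

(** Multiplication by the weight is the weighted composition operator applied to
    the composition with the inverse automorphism. *)
Lemma weight_multiplier k (be ga : C -> C) : autpair be ga -> on_disc k ->
  bounded_operator (W k be) ->
  exists2 M : R, 0 < M & forall g, dirichlet g ->
    dirichlet (fun z => k z * g z) /\ Nsq (fun z => k z * g z) <= M * Nsq g.
Proof.
move=> pa ok bW; have [dW _ _] := bW; have [M M0 HM] := bounded_operator_Nsq bW.
have [B B0 HB] := iterate_Nsq (autpair_sym pa).
exists (M * (B * 2%:R ^+ 2)); first by rewrite !mulr_gt0.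
move=> g dg; have [d1 N1] := HB 1%N g dg.
have -> : (fun z => k z * g z) = W k be (dres (fun z => g (iter 1 ga z))).
  apply/funext => z; rewrite /W; have [dz|nz] := pselect (disc z); last by rewrite ok // !mul0r.
  by rewrite dresE /= ?(autpairK pa) //; exact: (autpairD pa dz).
split; first exact: (dW _ d1).
apply: (le_trans (HM _ d1)); rewrite -[leRHS]mulrA.
by apply: ler_wpM2l; [exact: ltW|exact: N1].
Qed.

Lemma weight_bounded k (be ga : C -> C) : autpair be ga -> on_disc k ->
  bounded_operator (W k be) ->
  exists2 B : R, 0 < B & forall z, disc z -> modulus (k z) <= B.
Proof.
move=> pa ok bW; have [M M0 HM] := weight_multiplier pa ok bW.
exists (Num.sqrt M); first by rewrite sqrtr_gt0.
move=> z dz; have := multiplier_bounded M0 HM dz; have := modulus_ge0 (k z).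
clear HM; move: (modulus (k z)) => x x0 xM.
by rewrite -[leLHS]ger0_norm // -sqrtr_sqr ler_wsqrtr.
Qed.

Lemma neumann_growth k (be : C -> C) (p : nat) (K x : R) : on_disc k ->
  (forall z, disc z -> disc (be z)) -> 0 <= x -> x < 1 -> 0 <= K ->
  (forall n f, dirichlet f -> dirichlet (iter n (W k be) f) /\
     Nsq (iter n (W k be) f) <= K * n.+1%:R ^+ p * (x ^+ n) ^+ 2 * Nsq f) ->
  invertible_operator (fun f z => f z - W k be f z).
Proof.
move=> ok beD x0 x1 K0 H; pose q := (1 + x) / 2.
have q0 : 0 < q by rewrite /q; lra.
have q1 : q < 1 by rewrite /q; lra.
have xq : x ^+ 2 < q ^+ 2 by rewrite ltr_pXn2r ?nnegrE ?(ltW q0) //; rewrite /q; lra.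
have [A A0 HA] := poly_geometric p (sqr_ge0 x) xq.
have dT f : dirichlet f -> dirichlet (W k be f) by move=> df; have [d _] := H 1%N f df; exact: d.
have KA : 0 <= K * A by rewrite mulr_ge0 // ltW.
apply: (neumann ok beD dT q0 q1 KA) => n f df; have [_ h] := H n f df; apply: (le_trans h).
apply: ler_wpM2r; first exact: Nsq_ge0.
rewrite -!mulrA; apply: ler_wpM2l; first exact: K0.
by have := HA n; rewrite -!exprM !(mulnC 2).
Qed.

(** The [n]th iterate multiplies [f o be^n] by the product of the weight along [n]
    steps of an orbit: its norm is at most a polynomial in [n] times [L ^+ n]. *)
Lemma invertible_of_orbit_products k (be ga : C -> C) (b c L : R) (t : C) : autpair be ga -> on_disc k ->
  bounded_operator (W k be) -> (forall z, disc z -> k z != 0) ->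
  (forall z, disc z -> (modulus (k z))^-1 <= b) -> 0 < c -> 0 < L ->
  (forall n z, disc z -> modulus (wprod be k n z) <= c * L ^+ n) ->
  modulus t * L < 1 ->
  invertible_operator (fun f z => f z - t * W k be f z).
Proof.
move=> pa ok bW k0 kb c0 L0 wb tL.
have [M M0 kM] := weight_multiplier pa ok bW.
have hk : holomorphic_on_disc k.
  have [d1 _] := @dirichlet1 R; have [[_ h _] _] := kM _ d1.
  by apply: holo_eq h => z dz; rewrite dresE // mulr1.
have [K K0 HK] := wprod_Nsq pa hk kM k0 kb M0 c0 L0 wb.
have [B B0 HB] := iterate_Nsq pa.
have E n f : dirichlet f -> iter n (W (fun z => t * k z) be) f =
    (fun z => t ^+ n * dres (fun z => wprod be k n z * dres (fun z => f (iter n be z)) z) z).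
  move=> [of_ _ _]; apply/funext => z.
  have -> : iter n (W (fun z => t * k z) be) f z = t ^+ n * (wprod be k n z * f (iter n be z)).
    elim: n z => [|n IH] z; first by rewrite wprod0 !mul1r.
    by rewrite iterS {1}/W IH wprodSl iterSr exprS; ring.
  have [dz|nz] := pselect (disc z); first by rewrite !dresE.
  rewrite dres_on // mulr0; case: n => [|n]; first by rewrite /= of_ // !mulr0.
  by rewrite wprodSl ok // !mul0r mulr0.
have otk : on_disc (fun z => t * k z) by move=> z nz; rewrite ok // mulr0.
have beD z : disc z -> disc (be z) by exact: autpairD pa.
have tL0 : 0 <= modulus t * L by rewrite mulr_ge0 ?modulus_ge0 // ltW.
have KB0 : 0 <= 2 * K * B by rewrite !mulr_ge0 // ltW.
have TE f : dirichlet f ->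
    (fun z => f z - W (fun z => t * k z) be f z) = (fun z => f z - t * W k be f z).
  by move=> df; apply/funext => z; rewrite /W mulrA.
apply: (invertible_operator_eq TE).
apply: (neumann_growth (p := 7) otk beD tL0 tL KB0) => n f df; rewrite (E n f df).
have [d1 N1] := HB n f df; have [d2 N2] := HK n _ d1.
have [d3 N3] := dirichlet_scale (t ^+ n) d2; split; first exact: d3.
apply: (le_trans N3); rewrite modulusX [in leRHS](exprMn n).
have T0 : 0 <= 2 * (modulus t ^+ n) ^+ 2 by rewrite mulr_ge0 ?sqr_ge0.
have S0 : 0 <= K * n.+1%:R ^+ 5 * (L ^+ n) ^+ 2.
  by rewrite mulr_ge0 ?sqr_ge0 // mulr_ge0 ?exprn_ge0 // ltW.
apply: (le_trans (ler_wpM2l T0 (le_trans N2 (ler_wpM2l S0 N1)))).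
apply: le_of_eq.
by move: (Nsq f) (modulus t ^+ n) (L ^+ n) (n.+1%:R : R) => *; ring.
Qed.

Lemma ratio_between (x y : R) : 0 <= x -> x < y ->
  exists s, [/\ 0 < s, s < y, x < s, x * s^-1 < 1 & y^-1 * s < 1].
Proof.
move=> x0 xy; have s0 : 0 < (x + y) / 2 by lra.
have y0 : 0 < y by exact: le_lt_trans xy.
by exists ((x + y) / 2); split; rewrite ?ltr_pdivrMr ?mul1r ?ltr_pdivrMl ?mulr1 //; lra.
Qed.

Lemma wprod_reverse (phi al k : C -> C) n z : (forall z, disc z -> disc (phi z)) ->
  (forall z, disc z -> al (phi z) = z) -> disc z ->
  wprod al k n (iter n phi z) = wprod phi (fun z => k (phi z)) n z.
Proof.
move=> pD pK dz; have dn n' : disc (iter n' phi z) by elim: n' => [//|n' IH]; exact: pD IH.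
elim: n => [|n IH]; first by rewrite !wprod0.
by rewrite wprodSl wprodS iterS pK // IH mulrC.
Qed.

(** The inverse of a weighted composition operator is one, with the inverse
    automorphism. *)
Lemma inverse_weighted_composition h (phi al : C -> C) : autpair phi al -> on_disc h ->
  invertible_operator (W h phi) -> exists k : C -> C,
    [/\ on_disc k, forall z, disc z -> h z * k (phi z) = 1, bounded_operator (W k al)
      & forall f, dirichlet f -> W h phi (W k al f) = f].
Proof.
move=> pa oh [bW [S [bS SW WS]]]; have [dS _ _] := bS.
have [d1 _] := @dirichlet1 R.
have h0 z : disc z -> h z != 0.
  move=> dz; apply/eqP => hz; have := congr1 (fun f => f z) (WS _ d1).
  by rewrite /W hz mul0r dresE // => /eqP; rewrite eq_sym oner_eq0.
pose k := dres (fun z => (h (al z))^-1); have ok : on_disc k by exact: dres_on.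
have kE z : disc z -> k z = (h (al z))^-1 by exact: dresE.
have SE f : dirichlet f -> S f = W k al f.
  move=> df; have [oS _ _] := dS f df; apply/funext => z; rewrite /W.
  have [dz|nz] := pselect (disc z); last by rewrite oS // ok // mul0r.
  have da : disc (al z) by exact: autpairD (autpair_sym pa) dz.
  have <- := congr1 (fun f => f (al z)) (WS f df).
  by rewrite /W (autpairK (autpair_sym pa)) // kE // mulKf // h0.
exists k; split.
- exact: ok.
- move=> z dz; rewrite kE ?(autpairK pa) ?mulfV ?h0 //; exact: autpairD pa dz.
- exact: bounded_operator_eq SE bS.
- by move=> f df; rewrite -(SE f df) (WS f df).
Qed.

End WeightedComposition.

(** * The spectrum *)

Section Spectrum.
Context {R : realType}.
Local Notation C := R[i].
Variables (phi h : C -> C) (a b ha hb : C).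
Hypotheses (phi_hyp : hyperbolic_automorphism phi) (a_attr : attractive_fixed_point phi a)
  (b_rep : repelling_fixed_point phi b) (h_mult : multiplier h)
  (h_at_a : disc_limit h a ha) (h_at_b : disc_limit h b hb)
  (W_inv : invertible_operator (weighted_composition h phi)).
Local Notation W := (weighted_composition h phi).

(** Close to [a] and [b] the modulus of [h] lies between any two numbers that
    enclose its values there. *)
Let near_fixed_points (s t : R) : s < minr (modulus ha) (modulus hb) ->
  maxr (modulus ha) (modulus hb) < t ->
  exists2 r, 0 < r & forall z, disc z -> modulus (z - a) < r \/ modulus (z - b) < r ->
    s <= modulus (h z) <= t.
Proof.
rewrite lt_min gt_max => /andP[sa sb] /andP[ta tb].
have near c l : disc_limit h c l -> s < modulus l -> modulus l < t ->
    exists2 r, 0 < r & forall z, disc z -> modulus (z - c) < r -> s <= modulus (h z) <= t.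
  move=> /disc_limitP H sl lt; pose e := minr (modulus l - s) (t - modulus l).
  have e0 : 0 < e by rewrite lt_min !subr_gt0 sl.
  have [r r0 Hr] := H _ e0; exists r => // z dz zr.
  have := Hr z dz zr; rewrite lt_min => /andP[h1 h2].
  have h3 := modulus_sub_ge l (h z); have h4 := modulus_sub_ge (h z) l.
  by rewrite modulusBC in h3; apply/andP; split; lra.
have [r1 r10 H1] := near a ha h_at_a sa ta; have [r2 r20 H2] := near b hb h_at_b sb tb.
exists (minr r1 r2); first by rewrite lt_min r10.
by move=> z dz; rewrite !lt_min => -[/andP[z1 _]|/andP[_ z2]]; [exact: H1|exact: H2].
Qed.

(** For [l] of modulus greater than the maximum, [W - l = (- l) (1 - W / l)], and
    the products of [h] along the orbits grow more slowly than the powers of [l].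
    For [l] of modulus less than the minimum, [W - l = W (1 - l W^-1)], and the
    same holds for the weight of [W^-1], whose products along the orbits of the
    inverse are those of [1 / h] along the orbits of [phi], read backwards. *)
Lemma spectrum_annulus l : spectrum W l ->
  minr (modulus ha) (modulus hb) <= modulus l <= maxr (modulus ha) (modulus hb).
Proof.
have [p [theta [dp _ _ phiE]]] := phi_hyp.
have [al pa] : exists al, autpair phi al.
  eexists; apply: autpair_eq (autpair_disc_automorphism theta dp) => z dz.
  by rewrite phiE // ltW.
have pa' := autpair_sym pa.
have phiD z : disc z -> disc (phi z) by exact: autpairD pa.
have alD z : disc z -> disc (al z) by exact: autpairD pa'.
have [oh _] := h_mult; have [cb fb nb] := b_rep; have [bW _] := W_inv.
have ab : a != b by apply/eqP => E; apply: nb; rewrite -E.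
have [k [ok hk bV WV]] := inverse_weighted_composition pa oh W_inv.
have hk' z : disc z -> h (al z) * k z = 1.
  by move=> dz; have := hk _ (alD z dz); rewrite (autpairK pa').
have [Bh Bh0 hB] := weight_bounded pa oh bW.
have [Bk Bk0 kB] := weight_bounded pa' ok bV.
have hV z : disc z -> h z != 0 /\ (modulus (h z))^-1 = modulus (k (phi z)).
  by move=> dz; exact: modulus_mul_eq1 (hk z dz).
have kV z : disc z -> k z != 0 /\ (modulus (k z))^-1 = modulus (h (al z)).
  by move=> dz; apply: modulus_mul_eq1; rewrite mulrC; exact: (hk' z dz).
have m0 : 0 <= maxr (modulus ha) (modulus hb) by rewrite le_max modulus_ge0.
move=> sl; apply/andP; split; rewrite leNgt; apply/negP => lt; apply: sl.
- have [s [s0 s1 _ ls _]] := ratio_between (modulus_ge0 l) lt.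
  have m1 : maxr (modulus ha) (modulus hb) < maxr (modulus ha) (modulus hb) + 1 by rewrite ltrDl.
  have [r r0 Hr] := near_fixed_points s1 m1.
  have L0 : 0 < s^-1 by rewrite invr_gt0.
  have uB z : disc z -> modulus (k (phi z)) <= Bk by move=> dz; exact: kB (phiD z dz).
  have us z : disc z -> modulus (z - a) < r \/ modulus (z - b) < r -> modulus (k (phi z)) <= s^-1.
    move=> dz zr; have [h0 <-] := hV z dz; have /andP[hs _] := Hr z dz zr.
    have hp : 0 < modulus (h z) by rewrite modulus_gt0; exact: h0.
    rewrite lef_pV2 ?posrE; [exact: hs|exact: hp|exact: s0].
  have [c c0 wb] := orbit_product dp phiE pa a_attr cb fb ab uB L0 r0
    (fun z dz za => us z dz (or_introl za)) (fun z dz zb => us z dz (or_intror zb)).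
  have wb' n z : disc z -> modulus (wprod al k n z) <= c * s^-1 ^+ n.
    move=> dz; have pn := autpair_iter n pa'.
    rewrite -(autpairK pn dz) (wprod_reverse k n phiD _ (autpairD pn dz)).
      exact: wb (autpairD pn dz).
    by move=> w dw; exact: autpairK pa dw.
  have k0 z : disc z -> k z != 0 by move=> /kV[].
  have kb z : disc z -> (modulus (k z))^-1 <= Bh.
    by move=> dz; have [_ ->] := kV z dz; exact: hB (alD z dz).
  have inv := invertible_operator_comp W_inv (invertible_of_orbit_products pa' ok bV k0 kb c0 L0 wb' ls).
  apply: invertible_operator_eq inv => f df; apply/funext => z.
  have := congr1 (fun g => g z) (WV f df); rewrite /weighted_composition => E.
  by rewrite mulrBr mulrCA E.
- have [L [L0 Ll L1 _ ls]] := ratio_between m0 lt; rewrite -modulusV in ls.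
  have l0 : 0 < modulus l by exact: lt_trans Ll.
  have m1 : minr (modulus ha) (modulus hb) - 1 < minr (modulus ha) (modulus hb).
    by rewrite ltrBlDr ltrDl.
  have [r r0 Hr] := near_fixed_points m1 L1.
  have us z : disc z -> modulus (z - a) < r \/ modulus (z - b) < r -> modulus (h z) <= L.
    by move=> dz zr; have /andP[] := Hr z dz zr.
  have [c c0 wb] := orbit_product dp phiE pa a_attr cb fb ab hB L0 r0
    (fun z dz za => us z dz (or_introl za)) (fun z dz zb => us z dz (or_intror zb)).
  have h0 z : disc z -> h z != 0 by move=> /hV[].
  have hb' z : disc z -> (modulus (h z))^-1 <= Bk.
    by move=> dz; have [_ ->] := hV z dz; exact: kB (phiD z dz).
  have l1 : l != 0 by rewrite -modulus_gt0.
  have l2 : - l != 0 by rewrite oppr_eq0.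
  have inv := invertible_operator_comp (invertible_operator_scale l2)
    (invertible_of_orbit_products pa oh bW h0 hb' c0 L0 wb ls).
  apply: invertible_operator_eq inv => f df; apply/funext => z.
  by rewrite mulrBr !mulNr (mulVKf l1) opprK addrC.
Qed.

End Spectrum.

Theorem theorem3p3 (R : realType) (phi h : R[i] -> R[i])
    (a b ha hb : R[i]) (mu : R)
    (phi_hyp : hyperbolic_automorphism phi)
    (a_attr : attractive_fixed_point phi a)
    (b_rep : repelling_fixed_point phi b)
    (h_mult : multiplier h)
    (h_at_a : disc_limit h a ha)
    (h_at_b : disc_limit h b hb)
    (mu_gt0 : 0 < mu) (mu_lt1 : mu < 1)
    (phi_conj : conjugate_on_disc phi (psi_automorphism mu))
    (W_inv : invertible_operator (weighted_composition h phi)) :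
  (spectral_radius (weighted_composition h phi)
     <= (Num.max (modulus ha) (modulus hb) / mu)%:E)%E
  /\ spectrum (weighted_composition h phi) `<=`
       [set lambda : R[i] |
         Num.min (modulus ha) (modulus hb) * mu <= modulus lambda
         /\ modulus lambda <= Num.max (modulus ha) (modulus hb) / mu].
Proof.
have min0 : 0 <= minr (modulus ha) (modulus hb) by rewrite le_min !modulus_ge0.
have max0 : 0 <= maxr (modulus ha) (modulus hb) by rewrite le_max modulus_ge0.
have sub l : spectrum (weighted_composition h phi) l ->
    minr (modulus ha) (modulus hb) * mu <= modulus l
    /\ modulus l <= maxr (modulus ha) (modulus hb) / mu.
  move=> sl; have /andP[h1 h2] :=
    spectrum_annulus phi_hyp a_attr b_rep h_mult h_at_a h_at_b W_inv sl.
  split; first by apply: le_trans h1; exact: ler_piMr (ltW mu_lt1).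
  apply: (le_trans h2); rewrite ler_pdivlMr //; exact: ler_piMr (ltW mu_lt1).
split; last exact: sub.
by apply: ge_ereal_sup => _ [l sl <-]; rewrite lee_fin; have [_ ] := sub l sl.
Qed.
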